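(* Let $k$ be a finite field of odd characteristic, let $E/k$ be a quadratic extension, and let $\psi$ be a non-trivial additive character of $k$. Let $G=\mathrm{Sp}_4(k)$ (respectively $G=\mathrm{U}_4(k)$), let $J\subset G$ be the Fourier-Jacobi subgroup, $J\cong\mathrm{SL}_2(k)\ltimes\mathscr{H}$ (respectively $J\cong\mathrm{U}_2(k)\ltimes\mathscr{H}_E$, where $\mathscr{H}_E$ is the Heisenberg group of the form $E^2\oplus k$), and let $\omega_\psi$ be the Weil representation of $J$. Let $\pi$ be an irreducible representation of $\mathrm{SL}_2(k)$ (respectively $\mathrm{U}_2(k)$) which is not fully induced from the Borel subgroup, regarded as a representation of $J$ via the projection $J\to\mathrm{SL}_2(k)$ (respectively $J\to\mathrm{U}_2(k)$). Then $\mathrm{Ind}_J^G(\pi\otimes\omega_\psi)$ is multiplicity free.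
   Context: All representations are finite-dimensional and complex; a representation is multiplicity free if every irreducible representation occurs in it with multiplicity at most one. $q=|k|$; $\epsilon$ is the unique non-trivial quadratic character of $k^\times$; $x\mapsto\bar x$ is the non-trivial element of $\mathrm{Gal}(E/k)$, $\mathrm{Nm}(x)=x\bar x$, $\mathrm{Tr}(x)=x+\bar x$. $J_n$ denotes the $n\times n$ matrix with $1$'s on the anti-diagonal and $0$ elsewhere, and $\mathrm{Sp}_{2n}(k)=\{g\in\mathrm{GL}_{2n}(k): g\begin{pmatrix}&J_n\\-J_n&\end{pmatrix}{}^tg=\begin{pmatrix}&J_n\\-J_n&\end{pmatrix}\}$, $\mathrm{U}_{2n}(k)=\{g\in\mathrm{GL}_{2n}(E): g\begin{pmatrix}&J_n\\-J_n&\end{pmatrix}{}^t\bar g=\begin{pmatrix}&J_n\\-J_n&\end{pmatrix}\}$. In particular $\mathrm{Sp}_2(k)=\mathrm{SL}_2(k)$. Fully induced: for $\mathrm{SL}_2(k)$, $I(\chi)$ is the representation induced from the upper triangular Borel subgroup of the character $\begin{pmatrix}a&b\\&a^{-1}\end{pmatrix}\mapsto\chi(a)$, $\chi$ a character of $k^\times$. For $\mathrm{U}_2(k)$, $I(\chi)$ is induced from the upper triangular Borel subgroup (torus $\{\mathrm{diag}(a,\bar a^{-1}):a\in E^\times\}$) of the character $\chi$ of $E^\times$, extended trivially to the unipotent radical. An irreducible $\pi$ is fully induced from the Borel subgroup if $\pi\cong I(\chi)$ for some $\chi$. Symplectic case. $\mathscr{H}=k^2\oplus k$ with law $[x_1,y_1,z_1]+[x_2,y_2,z_2]=[x_1+x_2,y_1+y_2,z_1+z_2+x_1y_2-x_2y_1]$;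 $\mathrm{SL}_2(k)$ acts on $(x,y)$ by right multiplication and trivially on $z$, and the product in $\mathrm{SL}_2(k)\ltimes\mathscr{H}$ is $(g_1,h_1)(g_2,h_2)=(g_1g_2,h_1.g_2+h_2)$. $J\subset\mathrm{Sp}_4(k)$ is the subgroup of matrices $\begin{pmatrix}1&*&*\\&g&*\\&&1\end{pmatrix}$ in $\mathrm{Sp}_4(k)$ with $g\in\mathrm{SL}_2(k)$, identified with $\mathrm{SL}_2(k)\ltimes\mathscr{H}$ via $(g,[x,y,z])\mapsto\mathrm{diag}(1,g,1)\begin{pmatrix}1&x&y&z\\&1&0&y\\&&1&-x\\&&&1\end{pmatrix}$. $\omega_\psi$ acts on $\mathcal{S}(k)=\{\phi:k\to\mathbb{C}\}$ by $\omega_\psi([x,0,z])\phi(\xi)=\psi(z)\phi(\xi+x)$, $\omega_\psi([0,y,0])\phi(\xi)=\psi(2\xi y)\phi(\xi)$, $\omega_\psi(\mathrm{diag}(a,a^{-1}))\phi(\xi)=\epsilon(a)\phi(a\xi)$, $\omega_\psi\left(\begin{pmatrix}1&b\\&1\end{pmatrix}\right)\phi(\xi)=\psi(b\xi^2)\phi(\xi)$, $\omega_\psi\left(\begin{pmatrix}&b\\-b^{-1}&\end{pmatrix}\right)\phi(\xi)=\gamma(b,\psi)^{-1}\sum_{x\in k}\psi(2bx\xi)\phi(x)$, with $\gamma(b,\psi)=\sum_{x\in k}\psi(-bx^2)$. Unitary case. $\mathscr{H}_E=E^2\oplus k$ with law $[u_1,t_1]+[u_2,t_2]=[u_1+u_2,t_1+t_2+\tfrac12\mathrm{Tr}(\langle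 u_1,u_2\rangle)]$, where $\langle(x_1,y_1),(x_2,y_2)\rangle=x_1\bar y_2-y_1\bar x_2$; $\mathrm{U}_2(k)$ acts on $u\in E^2$ (row vectors) by right multiplication and trivially on $t$, with the same semi-direct product convention. $J\subset\mathrm{U}_4(k)$ is the subgroup of matrices $\begin{pmatrix}1&*&*\\&g&*\\&&1\end{pmatrix}$ in $\mathrm{U}_4(k)$ with $g\in\mathrm{U}_2(k)$, identified with $\mathrm{U}_2(k)\ltimes\mathscr{H}_E$ via $(g,[(x,y),z])\mapsto\mathrm{diag}(1,g,1)\begin{pmatrix}1&x&y&z-\frac12\bar xy+\frac12x\bar y\\&1&0&\bar y\\&&1&-\bar x\\&&&1\end{pmatrix}$. $\omega_\psi$ acts on $\mathcal{S}(E)=\{f:E\to\mathbb{C}\}$ by $\omega_\psi([x,0,z])f(\xi)=\psi(z)f(\xi+x)$ ($x\in E,z\in k$), $\omega_\psi([0,y,0])f(\xi)=\psi(\mathrm{Tr}(\bar y\xi))f(\xi)$ ($y\in E$), $\omega_\psi(\mathrm{diag}(a,\bar a^{-1}))f(\xi)=f(a\xi)$ ($a\in E^\times$), $\omega_\psi\left(\begin{pmatrix}1&b\\&1\end{pmatrix}\right)f(\xi)=\psi(\mathrm{Nm}(\xi)b)f(\xi)$ ($b\in k$), $\omega_\psi\left(\begin{pmatrix}&1\\-1&\end{pmatrix}\right)f(\xi)=-q^{-1}\sum_{y\in E}\psi(\mathrm{Tr}(\bar y\xi))f(y)$. *)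

(* Defs.v *)
From HB Require Import structures.
From mathcomp Require Import all_boot all_order all_algebra all_fingroup.
From mathcomp Require Import all_solvable all_field all_character.

Set Implicit Arguments.
Unset Strict Implicit.
Unset Printing Implicit Defensive.

Import Order.TTheory GroupScope GRing.Theory Num.Theory.
Local Open Scope ring_scope.

(* Representations are over algC, and multiplicities and isomorphism classes  *)
(* are read off characters, induction being 'Ind.                             *)

Section Matrices.
Variable R : pzRingType.

Definition mx_of_rows n (rows : seq (seq R)) : 'M[R]_n :=
  \matrix_(i, j) nth 0 (nth [::] rows i) j.

Definition antidiag n : 'M[R]_n := \matrix_(i, j) (i + j == n.-1)%N%:R.

Definition symp_form n : 'M[R]_(n + n) :=
  block_mx 0 (antidiag n) (- antidiag n) 0.

(* The shape (1 * * ; 0 g * ; 0 0 1), with block sizes 1, 2, 1 and g          *)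
(* arbitrary; [mid_block] extracts g.                                         *)
Definition mid_block (M : 'M[R]_(1 + (2 + 1))) : 'M[R]_2 :=
  ulsubmx (drsubmx M).

Definition FJ_shape (M : 'M[R]_(1 + (2 + 1))) : bool :=
  [&& ulsubmx M == 1%:M, dlsubmx M == 0,
      dlsubmx (drsubmx M) == 0 & drsubmx (drsubmx M) == 1%:M].

Definition diag_1g1 (g : 'M[R]_2) : 'M[R]_(1 + (2 + 1)) :=
  block_mx 1%:M 0 0 (block_mx g 0 0 1%:M).

End Matrices.

Arguments antidiag {R} n.
Arguments symp_form {R} n.

Section FJShapeTheory.
Variable R : pzRingType.
Implicit Types M N : 'M[R]_(1 + (2 + 1)).

Lemma FJ_shapeE M : FJ_shape M ->
  M = block_mx 1%:M (ursubmx M) 0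
        (block_mx (mid_block M) (ursubmx (drsubmx M)) 0 1%:M).
Proof.
case/and4P=> /eqP M1 /eqP M2 /eqP M3 /eqP M4.
by rewrite -[LHS]submxK M1 M2 -[drsubmx M in LHS]submxK M3 M4.
Qed.

Lemma FJ_shape1 : FJ_shape (1%:M : 'M[R]_(1 + (2 + 1))).
Proof.
rewrite /FJ_shape (scalar_mx_block 1 (2 + 1)) block_mxKul block_mxKdl.
by rewrite block_mxKdr (scalar_mx_block 2 1) block_mxKdl block_mxKdr !eqxx.
Qed.

Lemma mid_block1 : mid_block (1%:M : 'M[R]_(1 + (2 + 1))) = 1%:M.
Proof.
by rewrite /mid_block (scalar_mx_block 1 (2 + 1)) block_mxKdr
  (scalar_mx_block 2 1) block_mxKul.
Qed.

Lemma FJ_shape_mul M N : FJ_shape M -> FJ_shape N ->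
  FJ_shape (M *m N) /\ mid_block (M *m N) = mid_block M *m mid_block N.
Proof.
move=> /FJ_shapeE-> /FJ_shapeE->.
set a := ursubmx M; set b := ursubmx (drsubmx M); set g := mid_block M.
set a' := ursubmx N; set b' := ursubmx (drsubmx N); set g' := mid_block N.
rewrite !mulmx_block !mulmx1 !mul1mx !mul0mx !mulmx0 !addr0 !add0r.
by rewrite /FJ_shape /mid_block !(block_mxKul, block_mxKdr, block_mxKdl) !eqxx.
Qed.

End FJShapeTheory.

Lemma diag_1g1_unit (R : comUnitRingType) (g : 'M[R]_2) :
  g \in unitmx -> diag_1g1 g \in unitmx.
Proof. by rewrite !unitmxE !det_ublock !det1 mulr1 mul1r. Qed.

(* The element of GL_n with underlying matrix M (junk value 1 if M is not     *)
(* invertible).                                                               *)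
Definition to_GL n (R : finComUnitRingType) (M : 'M[R]_n.-1.+1) : {'GL_n[R]} :=
  insubd (sT := {'GL_n[R]}) 1%g M.

Lemma to_GLE n (R : finComUnitRingType) (M : 'M[R]_n.-1.+1) :
  M \in unitmx -> GLval (to_GL M) = M.
Proof. by move=> uM; apply: (@insubdK _ _ {'GL_n[R]}). Qed.

Lemma GLval_inj n (R : finComUnitRingType) : injective (@GLval n R).
Proof. exact: val_inj. Qed.

Section Characters.

Definition additive_char (k : finFieldType) (psi : k -> algC) : Prop :=
  psi 0 = 1 /\ forall x y, psi (x + y) = psi x * psi y.

Definition nontrivial_additive_char (k : finFieldType) (psi : k -> algC) :=
  additive_char psi /\ exists x, psi x != 1.

(* A character of the multiplicative group of R; its value at 0 is junk.      *)
Record mult_char (R : finFieldType) := MultChar {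
  mult_char_fun :> R -> algC;
  mult_char1 : mult_char_fun 1 = 1;
  mult_charM : forall a b, a != 0 -> b != 0 ->
    mult_char_fun (a * b) = mult_char_fun a * mult_char_fun b }.

Definition nontrivial_quadratic_char (R : finFieldType) (eps : mult_char R) :=
  (forall a : R, a != 0 -> eps a ^+ 2 = 1) /\
  (exists2 a : R, a != 0 & eps a != 1).

End Characters.

Section Representations.
Variable gT : finGroupType.

Definition multiplicity_free (G : {group gT}) (phi : 'CF(G)) : Prop :=
  forall i : Iirr G, '[phi, 'chi_i] <= 1.

(* The pullback of a representation of H along a homomorphism p : J -> H.     *)
Lemma pullback_mx_repr (hT : finGroupType) (J : {group gT}) (H : {group hT})
    (p : gT -> hT) (pM : {in J &, {morph p : u v / (u * v)%g}})
    (pH : {in J, forall u, p u \in H}) d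
    (rho : mx_representation algC H d) :
  mx_repr J (fun u => rho (p u)).
Proof.
have p1: p 1%g = 1%g.
  by apply: (mulgI (p 1%g)); rewrite mulg1 -{3}[1%g]mulg1 pM ?group1.
split=> [|u v Ju Jv]; first by rewrite p1 repr_mx1.
by rewrite pM // repr_mxM ?pH.
Qed.

Definition pullback_repr hT J H p pM pH d rho :=
  MxRepresentation (@pullback_mx_repr hT J H p pM pH d rho).

End Representations.

(* A matrix indexed by (the enumeration of) a finite set X, acting on the     *)
(* left on the space of functions X -> C.                                     *)
Definition fun_act (X : finType) (A : 'M[algC]_#|X|) (f : X -> algC) (x : X)
    : algC :=
  \sum_(y : X) A (enum_rank x) (enum_rank y) * f y.

(* Principal series. [T] is SL_2 or U_2; in both cases the diagonal torus is  *)
(* parametrised by the upper left entry.                                      *)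
Section PrincipalSeries.
Variables (R : finFieldType) (T : {group {'GL_2[R]}}).

Definition borel : {set {'GL_2[R]}} :=
  [set g in T | GLval g ord_max ord0 == 0].

Lemma mul_upper (g h : 'M[R]_2) : h ord_max ord0 = 0 ->
  (g *m h) ord0 ord0 = g ord0 ord0 * h ord0 ord0 /\
  (g *m h) ord_max ord0 = g ord_max ord0 * h ord0 ord0.
Proof.
have E: lift ord0 ord0 = ord_max :> 'I_2 by apply: val_inj.
by move=> h0; rewrite !mxE !big_ord_recl !big_ord0 E h0 !mulr0 !addr0.
Qed.

Lemma borel_group_set : group_set borel.
Proof.
apply/group_setP; split=> [|g h]; first by rewrite inE group1 GL_1E mxE eqxx.
rewrite !inE => /andP[Tg /eqP g0] /andP[Th /eqP h0]; rewrite groupM //=.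
by have [_ ->] := mul_upper (GLval g) h0; rewrite g0 mul0r.
Qed.
Canonical borel_group := Group borel_group_set.

Lemma borel_neq0 g : g \in borel -> GLval g ord0 ord0 != 0.
Proof.
rewrite inE => /andP[_ /eqP g0]; apply: contraNneq (GL_det g) => g00.
have E: lift ord0 ord0 = ord_max :> 'I_2 by apply: val_inj.
rewrite (expand_det_col (GLval g) ord0) !big_ord_recl big_ord0 E.
by rewrite g0 g00 !mul0r !addr0.
Qed.

Lemma borel_mx_repr (chi : mult_char R) :
  mx_repr borel (fun g => (chi (GLval g ord0 ord0))%:M : 'M[algC]_1).
Proof.
split=> [|g h Bg Bh]; first by rewrite !mxE mult_char1.
rewrite -scalar_mxM -mult_charM ?borel_neq0 //.
by move: Bh; rewrite inE => /andP[_ /eqP /(mul_upper (GLval g))[<- _]].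
Qed.

Definition borel_repr chi := MxRepresentation (borel_mx_repr chi).

(* The character of I(chi).                                                   *)
Definition principal_series chi : 'CF(T) := 'Ind[T] (cfRepr (borel_repr chi)).

Definition fully_induced d (pi : mx_representation algC T d) : Prop :=
  exists chi : mult_char R, cfRepr pi = principal_series chi.

End PrincipalSeries.

Section Symplectic.
Variable k : finFieldType.

Definition symp_mx n (g : 'M[k]_(n + n)) : bool :=
  g *m symp_form n *m g^T == symp_form n.

Definition SL2 : {set {'GL_2[k]}} :=
  [set g | \det (GLval g) == 1].

Lemma SL2_group_set : group_set SL2.
Proof.
apply/group_setP; split=> [|g h]; first by rewrite inE det1.
by rewrite !inE /= => /eqP dg /eqP dh; rewrite det_mulmx dg dh mulr1.
Qed.
Canonical SL2_group := Group SL2_group_set.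

Definition Sp4 : {set {'GL_4[k]}} :=
  [set g : {'GL_4[k]} | symp_mx (n := 2) (GLval g)].

Lemma Sp4_group_set : group_set Sp4.
Proof.
apply/group_setP; split=> [|g h].
  by rewrite inE /symp_mx mul1mx trmx1 mulmx1.
rewrite !inE /symp_mx GL_MxE => /eqP Sg /eqP Sh.
by rewrite trmx_mul !mulmxA -2!(mulmxA (GLval g)) Sh Sg.
Qed.
Canonical Sp4_group := Group Sp4_group_set.

Definition J_Sp : {set {'GL_4[k]}} :=
  [set u in Sp4 | FJ_shape (GLval u) &
                  [exists g in SL2, mid_block (GLval u) == GLval g]].

Definition proj_Sp (u : {'GL_4[k]}) : {'GL_2[k]} :=
  to_GL (n := 2) (mid_block (GLval u)).

Lemma proj_SpE u : u \in J_Sp -> GLval (proj_Sp u) = mid_block (GLval u).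
Proof.
rewrite inE => /and3P[_ _ /existsP[g /andP[_ /eqP E]]].
by rewrite to_GLE // E; apply: GL_unitmx.
Qed.

Lemma J_Sp_group_set : group_set J_Sp.
Proof.
apply/group_setP; split=> [|u v].
  rewrite inE group1 GL_1E FJ_shape1; apply/existsP; exists 1%g.
  by rewrite group1 mid_block1 /=.
rewrite ![_ \in J_Sp]inE => /and3P[Su Fu /existsP[g /andP[Sg /eqP Eg]]].
case/and3P=> [Sv Fv /existsP[h /andP[Sh /eqP Eh]]].
rewrite groupM // GL_MxE; have [-> E] := FJ_shape_mul Fu Fv.
by apply/existsP; exists (g * h)%g; rewrite groupM //= E Eg Eh.
Qed.
Canonical J_Sp_group := Group J_Sp_group_set.

Lemma proj_SpM : {in J_Sp &, {morph proj_Sp : u v / (u * v)%g}}.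
Proof.
move=> u v Ju Jv; apply: GLval_inj.
rewrite GL_MxE !proj_SpE ?groupM // GL_MxE.
move: Ju Jv; rewrite !inE => /and3P[_ Fu _] /and3P[_ Fv _].
by have [_ ->] := FJ_shape_mul Fu Fv.
Qed.

Lemma proj_SpP : {in J_Sp, forall u, proj_Sp u \in SL2}.
Proof.
move=> u Ju; have E := proj_SpE Ju; move: Ju.
rewrite inE => /and3P[_ _ /existsP[g /andP[Sg /eqP Eg]]].
by suff ->: proj_Sp u = g by []; apply: GLval_inj; rewrite E Eg.
Qed.

Definition lift_Sp d (pi : mx_representation algC SL2 d) :
    mx_representation algC J_Sp d :=
  @pullback_repr _ _ J_Sp_group SL2_group proj_Sp proj_SpM proj_SpP d pi.

(* The element (g, [x, y, z]) of SL_2 |x H, seen in J.                        *)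
Definition heis_Sp (x y z : k) : 'M[k]_4 := mx_of_rows 4
  [:: [:: 1; x; y; z  ];
      [:: 0; 1; 0; y  ];
      [:: 0; 0; 1; - x];
      [:: 0; 0; 0; 1  ] ].

Definition elt_Sp (g : 'M[k]_2) (x y z : k) : {'GL_4[k]} :=
  to_GL (n := 4) (diag_1g1 g *m heis_Sp x y z).

Lemma heis_Sp_unit (x y z : k) : heis_Sp x y z \in unitmx.
Proof.
rewrite unitmxE -det_tr det_trig; last first.
  apply/is_trig_mxP=> i j; rewrite !mxE.
  by case: i => [[|[|[|[|i]]]] lti] //; case: j => [[|[|[|[|j]]]] ltj].
by rewrite !big_ord_recl big_ord0 !mxE /= !mulr1 unitr1.
Qed.

Lemma elt_SpE (g : 'M[k]_2) x y z : g \in unitmx ->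
  GLval (elt_Sp g x y z) = diag_1g1 g *m heis_Sp x y z.
Proof.
by move=> ug; rewrite to_GLE // unitmx_mul diag_1g1_unit ?heis_Sp_unit.
Qed.

Definition gauss_sum (psi : k -> algC) (b : k) : algC :=
  \sum_(x : k) psi (- (b * x ^+ 2)).

(* omega is the Weil representation on functions; the elements below generate *)
(* J, so their values determine it.                                           *)
Definition is_Weil_Sp (eps : mult_char k) (psi : k -> algC)
    (omega : mx_representation algC J_Sp #|k|) : Prop :=
  let act g x y z := fun_act (omega (elt_Sp g x y z)) in
  [/\ forall x z phi xi,
        act 1%:M x 0 z phi xi = psi z * phi (xi + x),
      forall y phi xi,
        act 1%:M 0 y 0 phi xi = psi (2%:R * xi * y) * phi xi,
      forall a phi xi, a != 0 ->
        act (mx_of_rows 2 [:: [:: a; 0]; [:: 0; a^-1] ]) 0 0 0 phi xi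
          = eps a * phi (a * xi),
      forall b phi xi,
        act (mx_of_rows 2 [:: [:: 1; b]; [:: 0; 1] ]) 0 0 0 phi xi
          = psi (b * xi ^+ 2) * phi xi
    & forall b phi xi, b != 0 ->
        act (mx_of_rows 2 [:: [:: 0; b]; [:: - b^-1; 0] ]) 0 0 0 phi xi
          = (gauss_sum psi b)^-1
            * \sum_(x : k) psi (2%:R * b * x * xi) * phi x].

End Symplectic.

(* E is carried by [finvect_type E], which is E with its finite field         *)
(* structure; [s] is an element of Gal(E / k), and is the conjugation         *)
(* x |-> \bar x when it is not trivial.                                       *)
Section Unitary.
Variables (k : finFieldType) (E0 : fieldExtType k).
Local Notation E := (finvect_type E0).
Variable s : gal_of {: E}.

Definition unitary_mx n (g : 'M[E]_(n + n)) : bool :=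
  g *m symp_form n *m (map_mx s g)^T == symp_form n.

Lemma unitary_mx1 n : unitary_mx (1%:M : 'M_(n + n)).
Proof. by rewrite /unitary_mx map_mx1 trmx1 mul1mx mulmx1. Qed.

Lemma unitary_mxM n (g h : 'M_(n + n)) :
  unitary_mx g -> unitary_mx h -> unitary_mx (g *m h).
Proof.
rewrite /unitary_mx => /eqP Ug /eqP Uh.
by rewrite map_mxM trmx_mul !mulmxA -2!(mulmxA g) Uh Ug.
Qed.

Definition U2 : {set {'GL_2[E]}} :=
  [set g : {'GL_2[E]} | unitary_mx (n := 1) (GLval g)].

Lemma U2_group_set : group_set U2.
Proof.
apply/group_setP; split=> [|g h]; rewrite !inE; first exact: unitary_mx1.
exact: unitary_mxM.
Qed.
Canonical U2_group := Group U2_group_set.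

Definition U4 : {set {'GL_4[E]}} :=
  [set g : {'GL_4[E]} | unitary_mx (n := 2) (GLval g)].

Lemma U4_group_set : group_set U4.
Proof.
apply/group_setP; split=> [|g h]; rewrite !inE; first exact: unitary_mx1.
exact: unitary_mxM.
Qed.
Canonical U4_group := Group U4_group_set.

Definition J_U : {set {'GL_4[E]}} :=
  [set u in U4 | FJ_shape (GLval u) &
                 [exists g in U2, mid_block (GLval u) == GLval g]].

Definition proj_U (u : {'GL_4[E]}) : {'GL_2[E]} :=
  to_GL (n := 2) (mid_block (GLval u)).

Lemma proj_UE u : u \in J_U -> GLval (proj_U u) = mid_block (GLval u).
Proof.
rewrite inE => /and3P[_ _ /existsP[g /andP[_ /eqP Eg]]].
by rewrite to_GLE // Eg; apply: GL_unitmx.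
Qed.

Lemma J_U_group_set : group_set J_U.
Proof.
apply/group_setP; split=> [|u v].
  rewrite inE group1 GL_1E FJ_shape1; apply/existsP; exists 1%g.
  by rewrite group1 mid_block1 /=.
rewrite ![_ \in J_U]inE => /and3P[Su Fu /existsP[g /andP[Sg /eqP Eg]]].
case/and3P=> [Sv Fv /existsP[h /andP[Sh /eqP Eh]]].
rewrite groupM // GL_MxE; have [-> Em] := FJ_shape_mul Fu Fv.
by apply/existsP; exists (g * h)%g; rewrite groupM //= Em Eg Eh.
Qed.
Canonical J_U_group := Group J_U_group_set.

Lemma proj_UM : {in J_U &, {morph proj_U : u v / (u * v)%g}}.
Proof.
move=> u v Ju Jv; apply: GLval_inj.
rewrite GL_MxE !proj_UE ?groupM // GL_MxE.
move: Ju Jv; rewrite !inE => /and3P[_ Fu _] /and3P[_ Fv _].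
by have [_ ->] := FJ_shape_mul Fu Fv.
Qed.

Lemma proj_UP : {in J_U, forall u, proj_U u \in U2}.
Proof.
move=> u Ju; have Eu := proj_UE Ju; move: Ju.
rewrite inE => /and3P[_ _ /existsP[g /andP[Sg /eqP Eg]]].
by suff ->: proj_U u = g by []; apply: GLval_inj; rewrite Eu Eg.
Qed.

Definition lift_U d (pi : mx_representation algC U2 d) :
    mx_representation algC J_U d :=
  @pullback_repr _ _ J_U_group U2_group proj_U proj_UM proj_UP d pi.

(* The element (g, [(x, y), z]) of U_2 |x H_E, seen in J.                     *)
Definition heis_U (x y : E) (z : k) : 'M[E]_4 := mx_of_rows 4
  [:: [:: 1; x; y; z%:A - 2%:R^-1 * s x * y + 2%:R^-1 * x * s y];
      [:: 0; 1; 0; s y  ];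
      [:: 0; 0; 1; - s x];
      [:: 0; 0; 0; 1    ] ].

Definition elt_U (g : 'M[E]_2) (x y : E) (z : k) : {'GL_4[E]} :=
  to_GL (n := 4) (diag_1g1 g *m heis_U x y z).

Lemma heis_U_unit (x y : E) (z : k) : heis_U x y z \in unitmx.
Proof.
rewrite unitmxE -det_tr det_trig; last first.
  apply/is_trig_mxP=> i j; rewrite !mxE.
  by case: i => [[|[|[|[|i]]]] lti] //; case: j => [[|[|[|[|j]]]] ltj].
by rewrite !big_ord_recl big_ord0 !mxE /= !mulr1 unitr1.
Qed.

Lemma elt_UE (g : 'M[E]_2) x y z : g \in unitmx ->
  GLval (elt_U g x y z) = diag_1g1 g *m heis_U x y z.
Proof.
by move=> ug; rewrite to_GLE // unitmx_mul diag_1g1_unit ?heis_U_unit.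
Qed.

(* The element of k with image x in E (junk value 0 if there is none).        *)
Definition to_base (x : E) : k := odflt 0 [pick t : k | t%:A == x].

Lemma to_baseE (x : E) : x \in 1%VS -> (to_base x)%:A = x.
Proof.
case/vlineP=> t Dx; rewrite /to_base; case: pickP => [u /eqP//|/(_ t)].
by rewrite Dx eqxx.
Qed.

Definition trE (x : E) : k := to_base (x + s x).
Definition nmE (x : E) : k := to_base (x * s x).

Lemma gal_quad : \dim {: E} = 2%N -> s != 1%g ->
  'Gal({: E} / 1)%g = [set 1%g; s].
Proof.
move=> E2 s1; apply/esym/eqP.
have galE := finField_galois (sub1v {: E}%AS).
rewrite eqEcard cards2 eq_sym s1 -(galois_dim galE) dimv1 divn1 E2 andbT.
apply/subsetP=> t _.
rewrite gal_kHom ?sub1v //; apply/kAHomP => x /vlineP[a ->].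
by rewrite linearZ /= rmorph1.
Qed.

Lemma trEE x : \dim {: E} = 2%N -> s != 1%g -> (trE x)%:A = x + s x.
Proof.
move=> E2 s1; apply: to_baseE.
have := mem_galTrace (finField_galois (sub1v {: E}%AS)) (memvf x).
by rewrite /galTrace gal_quad // big_setU1 ?inE 1?eq_sym // big_set1 gal_id.
Qed.

Lemma nmEE x : \dim {: E} = 2%N -> s != 1%g -> (nmE x)%:A = x * s x.
Proof.
move=> E2 s1; apply: to_baseE.
have := mem_galNorm (finField_galois (sub1v {: E}%AS)) (memvf x).
by rewrite /galNorm gal_quad // big_setU1 ?inE 1?eq_sym // big_set1 gal_id.
Qed.

(* omega is the Weil representation on functions; the elements below generate *)
(* J, so their values determine it.                                           *)
Definition is_Weil_U (psi : k -> algC)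
    (omega : mx_representation algC J_U #|E|) : Prop :=
  let act g x y z := fun_act (X := E) (omega (elt_U g x y z)) in
  [/\ forall x z f xi,
        act 1%:M x 0 z f xi = psi z * f (xi + x),
      forall y f xi,
        act 1%:M 0 y 0 f xi = psi (trE (s y * xi)) * f xi,
      forall a f xi, a != 0 ->
        act (mx_of_rows 2 [:: [:: a; 0]; [:: 0; (s a)^-1] ]) 0 0 0 f xi
          = f (a * xi),
      forall b f xi,
        act (mx_of_rows 2 [:: [:: 1; b%:A]; [:: 0; 1] ]) 0 0 0 f xi
          = psi (nmE xi * b) * f xi
    & forall f xi,
        act (mx_of_rows 2 [:: [:: 0; 1]; [:: - 1; 0] ]) 0 0 0 f xi
          = - #|k|%:R^-1 * \sum_(y : E) psi (trE (s y * xi)) * f y].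

End Unitary.

(* Main.v *)
Require Import Defs.
From mathcomp Require Import all_boot all_order all_algebra all_fingroup.
From mathcomp Require Import all_solvable all_field all_character.
From mathcomp Require Import ring zify.

(** The symplectic and the unitary case are one statement. Let s be the
    identity of R = k, respectively the conjugation of R = E: an involutive
    automorphism of a finite field of odd characteristic. In both cases the
    rank-one group T (SL_2 or U_2) and the group G (Sp_4 or U_4) consist of
    the matrices A with A F s(A)^T = F, where F is the antidiagonal form of
    size 2 or 4; the Heisenberg group, the subgroup J and the operators of
    omega_psi are given by the same formulas, up to a sign character of the
    torus and a constant, for the s-invariant additive character Psi of R which
    is psi for R = k and x |-> psi (Tr(x) / 2) for R = E. [fourier_jacobi_multiplicity_free] is the theorem in this setting.

    The proof is Gelfand's trick in the form [gelfand_multiplicity_free]. The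
    flip tau of a matrix across its antidiagonal is an anti-involution that
    preserves G, J and T. Put rho = pi (x) omega, which has only scalar
    endomorphisms ([rho_scalar_commutant]). If Ind rho contained an irreducible
    sigma twice, the matrix units between two copies of rho in sigma would not
    commute; but they do commute once
      tr (S sigma(tau g) S') = tr (S sigma(g) S')
    for all J-maps S : sigma -> rho and S' : rho -> sigma. For the function
    Phi(g) = S sigma(g) S', this is checked on each double coset J r J. When
    tau r = r, it says that A = Phi(r) satisfies tr (A rho(tau j)) =
    tr (A rho(j)) on J. There are three kinds of r ([double_coset]):
    - the torus element diag(a, 1, 1, s(a)^-1). It multiplies the centre of the
      Heisenberg group by a s(a), so Phi vanishes unless a s(a) = 1; in that
      case r is a central element of G times an element of J, and Phi is
      scalar on central elements;
    - a Weyl element exchanging the two outer coordinates, for which A commutes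
      with rho(T) ([corner_tau]);
    - a Weyl element exchanging the coordinates in two pairs, which normalises
      a Siegel unipotent radical ([swap_tau]).

    In the basis of delta functions of omega, A is a matrix of blocks
    A_(xi, zeta) acting on pi, the blocks of rho(j) are the multiples
    omega(j)_(xi, zeta) pi(j), and the kernel of omega has the symmetry
    omega(tau j)_(xi, zeta) = omega(j)_(s zeta, s xi) ([tau_kernel]). It remains
    to compare traces of blocks of A against pi(tau g) and pi(g).

    The hypothesis on pi enters through [unip_commutant_tau]: if B commutes
    with pi(N), where N is the unipotent radical of the Borel subgroup, then
    tr (B pi(tau g)) = tr (B pi(g)). On the part of B where N acts by a
    non-trivial character, this is the usual argument for the uniqueness of
    Whittaker models, by the Bruhat decomposition. The remaining part lives on
    the N-fixed vectors of pi, and these form at most a line because pi is not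
    fully induced ([unip_fixed_le1]: a principal series has at most two
    dimensions of N-fixed vectors and each constituent has at least one). So this
    part is a multiple of the projector onto that line, and the claim follows
    from the fact that tau g and g are conjugate in T ([tau_conj]).

    For the second Weyl element, the blocks vanish unless zeta = s xi and the
    remaining ones commute with pi(N). For the first one, the family of blocks
    is tested against the kernels of all Heisenberg elements h, which separate
    functions of (xi, zeta) ([heis_span]). The result is invariant under
    simultaneous conjugation of h and g by T, so h may be moved to a standard
    position ([heis_orbit]). If h is central, use that tau g and g are
    conjugate; if h lies over an isotropic vector, it is centralised by N, and
    [unip_commutant_tau] applies; if h lies over an anisotropic vector, which
    needs s to be non-trivial, some x in T centralises h and conjugates g to
    tau g ([aniso_conj]). *)

Set Implicit Arguments.
Unset Strict Implicit.
Unset Printing Implicit Defensive.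
Import Order.TTheory GRing.Theory Num.Theory.
Local Open Scope ring_scope.

(** * Schur orthogonality and Gelfand's trick *)
Section GroupSums.
Variables (gT : finGroupType) (G : {group gT}) (V : nmodType).
Implicit Type F : gT -> V.

Lemma sum_groupMl g F : g \in G ->
  \sum_(y in G) F (g * y)%g = \sum_(y in G) F y.
Proof.
move=> Gg; rewrite [RHS](reindex_inj (mulgI g)).
by apply: eq_bigl => y; rewrite groupMl.
Qed.

End GroupSums.

Section SchurOrthogonality.
Variables (gT : finGroupType) (G : {group gT}) (n : nat).
Variable rG : mx_representation algC G n.

(** Over an algebraically closed field this is irreducibility. It is the form in
    which irreducibility is available for pi (x) omega and in which Schur's
    lemma is applied. *)
Definition scalar_commutant :=
  forall X : 'M_n, {in G, forall g, rG g *m X = X *m rG g} -> is_scalar_mx X.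

Lemma irr_scalar_commutant : mx_irreducible rG -> scalar_commutant.
Proof.
move=> irrG X cX; have abs := @groupC _ G n rG irrG.
by apply: (mx_abs_irr_cent_scalar abs); apply/centgmxP=> x Gx; rewrite -cX.
Qed.

Hypothesis scG : scalar_commutant.
Hypothesis n_gt0 : (0 < n)%N.

Let n_neq0 : n%:R != 0 :> algC. Proof. by rewrite pnatr_eq0 -lt0n. Qed.

Lemma sum_conj_repr (M : 'M[algC]_n) :
  \sum_(y in G) rG y *m M *m rG y^-1%g = (#|G|%:R / n%:R * \tr M)%:M.
Proof.
set A := \sum_(y in G) _.
have /is_scalar_mxP[a Ea] : is_scalar_mx A.
  apply: scG => g Gg; rewrite mulmx_sumr mulmx_suml.
  rewrite -[RHS](sum_groupMl _ Gg); apply: eq_bigr => y Gy.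
  by rewrite invMg !repr_mxM ?groupV // !mulmxA repr_mxKV.
rewrite Ea; congr _%:M; apply: (mulIf n_neq0).
rewrite mulrAC divfK // mulr_natr -mxtrace_scalar -Ea raddf_sum /=.
rewrite (eq_bigr (fun=> \tr M)) => [|y Gy].
  by rewrite sumr_const mulr_natl.
by rewrite mxtrace_mulC mulmxA -repr_mxM ?groupV // mulVg repr_mx1 mul1mx.
Qed.

Lemma schur_entries i j i' j' :
  \sum_(y in G) rG y i j * rG y^-1%g i' j'
    = #|G|%:R / n%:R * ((i == j') && (j == i'))%:R.
Proof.
have /matrixP/(_ i j') := sum_conj_repr (delta_mx j i').
have -> : \tr (delta_mx j i' : 'M[algC]_n) = (j == i')%:R.
  rewrite /mxtrace (bigD1 j) //= mxE eqxx /= big1 ?addr0 // => k nkj.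
  by rewrite mxE (negPf nkj).
rewrite summxE !mxE -mulrnAr -mulrnA mulnb andbC => <-.
apply: eq_bigr => y Gy; rewrite -(mul_delta_mx (0 : 'I_1)) mulmxA -mulmxA.
by rewrite -colE -rowE mxE big_ord1 !mxE.
Qed.

(** A matrix is recovered from its matrix coefficient y |-> tr (rG(y) M), so
    that convolving such coefficients amounts to multiplying matrices. *)
Lemma fourier_inversion (M : 'M[algC]_n) :
  \sum_(y in G) \tr (rG y *m M) *: rG y^-1%g = (#|G|%:R / n%:R) *: M.
Proof.
apply/matrixP=> i j; rewrite summxE mxE.
transitivity (\sum_k \sum_l M l k * \sum_(y in G) rG y k l * rG y^-1%g i j).
  under eq_bigr do rewrite mxE mulr_suml.
  rewrite exchange_big; apply: eq_bigr => k _ /=.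
  under eq_bigr do rewrite mxE mulr_suml.
  rewrite exchange_big; apply: eq_bigr => l _ /=.
  by rewrite mulr_sumr; apply: eq_bigr => y _; rewrite mulrAC mulrC.
under eq_bigr => k _ do under eq_bigr => l _ do rewrite schur_entries.
rewrite (bigD1 j) //= (bigD1 i) //= !eqxx big1 => [|l /negPf->]; last first.
  by rewrite andbF !mulr0.
rewrite big1 => [|k /negPf nkj]; last first.
  by rewrite big1 // => l _; rewrite nkj !mulr0.
by rewrite !addr0 mulr1 mulrC.
Qed.

Lemma eq_trace_repr (M M' : 'M[algC]_n) :
  {in G, forall y, \tr (rG y *m M) = \tr (rG y *m M')} -> M = M'.
Proof.
move=> eqMM'; apply: (@scalerI _ _ (#|G|%:R / n%:R)).
  by rewrite mulf_neq0 ?invr_eq0 ?neq0CG.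
by rewrite -!fourier_inversion; apply: eq_bigr => y Gy; rewrite eqMM'.
Qed.

Lemma scalar_commutant_irr : cfRepr rG \in irr G.
Proof.
rewrite irrEchar cfRepr_char cfdotE /=; apply/eqP.
apply: (mulfI (neq0CG G)); rewrite mulVKf ?neq0CG // mulr1.
transitivity (\sum_i \sum_j \sum_(y in G) rG y i i * rG y^-1%g j j).
  transitivity (\sum_(y in G) \tr (rG y) * \tr (rG y^-1%g)).
    apply: eq_bigr => y Gy; rewrite -char_inv ?cfRepr_char //.
    by rewrite !cfunE Gy groupV Gy !mulr1n.
  under eq_bigr do rewrite mulr_suml.
  rewrite exchange_big; apply: eq_bigr => i _ /=.
  under eq_bigr do rewrite mulr_sumr.
  by rewrite exchange_big.
under eq_bigr => i _ do under eq_bigr => j _ do rewrite schur_entries andbb.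
rewrite (eq_bigr (fun=> #|G|%:R / n%:R)) => [|i _].
  by rewrite sumr_const card_ord -[_ *+ n]mulr_natr divfK.
rewrite (bigD1 i) //= eqxx mulr1 big1 ?addr0 // => j; rewrite eq_sym => /negPf->.
by rewrite mulr0.
Qed.

End SchurOrthogonality.

Section GelfandTrick.
Variables (gT : finGroupType) (G J : {group gT}) (n : nat).
Variables (rho : mx_representation algC J n) (tau : gT -> gT).
Hypothesis sJG : J \subset G.
Hypothesis tauG : {in G, forall x, tau x \in G}.
Hypothesis tauM : {in G &, forall x y, tau (x * y)%g = (tau y * tau x)%g}.
Hypothesis tauK : {in G, involutive tau}.

Lemma tau_V : {in G, forall x, tau x^-1%g = (tau x)^-1%g}.
Proof.
have tau1 : tau 1%g = 1%g.
  by apply: (mulgI (tau 1%g)); rewrite -tauM ?group1 // !mulg1.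
by move=> x Gx; apply: (mulgI (tau x)); rewrite -tauM ?groupV // mulVg mulgV tau1.
Qed.

Lemma sum_tau (V : nmodType) (F : gT -> V) :
  \sum_(y in G) F (tau y) = \sum_(y in G) F y.
Proof.
rewrite [RHS](reindex_onto tau tau) => [|x Gx]; last exact: tauK.
apply: eq_bigl => y; apply/idP/andP=> [Gy|[Gy /eqP <-]].
  by rewrite tauK // eqxx tauG.
exact: tauG.
Qed.

Section OneConstituent.
Variables (N : nat) (sigma : mx_representation algC G N).
Hypothesis scG : scalar_commutant sigma.
Hypothesis N_gt0 : (0 < N)%N.

Let phi (M : 'M[algC]_N) x := \tr (sigma x *m M).

(** Write phi_M(x) = tr (sigma(x) M). By Fourier inversion the convolution of
    phi_M and phi_M' is a multiple of phi_(M M'). An anti-automorphism reverses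
    convolutions, so if it fixes phi_M, phi_M' and phi_(M M'), then
    phi_(M M') = phi_(M' M). *)
Lemma tau_fixed_commute (M M' : 'M[algC]_N) :
    {in G, forall x, phi M (tau x) = phi M x} ->
    {in G, forall x, phi M' (tau x) = phi M' x} ->
    {in G, forall x, phi (M *m M') (tau x) = phi (M *m M') x} ->
  M *m M' = M' *m M.
Proof.
move=> fM fM' fMM'; apply: (eq_trace_repr scG N_gt0) => x Gx.
rewrite -/(phi _ x) -fMM' //; set c := #|G|%:R / N%:R : algC.
have c_neq0 : c != 0.
  by rewrite mulf_neq0 ?invr_eq0 ?neq0CG // pnatr_eq0 -lt0n.
apply: (mulfI c_neq0).
have conv_l z : z \in G ->
  c * phi (M *m M') z = \sum_(y in G) phi M y * phi M' (z * y^-1)%g.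
- move=> Gz; rewrite /phi mxtrace_mulC -mulmxA -mxtraceZ scalemxAl.
  rewrite -(fourier_inversion scG N_gt0) mulmx_suml raddf_sum /=.
  apply: eq_bigr => y Gy; rewrite -scalemxAl mxtraceZ; congr (_ * _).
  by rewrite mxtrace_mulC -mulmxA mxtrace_mulC repr_mxM ?groupV.
have conv_r z : z \in G ->
  c * phi (M' *m M) z = \sum_(y in G) phi M y * phi M' (y^-1 * z)%g.
- move=> Gz; rewrite /phi mulmxA -mxtraceZ scalemxAr.
  rewrite -(fourier_inversion scG N_gt0) mulmx_sumr raddf_sum /=.
  apply: eq_bigr => y Gy; rewrite -scalemxAr mxtraceZ; congr (_ * _).
  by rewrite mxtrace_mulC mulmxA -repr_mxM ?groupV.
rewrite conv_l ?tauG // conv_r // -sum_tau; apply: eq_bigr => y Gy.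
by rewrite fM // -tau_V // -tauM ?groupV // fM' ?groupM ?groupV.
Qed.

End OneConstituent.

Hypothesis scJ : scalar_commutant rho.
Hypothesis n_gt0 : (0 < n)%N.

(** Two independent copies of rho inside sigma, given by the inclusions T1, T2
    and by the projections S1, S2. *)
Lemma split_twice N (sigma : mx_representation algC G N) :
    ~~ ('[cfRepr rho, 'Res[J] (cfRepr sigma)] <= 1) ->
  exists S1 S2 T1 T2,
   [/\ {in J, forall j, S1 *m sigma j = rho j *m S1}
     /\ {in J, forall j, S2 *m sigma j = rho j *m S2},
       {in J, forall j, sigma j *m T1 = T1 *m rho j}
     /\ {in J, forall j, sigma j *m T2 = T2 *m rho j},
       S1 *m T1 = 1%:M /\ S2 *m T2 = 1%:M
     & S1 *m T2 = 0 /\ S2 *m T1 = 0].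
Proof.
have /irrP[a Da] := scalar_commutant_irr scJ n_gt0.
have Nres : 'Res[J] (cfRepr sigma) \is a character by rewrite cfRes_char ?cfRepr_char.
rewrite Da cfdotC => big2.
have /(constt_charP a Nres)[chi1 Nchi1 E1] :
    a \in irr_constt ('Res[J] (cfRepr sigma)).
  by rewrite irr_consttE; apply: contraNneq big2 => ->; rewrite conjC0 ler01.
have /(constt_charP a Nchi1)[chi2 Nchi2 E2] : a \in irr_constt chi1.
  by rewrite irr_consttE; apply: contraNneq big2; rewrite E1 cfdotDl cfdot_irr eqxx => ->; rewrite addr0 conjC1.
have [r2 Dr2] := char_reprP Nchi2.
pose r := dadd_grepr (Representation rho) (dadd_grepr (Representation rho) r2).
have /mx_rsim_def[B [B' B'B Dsig]] : mx_rsim (subg_repr sigma sJG) r.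
  by apply/cfRepr_rsimP; rewrite cfRepr_sub E1 E2 Dr2 !cfRepr_dadd /= Da.
have {Dsig} [BL BR] : {in J, forall j, B' *m sigma j = r j *m B'}
    /\ {in J, forall j, sigma j *m B = B *m r j}.
  split=> j Jj; rewrite (Dsig j Jj) -?mulmxA ?B'B ?mulmx1 //.
  by rewrite !mulmxA B'B mul1mx.
exists (usubmx B'), (usubmx (dsubmx B')), (lsubmx B), (lsubmx (rsubmx B)).
move: B'B; rewrite -[B in _ *m B]hsubmxK -[rsubmx B]hsubmxK.
rewrite -[B' in B' *m _]vsubmxK -[dsubmx B']vsubmxK.
rewrite !mul_col_row mul_mx_row mul_col_mx (scalar_mx_block n) (scalar_mx_block n).
case/eq_block_mx => E11 E12 E21 E22.
move/(congr1 lsubmx): E12; rewrite row_mxKl linear0 => E12.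
move/(congr1 usubmx): E21; rewrite col_mxKu linear0 => E21.
move: E22; case/eq_block_mx => E22 _ _ _.
rewrite col_mxKu row_mxKl.
split; [split | split | split | split] => // [j Jj|j Jj|j Jj|j Jj].
- by rewrite mul_usub_mx BL //= -{1}[B']vsubmxK mul_block_col col_mxKu mul0mx addr0.
- rewrite !mul_usub_mx mul_dsub_mx BL //= -{1}[B']vsubmxK mul_block_col col_mxKd.
  rewrite mul0mx add0r -{1}[dsubmx B']vsubmxK mul_block_col col_mxKu.
  by rewrite mul0mx addr0.
- by rewrite mulmx_lsub BR //= -{1}[B]hsubmxK mul_row_block row_mxKl mulmx0 addr0.
rewrite !mulmx_lsub mulmx_rsub BR //= -{1}[B]hsubmxK mul_row_block row_mxKr.
rewrite mulmx0 add0r -{1}[rsubmx B]hsubmxK mul_row_block row_mxKl.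
by rewrite mulmx0 addr0.
Qed.

(** By Frobenius reciprocity, a multiplicity at least 2 of sigma in Ind rho
    gives two copies of rho in sigma. The matrix units T1 S2 and T2 S1 between
    them do not commute, while [tau_fixed_commute] says that they do. *)
Theorem gelfand_multiplicity_free :
    (forall N (sigma : mx_representation algC G N) S T,
        {in J, forall j, S *m sigma j = rho j *m S} ->
        {in J, forall j, sigma j *m T = T *m rho j} ->
      {in G, forall g, \tr (S *m sigma (tau g) *m T) = \tr (S *m sigma g *m T)}) ->
  multiplicity_free ('Ind[G] (cfRepr rho)).
Proof.
move=> tau_inv i; rewrite -Frobenius_reciprocity -irrRepr.
apply: contraT => /split_twice[S1 [S2 [T1 [T2 [[hS1 hS2] [hT1 hT2]]]]]].
case=> [[S1T1 S2T2] [S1T2 S2T1]].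
have irr_i : mx_irreducible 'Chi_i by exact: socle_irr.
have scG := irr_scalar_commutant irr_i.
have N_gt0 : (0 < irr_degree (socle_of_Iirr i))%N by exact: irr_degree_gt0.
have fix_tau S T :
    {in J, forall j, S *m 'Chi_i j = rho j *m S} ->
    {in J, forall j, 'Chi_i j *m T = T *m rho j} ->
  {in G, forall g, \tr ('Chi_i (tau g) *m (T *m S)) = \tr ('Chi_i g *m (T *m S))}.
- move=> hS hT g Gg; have := tau_inv _ _ S T hS hT g Gg.
  by rewrite -!mulmxA ![\tr (S *m _)]mxtrace_mulC -!mulmxA.
have M12 : (T1 *m S2) *m (T2 *m S1) = T1 *m S1.
  by rewrite mulmxA -(mulmxA T1) S2T2 mulmx1.
have M21 : (T2 *m S1) *m (T1 *m S2) = T2 *m S2.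
  by rewrite mulmxA -(mulmxA T2) S1T1 mulmx1.
have := @tau_fixed_commute _ _ scG N_gt0 (T1 *m S2) (T2 *m S1).
rewrite M12 M21 => /(_ (fix_tau _ _ hS2 hT1) (fix_tau _ _ hS1 hT2) (fix_tau _ _ hS1 hT1)).
move/(congr1 (fun M => S1 *m M *m T1)).
rewrite !mulmxA S1T1 S1T2 !mul1mx !mul0mx S1T1 => /matrixP/(_ (Ordinal n_gt0) (Ordinal n_gt0)).
by rewrite !mxE eqxx => /eqP; rewrite oner_eq0.
Qed.

End GelfandTrick.

(** * The antidiagonal form and the flip *)
Section Flip.
Variables (R : comNzRingType) (m : nat).
Implicit Types A B : 'M[R]_m.

Definition rot_mx A : 'M[R]_m := \matrix_(i, j) A (rev_ord i) (rev_ord j).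
Definition flip_mx A : 'M[R]_m := (rot_mx A)^T.

Lemma rot_mxM A B : rot_mx (A *m B) = rot_mx A *m rot_mx B.
Proof.
apply/matrixP=> i j; rewrite !mxE (reindex_inj rev_ord_inj).
by apply: eq_bigr => k _; rewrite !mxE.
Qed.

Lemma flip_mxM A B : flip_mx (A *m B) = flip_mx B *m flip_mx A.
Proof. by rewrite /flip_mx rot_mxM trmx_mul. Qed.

Lemma flip_mxK : involutive flip_mx.
Proof. by move=> A; apply/matrixP=> i j; rewrite !mxE !rev_ordK. Qed.

Lemma flip_scalar (a : R) : flip_mx a%:M = a%:M.
Proof. by apply/matrixP=> i j; rewrite !mxE (inj_eq rev_ord_inj) eq_sym. Qed.

(** The flip is a transposition followed by the rotation by a half-turn.
    Inverting A F s(A)^T = F gives the same identity for A^T, and both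
    transposing and rotating F change its sign, so that A and its flip preserve
    the same form. *)
Lemma flip_form (s : {rmorphism R -> R}) (F A : 'M[R]_m) :
    F *m F = - 1%:M -> F^T = - F -> rot_mx F = - F -> map_mx s F = F ->
    involutive s -> A *m F *m (map_mx s A)^T = F ->
  flip_mx A *m F *m (map_mx s (flip_mx A))^T = F.
Proof.
move=> FF Ft rF sF sK AF.
have AFA : A *m (- (F *m (map_mx s A)^T *m F)) = 1%:M.
  by rewrite mulmxN !mulmxA AF FF opprK.
have {AFA} : A^T *m F *m map_mx s A = F.
  have /mulmx1C/(congr1 (mulmx F)) := AFA.
  rewrite mulNmx mulmxN !mulmxA FF !mulNmx opprK mul1mx mulmx1.
  have sKA : map_mx s (map_mx s A) = A.
    by apply/matrixP=> i j; rewrite !mxE sK.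
  by move/(congr1 (map_mx s)); rewrite !map_mxM sF -map_trmx sKA.
move=> AtF; have -> : (map_mx s (flip_mx A))^T = rot_mx (map_mx s A).
  by apply/matrixP=> i j; rewrite !mxE.
rewrite /flip_mx -[F in _ *m F *m _]opprK -rF.
have -> : (rot_mx A)^T = rot_mx A^T by apply/matrixP=> i j; rewrite !mxE.
by rewrite mulmxN mulNmx -!rot_mxM AtF rF opprK.
Qed.

End Flip.

Notation M2 a b c d := (mx_of_rows 2 [:: [:: a; b]; [:: c; d]]).

Section TwoByTwo.
Variable R : comPzRingType.

Lemma M2E (A : 'M[R]_2) :
  A = M2 (A ord0 ord0) (A ord0 ord_max) (A ord_max ord0) (A ord_max ord_max).
Proof.
apply/matrixP=> i j; rewrite mxE.
by case: i => [[|[|i]] lti] //=; case: j => [[|[|j]] ltj] //=; congr (A _ _); apply: val_inj.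
Qed.

Lemma M2M (a b c d a' b' c' d' : R) :
  M2 a b c d *m M2 a' b' c' d'
    = M2 (a * a' + b * c') (a * b' + b * d') (c * a' + d * c') (c * b' + d * d').
Proof.
apply/matrixP=> i j; rewrite !mxE !big_ord_recl big_ord0 !mxE addr0.
by case: i => [[|[|i]] lti] //=; case: j => [[|[|j]] ltj].
Qed.

Lemma M2_inj (a b c d a' b' c' d' : R) :
  M2 a b c d = M2 a' b' c' d' -> [/\ a = a', b = b', c = c' & d = d'].
Proof.
move=> /matrixP E; move: (E ord0 ord0) (E ord0 ord_max) (E ord_max ord0) (E ord_max ord_max).
by rewrite !mxE /=.
Qed.

Lemma M2_1 : 1%:M = M2 1 0 0 1 :> 'M[R]_2.
Proof. by rewrite [LHS]M2E !mxE. Qed.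

Lemma symp_formE n (i j : 'I_(n + n)) :
  symp_form n i j = (if (i + j)%N == (n + n).-1 then (-1) ^+ (n <= i)%N else 0) :> R.
Proof.
rewrite /symp_form /block_mx mxE; case: splitP => i1 Ei; rewrite mxE;
  case: splitP => j1 Ej; rewrite !mxE Ei Ej;
  have := ltn_ord i1; have := ltn_ord j1 => ltj lti.
- by rewrite ifF //; lia.
- have -> : (n <= i1)%N = false by lia.
  by rewrite expr0; case: eqP => Ea; case: eqP => Eb //; exfalso; lia.
- rewrite leq_addr expr1.
  by case: eqP => Ea; case: eqP => Eb; rewrite /= ?oppr0 //; exfalso; lia.
by rewrite ifF //; lia.
Qed.

Lemma symp_form1E : symp_form 1 = M2 0 1 (- 1) 0 :> 'M[R]_2.
Proof.
by rewrite [LHS]M2E !(@symp_formE 1) /= expr0 expr1.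
Qed.

End TwoByTwo.

Lemma M2_map (R S : comPzRingType) (f : R -> S) a b c d :
  map_mx f (M2 a b c d) = M2 (f a) (f b) (f c) (f d).
Proof. by rewrite [LHS]M2E !mxE. Qed.

Lemma M2_tr (R : comPzRingType) (a b c d : R) : (M2 a b c d)^T = M2 a c b d.
Proof. by rewrite [LHS]M2E !mxE. Qed.

Lemma M2_flip (R : comNzRingType) (a b c d : R) : flip_mx (M2 a b c d) = M2 d b c a.
Proof. by rewrite [LHS]M2E !mxE. Qed.

(** * The rank-one group *)
(** In what follows, T is SL_2 when s is the identity, since then the condition
    [T_mem] reads det g = 1, and U_2 when s is the conjugation. *)
Section UnitaryPlane.
Variables (R : finFieldType) (s : {rmorphism R -> R}).
Hypothesis sK : involutive s.
Variable T : {group {'GL_2[R]}}.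
Hypothesis T_mem : forall g, (g \in T) =
  (GLval g *m symp_form 1 *m (map_mx s (GLval g))^T == symp_form 1).

(** The conditions on the entries of a 2 x 2 matrix to preserve the form, which
    is antihermitian: one equation per entry above or on the diagonal. *)
Definition U11 a b c d :=
  [/\ a * s b = b * s a, a * s d - b * s c = 1 & c * s d = d * s c].

Lemma U11_unit a b c d : U11 a b c d -> M2 a b c d \in unitmx.
Proof.
case=> Eab E1 Ecd; suff /mulmx1_unit[] :
  M2 a b c d *m M2 (s d) (- s b) (- s c) (s a) = 1%:M by [].
have E2 : d * s a - c * s b = 1.
  by have := congr1 s E1; rewrite rmorphB !rmorphM !sK rmorph1 => <-; ring.
rewrite M2M M2_1; congr (M2 _ _ _ _).
- by apply: etrans E1; ring.
- by rewrite mulrN Eab; ring.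
- by rewrite mulrN Ecd; ring.
by apply: etrans E2; ring.
Qed.

Lemma U11_inv a b c d : U11 a b c d -> c * s b - d * s a = -1.
Proof.
case=> _ E1 _; have := congr1 s E1; rewrite rmorphB !rmorphM !sK rmorph1 => <-.
by ring.
Qed.

(** The element of GL_2 with the given entries. It is locked so that conversion
    never unfolds the invertibility test in [to_GL]. *)
Fact gl2_key : unit. Proof. by []. Qed.
Definition gl2 (a b c d : R) : {'GL_2[R]} :=
  locked_with gl2_key (fun a b c d : R => to_GL (n := 2) (M2 a b c d)) a b c d.

Arguments gl2 (a b c d)%_R.

Lemma gl2E a b c d : U11 a b c d -> GLval (gl2 a b c d) = M2 a b c d.
Proof. by move=> U; rewrite /gl2 unlock to_GLE // U11_unit. Qed.

Lemma U11P a b c d : U11 a b c d <->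
  M2 a b c d *m symp_form 1 *m (map_mx s (M2 a b c d))^T = symp_form 1.
Proof.
rewrite (symp_form1E R) M2_map M2_tr !M2M.
split=> [U|/M2_inj[E1 E2 E3 E4]].
  have E4 := U11_inv U; case: U => E1 E2 E3.
  congr (M2 _ _ _ _).
  - by transitivity (a * s b - b * s a); [ring | rewrite E1 subrr].
  - by transitivity (a * s d - b * s c); first ring.
  - by transitivity (c * s b - d * s a); first ring.
  by transitivity (c * s d - d * s c); [ring | rewrite E3 subrr].
split.
- by apply: subr0_eq; apply: etrans E1; ring.
- by apply: etrans E2; ring.
by apply: subr0_eq; apply: etrans E4; ring.
Qed.

Lemma mem_gl2 a b c d : U11 a b c d -> gl2 a b c d \in T.
Proof. by move=> U; rewrite T_mem gl2E //; apply/eqP/U11P. Qed.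

Variant T_spec (g : {'GL_2[R]}) : Prop :=
  TSpec a b c d of U11 a b c d & g = gl2 a b c d.

Lemma TP g : g \in T -> T_spec g.
Proof.
rewrite T_mem => /eqP Ug.
have U : U11 (GLval g ord0 ord0) (GLval g ord0 ord_max)
             (GLval g ord_max ord0) (GLval g ord_max ord_max).
  by apply/U11P; rewrite -M2E.
by apply: (TSpec U); apply: GLval_inj; rewrite gl2E // -M2E.
Qed.

Lemma gl2M a b c d a' b' c' d' : U11 a b c d -> U11 a' b' c' d' ->
  (gl2 a b c d * gl2 a' b' c' d')%g
    = gl2 (a * a' + b * c') (a * b' + b * d') (c * a' + d * c') (c * b' + d * d').
Proof.
move=> U U'; have := groupM (mem_gl2 U) (mem_gl2 U').
rewrite T_mem GL_MxE !gl2E // M2M => /eqP/U11P U2.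
by apply: GLval_inj; rewrite GL_MxE !gl2E // M2M.
Qed.

End UnitaryPlane.

Arguments gl2 {R} (a b c d)%_R.

Section SympForm.
Variables (R : comNzRingType) (n : nat).
Local Notation F := (symp_form n : 'M[R]_(n + n)).

Lemma rev_ordE (i j : 'I_(n + n)) : ((i + j)%N == (n + n).-1) = (j == rev_ord i).
Proof. by apply/eqP/eqP=> [E|->] /=; [apply: val_inj => /=; lia | have := ltn_ord i; lia]. Qed.

Lemma symp_form_rev (i j : 'I_(n + n)) :
  symp_form n i j = (if j == rev_ord i then (-1) ^+ (n <= i)%N else 0) :> R.
Proof. by rewrite symp_formE rev_ordE. Qed.

Lemma symp_form_tr : F^T = - F.
Proof.
apply/matrixP=> i j; rewrite [LHS]mxE [RHS]mxE !symp_formE addnC; case: eqP => E; rewrite ?oppr0 //.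
have -> : (n <= j)%N = ~~ (n <= i)%N by have := ltn_ord i; have := ltn_ord j; lia.
by case: (n <= i)%N; rewrite /= ?expr0 ?expr1 ?opprK.
Qed.

Lemma symp_form_rot : rot_mx F = - F.
Proof.
rewrite -symp_form_tr; apply/matrixP=> i j; rewrite [LHS]mxE [RHS]mxE !symp_form_rev.
rewrite (inj_eq rev_ord_inj) [i == _]eq_sym (can2_eq (@rev_ordK _) (@rev_ordK _)).
by case: eqP => // ->; congr (_ ^+ _).
Qed.

Lemma symp_form_sq : F *m F = - 1%:M.
Proof.
apply/matrixP=> i j; rewrite [LHS]mxE [RHS]mxE [in RHS]mxE (bigD1 (rev_ord i)) //= big1 => [|k nk].
  rewrite !symp_form_rev eqxx rev_ordK addr0.
  have [_|_] := eqVneq j i; last by rewrite mulr0 oppr0.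
  rewrite -exprD.
  have -> : ((n <= i) + (n <= rev_ord i))%N = 1%N.
    rewrite /=; have := ltn_ord i.
    by case: (leqP n i); case: (leqP n (n + n - i.+1)) => //=; lia.
  by rewrite expr1.
by rewrite symp_form_rev (negPf nk) mul0r.
Qed.

Lemma symp_form_map (s : {rmorphism R -> R}) : map_mx s F = F.
Proof.
apply/matrixP=> i j; rewrite mxE symp_form_rev; case: ifP => _; last exact: rmorph0.
by rewrite rmorphXn rmorphN1.
Qed.

Lemma flip_unitary (s : {rmorphism R -> R}) (A : 'M_(n + n)) : involutive s ->
  A *m F *m (map_mx s A)^T = F ->
  flip_mx A *m F *m (map_mx s (flip_mx A))^T = F.
Proof.
move=> sK; apply: flip_form => //.
- exact: symp_form_sq.
- exact: symp_form_tr.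
- exact: symp_form_rot.
exact: symp_form_map.
Qed.

End SympForm.

Section AntiTranspose.
Variables (n : nat) (R : finComUnitRingType).
Implicit Types g h : {'GL_n[R]}.

Definition tau g : {'GL_n[R]} := to_GL (flip_mx (GLval g)).

Lemma tauE g : GLval (tau g) = flip_mx (GLval g).
Proof.
apply: to_GLE; suff /mulmx1_unit[] : flip_mx (GLval g) *m flip_mx (GLval g^-1%g) = 1%:M by [].
by rewrite -flip_mxM -GL_MxE mulVg GL_1E flip_scalar.
Qed.

Lemma tauM g h : tau (g * h)%g = (tau h * tau g)%g.
Proof. by apply: GLval_inj; rewrite GL_MxE !tauE GL_MxE flip_mxM. Qed.

Lemma tauK : involutive tau.
Proof. by move=> g; apply: GLval_inj; rewrite !tauE flip_mxK. Qed.

End AntiTranspose.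

Section PlaneElements.
Variables (R : finFieldType) (s : {rmorphism R -> R}).
Hypothesis sK : involutive s.
Variable T : {group {'GL_2[R]}}.
Hypothesis T_mem : forall g, (g \in T) =
  (GLval g *m symp_form 1 *m (map_mx s (GLval g))^T == symp_form 1).

Lemma U11_flip a b c d : U11 s a b c d -> U11 s d b c a.
Proof.
move/(U11P sK)=> U; apply/(U11P sK).
by have := flip_unitary (n := 1) sK U; rewrite M2_flip.
Qed.

Lemma tau_gl2 a b c d : U11 s a b c d -> tau (n := 2) (gl2 a b c d) = gl2 d b c a.
Proof.
move=> U; apply: GLval_inj.
by rewrite tauE !(gl2E sK) ?M2_flip //; apply: U11_flip.
Qed.

Lemma tau_T g : g \in T -> tau (n := 2) g \in T.
Proof.
case/(TP sK T_mem)=> a b c d U ->; rewrite tau_gl2 //.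
by apply: (mem_gl2 sK T_mem); apply: U11_flip.
Qed.

(** An element g of T equals det(g) s(g): both are read off the inverse of g,
    once from the form and once from the adjugate. This is what makes the
    quotients of entries of g lie in the fixed field of s. *)
Lemma U11_det a b c d : U11 s a b c d ->
  [/\ (a * d - b * c) * s a = a, (a * d - b * c) * s b = b,
      (a * d - b * c) * s c = c & (a * d - b * c) * s d = d].
Proof.
move=> U; have E4 := U11_inv sK U; case: U => E1 E2 E3.
have E4' : d * s a - c * s b = 1 by apply: oppr_inj; apply: etrans E4; ring.
split.
- transitivity (a * (d * s a - c * s b) + c * (a * s b - b * s a)); first ring.
  by rewrite E1 subrr E4' mulr0 addr0 mulr1.
- transitivity (b * (d * s a - c * s b) + d * (a * s b - b * s a)); first ring.
  by rewrite E1 subrr E4' mulr0 addr0 mulr1.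
- transitivity (c * (a * s d - b * s c) - a * (c * s d - d * s c)); first ring.
  by rewrite E3 subrr E2 mulr0 subr0 mulr1.
transitivity (d * (a * s d - b * s c) - b * (c * s d - d * s c)); first ring.
by rewrite E3 subrr E2 mulr0 subr0 mulr1.
Qed.

Lemma U11_det_neq0 a b c d : U11 s a b c d -> a * d - b * c != 0.
Proof.
move=> U; have [Ea Eb _ _] := U11_det U; case: U => _ E2 _.
apply: contra_eq_neq E2 => d0; move: Ea Eb; rewrite d0 !mul0r => <- <-.
by rewrite !mul0r subrr eq_sym oner_eq0.
Qed.

Lemma fixed_ratio D x y : D != 0 -> D * s x = x -> D * s y = y -> s (x / y) = x / y.
Proof.
move=> D0 Ex Ey; rewrite fmorph_div -[in RHS]Ex -[in RHS]Ey invfM.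
by rewrite mulrACA divff // mul1r.
Qed.

(** The unipotent, diagonal and Weyl elements of T; [gn b] is in T when b is
    fixed by s. *)
Definition gn (b : R) : {'GL_2[R]} := gl2 1 b 0 1.
Definition gt (a : R) : {'GL_2[R]} := gl2 a 0 0 (s a)^-1.
Definition gw : {'GL_2[R]} := gl2 0 1 (- 1) 0.

Arguments gn b%_R.
Arguments gt a%_R.

Lemma U11_n b : s b = b -> U11 s 1 b 0 1.
Proof. by move=> sb; split; rewrite ?sb ?rmorph0 ?rmorph1; ring. Qed.

Lemma U11_t a : a != 0 -> U11 s a 0 0 (s a)^-1.
Proof.
move=> a0; split; rewrite ?rmorph0 ?mulr0 ?mul0r ?subr0 //.
by rewrite fmorphV sK divff.
Qed.

Lemma U11_w : U11 s 0 1 (- 1) 0.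
Proof. by split; rewrite ?rmorphN ?rmorph0 ?rmorph1; ring. Qed.

Lemma U11_upper a b d : U11 s a b 0 d -> [/\ a != 0, d = (s a)^-1 & s (b / d) = b / d].
Proof.
move=> U; have [E1 E2 _] := U; have [_ Eb _ Ed] := U11_det U.
move: E2; rewrite rmorph0 mulr0 subr0 => E2.
have a0 : a != 0 by apply: contra_eq_neq E2 => ->; rewrite mul0r eq_sym oner_eq0.
split=> //; last exact: fixed_ratio (U11_det_neq0 U) Eb Ed.
have : s (a * s d) = 1 by rewrite E2 rmorph1.
by rewrite rmorphM sK => /mulr1_eq.
Qed.

Lemma upper_decomp a b d : U11 s a b 0 d -> gl2 a b 0 d = (gn (b / d) * gt a)%g.
Proof.
move=> U; have [a0 Ed sb] := U11_upper U.
have Un := U11_n sb; have := U11_t a0; rewrite /gn /gt -Ed => Ut.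
rewrite (gl2M sK T_mem) //.
have d0 : d != 0 by rewrite Ed invr_eq0 fmorph_eq0.
by congr gl2; field.
Qed.

Lemma bruhat_decomp a b c d : U11 s a b c d -> c != 0 ->
  exists u v b' c',
   [/\ s u = u, s v = v, U11 s 0 b' c' 0
     & gl2 a b c d = (gn u * gl2 0 b' c' 0 * gn v)%g].
Proof.
move=> U c0; have [Ea _ Ec Ed] := U11_det U; have D0 := U11_det_neq0 U.
have su : s (a / c) = a / c by apply: fixed_ratio D0 Ea Ec.
have sv : s (d / c) = d / c by apply: fixed_ratio D0 Ed Ec.
have snu : s (- (a / c)) = - (a / c) by rewrite rmorphN su.
have snv : s (- (d / c)) = - (d / c) by rewrite rmorphN sv.
exists (a / c), (d / c), (b - a * d / c), c.
have [U1n U2n U3n U4n] := And4 (U11_n su) (U11_n sv) (U11_n snu) (U11_n snv).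
have U1 := groupM (mem_gl2 sK T_mem (U11_n snu)) (mem_gl2 sK T_mem U).
have := groupM U1 (mem_gl2 sK T_mem (U11_n snv)).
rewrite T_mem !GL_MxE !(gl2E sK) // !M2M => /eqP/(U11P sK).
have -> : (1 * a + - (a / c) * c) * 1 + (1 * b + - (a / c) * d) * 0 = 0.
  by field.
have -> : (1 * a + - (a / c) * c) * - (d / c) + (1 * b + - (a / c) * d) * 1 = b - a * d / c by field.
have -> : (0 * a + 1 * c) * 1 + (0 * b + 1 * d) * 0 = c by ring.
have -> : (0 * a + 1 * c) * - (d / c) + (0 * b + 1 * d) * 1 = 0 by field.
move=> U'; split=> //.
apply: GLval_inj; rewrite !GL_MxE !(gl2E sK) // !M2M.
by congr (M2 _ _ _ _); field.
Qed.

(** The flip exchanges the two diagonal entries of g and fixes the others. If g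
    has a non-zero entry off the diagonal, a unipotent matrix on the opposite
    side conjugates g to its flip; if g is diagonal, the Weyl element does. *)
Lemma tau_conj g : g \in T -> exists2 x, x \in T & (x * g)%g = (tau (n := 2) g * x)%g.
Proof.
case/(TP sK T_mem)=> a b c d U ->; rewrite tau_gl2 //.
have U' := U11_flip U.
have [Ea Eb Ec Ed] := U11_det U; have D0 := U11_det_neq0 U.
have Eda : (a * d - b * c) * s (d - a) = d - a.
  by rewrite rmorphB mulrBr Ed Ea.
have [c0|c0] := eqVneq c 0; last first.
  have su := fixed_ratio D0 Eda Ec.
  have Un := U11_n su.
  exists (gn ((d - a) / c)); first exact: (mem_gl2 sK T_mem Un).
  rewrite /gn !(gl2M sK T_mem) //.
  by congr gl2; field.
have [b0|b0] := eqVneq b 0; last first.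
  have Ead : (a * d - b * c) * s (a - d) = a - d.
    by rewrite rmorphB mulrBr Ed Ea.
  have su := fixed_ratio D0 Ead Eb.
  have Ul : U11 s 1 0 ((a - d) / b) 1.
    by split; rewrite ?su ?rmorph0 ?rmorph1; ring.
  exists (gl2 1 0 ((a - d) / b) 1); first exact: (mem_gl2 sK T_mem Ul).
  by rewrite c0 in U U' *; rewrite !(gl2M sK T_mem) //; congr gl2; field.
have Uw := U11_w.
exists gw; first exact: (mem_gl2 sK T_mem Uw).
rewrite b0 c0 in U U' *; rewrite /gw !(gl2M sK T_mem) //.
by congr gl2; ring.
Qed.

End PlaneElements.

Arguments gn {R} b%_R.
Arguments gt {R} s a%_R.
Arguments gw {R}.

Section Unipotent.
Variables (R : finFieldType) (s : {rmorphism R -> R}).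
Hypothesis sK : involutive s.
Variable T : {group {'GL_2[R]}}.
Hypothesis T_mem : forall g, (g \in T) =
  (GLval g *m symp_form 1 *m (map_mx s (GLval g))^T == symp_form 1).

Lemma gl2_1 : gl2 1 0 0 1 = 1%g :> {'GL_2[R]}.
Proof. by apply: GLval_inj; rewrite (gl2E sK) -?M2_1 //; apply: U11_n; rewrite rmorph0. Qed.

Lemma gnM u v : s u = u -> s v = v -> (gn u * gn v)%g = gn (u + v).
Proof.
move=> /U11_n Uu /U11_n Uv; rewrite /gn (gl2M sK T_mem) //.
by congr gl2; ring.
Qed.

Lemma gtM a b : a != 0 -> b != 0 -> (gt s a * gt s b)%g = gt s (a * b).
Proof.
move=> /(U11_t sK) Ua /(U11_t sK) Ub; rewrite /gt (gl2M sK T_mem) //.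
by congr gl2; rewrite ?rmorphM ?invfM; ring.
Qed.

Lemma mem_gn u : s u = u -> gn u \in T.
Proof. by move=> /U11_n; apply: (mem_gl2 sK T_mem). Qed.

Lemma mem_gt a : a != 0 -> gt s a \in T.
Proof. by move=> /(U11_t sK); apply: (mem_gl2 sK T_mem). Qed.

Lemma mem_gw : gw \in T.
Proof. exact: (mem_gl2 sK T_mem (U11_w s)). Qed.

Definition unip : {set {'GL_2[R]}} :=
  [set g in borel T | GLval g ord0 ord0 == 1].

Lemma gl2_borel a b c d : U11 s a b c d -> (gl2 a b c d \in borel T) = (c == 0).
Proof. by move=> U; rewrite inE (mem_gl2 sK T_mem) // (gl2E sK) // mxE. Qed.

Lemma borelP g : g \in borel T -> exists u a, [/\ s u = u, a != 0 & g = (gn u * gt s a)%g].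
Proof.
move=> Bg; have /(TP sK T_mem)[a b c d U Dg] : g \in T.
  by move: Bg; rewrite inE => /andP[].
move: Bg; rewrite Dg gl2_borel // => /eqP c0; rewrite {}c0 in U Dg *.
have [a0 Ed su] := U11_upper sK U.
by exists (b / d), a; rewrite -(upper_decomp sK T_mem U).
Qed.

Lemma borelM00 : {in borel T &, forall g h,
  GLval (g * h)%g ord0 ord0 = GLval g ord0 ord0 * GLval h ord0 ord0}.
Proof.
by move=> g h _; rewrite inE => /andP[_ /eqP/(mul_upper (GLval g))[<- _]]; rewrite GL_MxE.
Qed.

Lemma borelV00 : {in borel T, forall g,
  GLval g^-1%g ord0 ord0 = (GLval g ord0 ord0)^-1}.
Proof.
move=> g Bg; apply/esym/mulr1_eq.
by rewrite -borelM00 ?groupV // mulgV GL_1E mxE eqxx.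
Qed.

Lemma unip_group_set : group_set unip.
Proof.
apply/group_setP; split=> [|g h].
  by rewrite inE group1 GL_1E mxE eqxx /= eqxx.
rewrite ![_ \in unip]inE => /andP[Bg /eqP g1] /andP[Bh /eqP h1].
by rewrite groupM //= borelM00 // g1 h1 mulr1.
Qed.
Canonical unip_group := Group unip_group_set.

Lemma mem_unip u : s u = u -> gn u \in unip.
Proof.
move=> su; have Un := U11_n su.
by rewrite inE gl2_borel // eqxx (gl2E sK) // mxE /= eqxx.
Qed.

Lemma unipP g : g \in unip -> exists2 u, s u = u & g = gn u.
Proof.
rewrite inE => /andP[/borelP[u [a [su a0 ->]]]].
have [Un Ut] := (U11_n su, U11_t sK a0).
rewrite GL_MxE !(gl2E sK) // M2M mxE /= mulr0 addr0 mul1r => /eqP a1.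
exists u => //; rewrite a1 /gt rmorph1 invr1 gl2_1; exact: mulg1.
Qed.

Lemma sub_unip_borel : unip \subset borel T.
Proof. by apply/subsetP=> g; rewrite inE => /andP[]. Qed.

Lemma sub_borel : borel T \subset T.
Proof. by apply/subsetP=> g; rewrite inE => /andP[]. Qed.

Lemma unip_normal : (unip <| borel T)%g.
Proof.
rewrite /normal sub_unip_borel; apply/subsetP=> x Bx.
rewrite inE; apply/subsetP=> _ /imsetP[n Nn ->].
have Bn := subsetP sub_unip_borel _ Nn.
rewrite inE groupJ // conjgE !borelM00 ?groupM ?groupV // borelV00 //.
move: Nn; rewrite inE => /andP[_ /eqP ->]; rewrite mul1r mulVf ?eqxx //.
exact: borel_neq0 Bx.
Qed.

Lemma borel_der : (borel T)^`(1)%g \subset unip.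
Proof.
rewrite derg1 gen_subG; apply/subsetP=> _ /imset2P[x y Bx By ->].
rewrite inE groupR // commgEl conjgE !borelM00 ?groupM ?groupV // !borelV00 //.
have [x0 y0] := (borel_neq0 Bx, borel_neq0 By).
by apply/eqP; field; rewrite x0 y0.
Qed.

(** A non-trivial element of N fixes a single line, so it lies in no other
    conjugate of the Borel subgroup. *)
Lemma conj_unip_borel n x : n \in unip -> x \in T -> x \notin borel T ->
  (n ^ x)%g \in borel T -> n = 1%g.
Proof.
case/unipP=> u su ->{n} /(TP sK T_mem)[a b c d U ->].
rewrite gl2_borel // => c0 By; move: (By).
rewrite inE => /andP[/(TP sK T_mem)[a' b' c' d' U' Dy]].
rewrite Dy (gl2E sK) // mxE /= => /eqP c'0.
have Un := U11_n su.
have: (gl2 a b c d * (gn u ^ gl2 a b c d) = gn u * gl2 a b c d)%g.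
  by rewrite conjgE mulKVg.
rewrite Dy c'0 in U' * => /(congr1 (@GLval _ _)).
rewrite !GL_MxE !(gl2E sK) // !M2M => /M2_inj[E1 _ E3 _].
have a'1 : a' = 1.
  by apply: (mulfI c0); transitivity (c * a' + d * 0); [ring | rewrite E3; ring].
have /eqP : u * c = 0.
  by transitivity (1 * a + u * c - a); [ring | rewrite -E1 a'1; ring].
rewrite mulf_eq0 (negPf c0) orbF => /eqP ->; exact: gl2_1.
Qed.

(** The big cell B w N is the image of B x N. *)
Lemma card_notin_borel : (#|T :\: borel T| <= #|borel T| * #|unip|)%N.
Proof.
rewrite -cardsX; apply: leq_trans (leq_imset_card (fun p => p.1 * gw * p.2)%g _).
apply/subset_leq_card/subsetP=> _ /setDP[/(TP sK T_mem)[a b c d U ->]].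
rewrite gl2_borel // => c0.
have [u [v [b' [c' [su sv U' ->]]]]] := bruhat_decomp sK T_mem U c0.
have Uw := U11_w s.
apply/imsetP; exists (gn u * gl2 0 b' c' 0 * gw^-1, gn v)%g; last by rewrite mulgKV.
rewrite inE /= mem_unip // andbT -mulgA groupM //=.
  by rewrite gl2_borel ?eqxx //; apply: U11_n.
have Tw := mem_gw.
have : (gl2 0 b' c' 0 * gw^-1)%g \in T by rewrite groupM ?groupV // (mem_gl2 sK T_mem).
case/(TP sK T_mem)=> a2 b2 c2 d2 U2 E; rewrite E gl2_borel //.
have: (gl2 0 b' c' 0 = gl2 a2 b2 c2 d2 * gw)%g by rewrite -E mulgKV.
move/(congr1 (@GLval _ _)); rewrite GL_MxE !(gl2E sK) // M2M => /M2_inj[_ _ _ /eqP].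
by rewrite mulr0 addr0 mulr1 eq_sym.
Qed.

End Unipotent.

(** * Vectors fixed by the unipotent radical *)
Section UnipotentFixed.
Variables (R : finFieldType) (s : {rmorphism R -> R}).
Hypothesis sK : involutive s.
Variable T : {group {'GL_2[R]}}.
Hypothesis T_mem : forall g, (g \in T) =
  (GLval g *m symp_form 1 *m (map_mx s (GLval g))^T == symp_form 1).
Local Notation N := (unip_group T).
Local Notation B := (borel_group T).

(** The Borel subgroup is the product of N and of the torus, which is
    parametrised by the upper left entry. *)
Lemma linear_borel_char (theta : 'CF(B)) : theta \is a linear_char ->
    {in N, forall n, theta n = 1} ->
  exists chi : mult_char R, theta = cfRepr (borel_repr T chi).
Proof.
move=> lin_th th_N.
pose f a : algC := if a == 0 then 0 else theta (gt s a).
have Bgt a : a != 0 -> gt s a \in B.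
  by move=> a0; rewrite (gl2_borel sK T_mem) ?eqxx //; apply: (U11_t sK).
have f1 : f 1 = 1.
  by rewrite /f oner_eq0 /gt rmorph1 invr1 (gl2_1 sK) lin_char1.
have fM a b : a != 0 -> b != 0 -> f (a * b) = f a * f b.
  move=> a0 b0; rewrite /f mulf_eq0 (negPf a0) (negPf b0) /=.
  by rewrite -(gtM sK T_mem) // (lin_charM lin_th (Bgt _ a0) (Bgt _ b0)).
exists (MultChar f1 fM); apply/cfun_inP=> g Bg.
rewrite cfunE Bg mulr1n mxtrace_scalar mulr1n /=.
have [u [a [su a0 Dg]]] := borelP sK T_mem Bg.
have [Un Ut] := (U11_n su, U11_t sK a0).
have -> : GLval g ord0 ord0 = a.
  by rewrite Dg GL_MxE !(gl2E sK) // M2M mxE /= mulr0 addr0 mul1r.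
have Bn : gn u \in B by rewrite (gl2_borel sK T_mem) ?eqxx.
rewrite /f (negPf a0) Dg (lin_charM lin_th Bn (Bgt _ a0)).
by rewrite th_N ?mul1r //; apply: (mem_unip sK T_mem su).
Qed.

Lemma cfdot_Res_unip (phi : 'CF(T)) :
  '['Res[N] phi, 1] = #|N|%:R^-1 * \sum_(n in N) phi n.
Proof.
have sNT : N \subset T := subset_trans (sub_unip_borel T) (sub_borel T).
rewrite cfdotE; congr (_ * _); apply: eq_bigr => n Nn.
by rewrite cfResE // cfun1E Nn conjC1 mulr1.
Qed.

(** The multiplicity is the average over n in N of the induced character, hence
    the sum of theta(n^x) over x in T and n in N, divided by |B| |N|. Each x in B
    contributes |N|; each x outside B contributes only for n = 1, and there are
    at most |B| |N| of them. *)
Lemma Ind_borel_fixed (theta : 'CF(B)) : {in N, forall n, theta n = 1} ->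
  '['Res[N] ('Ind[T] theta), 1] <= 2%:R.
Proof.
move=> th_N; rewrite cfdot_Res_unip.
have sBT := sub_borel T; have sNB : N \subset B := sub_unip_borel T.
under eq_bigr => n _ do rewrite (cfIndE _ _ sBT).
rewrite -mulr_sumr exchange_big /=.
have -> : \sum_(x in T) \sum_(n in N) theta (n ^ x)%g =
   #|B|%:R * #|N|%:R + #|T :\: B|%:R.
  rewrite (big_setID B) /= (setIidPr sBT); congr (_ + _).
    transitivity (\sum_(x in B) (#|N|%:R : algC)); last by rewrite sumr_const mulr_natl.
    apply: eq_bigr => x Bx; transitivity (\sum_(n in N) (1 : algC)).
      apply: eq_bigr => n Nn; apply: th_N; rewrite memJ_norm //.
      by apply: subsetP Bx; apply: normal_norm (unip_normal T).
    by rewrite sumr_const.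
  transitivity (\sum_(x in T :\: B) (1 : algC)); last by rewrite sumr_const.
  apply: eq_bigr => x /setDP[Tx Bx].
  rewrite (bigD1 1%g) ?group1 //= conj1g th_N // big1 ?addr0 // => n /andP[Nn n1].
  apply: cfun0; apply: contra n1 => Bnx.
  by apply/eqP; apply: (conj_unip_borel sK T_mem Nn Tx Bx Bnx).
have [B0 N0] : #|B|%:R != 0 :> algC /\ #|N|%:R != 0 :> algC by rewrite !neq0CG.
rewrite mulrA -invfM mulrC ler_pdivrMr; last by rewrite mulr_gt0 ?gt0CG.
rewrite mulr2n mulrDl mul1r lerD // mulrC // -natrM ler_nat mulnC //.
by have := card_notin_borel sK T_mem; rewrite mulnC.
Qed.

(** By Frobenius reciprocity such a constituent contains theta on B, on which N
    acts trivially. *)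
Lemma constt_Ind_fixed (theta : Iirr B) i : {in N, forall n, 'chi_theta n = 1} ->
  i \in irr_constt ('Ind[T] 'chi_theta) -> 1 <= '['Res[N] 'chi[T]_i, 1].
Proof.
move=> th_N; rewrite constt_Ind_Res => /constt_charP.
have sBT := sub_borel T; have sNB : N \subset B := sub_unip_borel T.
case; first by rewrite cfRes_char ?irr_char.
move=> chi Nchi E; rewrite -(cfResRes _ sNB sBT) E raddfD /= cfdotDl.
have -> : 'Res[N] 'chi_theta = 1.
  by apply/cfun_inP=> n Nn; rewrite cfResE // th_N // cfun1E Nn.
rewrite cfnorm1 lerDl; apply: natr_ge0.
by rewrite Cnat_cfdot_char ?cfRes_char ?cfun1_char.
Qed.

(** If pi has two independent N-fixed vectors, it is a constituent of some
    Ind theta with theta a character of B trivial on N. Any further constituent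
    would bring one more N-fixed vector, and Ind theta has only two; so pi is
    equal to Ind theta. *)
Lemma unip_fixed_le1 d (pi : mx_representation algC T d) :
  mx_irreducible pi -> ~ fully_induced pi -> '['Res[N] (cfRepr pi), 1] <= 1.
Proof.
move=> irr_pi nfi.
have sBT := sub_borel T; have sNB : N \subset B := sub_unip_borel T.
have sNT := subset_trans sNB sBT.
have d_gt0 : (0 < d)%N by case/mx_irrP: irr_pi.
have /irrP[i Di] := scalar_commutant_irr (irr_scalar_commutant irr_pi) d_gt0.
rewrite Di; have : '['Res[N] 'chi_i, 1] \is a Num.nat.
  by rewrite Cnat_cfdot_char ?cfRes_char ?irr_char ?cfun1_char.
case/natrP=> m Dm; rewrite Dm lern1 leqNgt; apply/negP=> m_gt1; apply: nfi.
(* A constituent t common to Res_B pi and Ind_N^B 1 exists because the pairing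
   of these two characters is the multiplicity m. *)
have /existsP[t /andP[It Rt]] : [exists t : Iirr B,
    ('['Res[B] 'chi_i, 'chi_t] != 0) && ('['Ind[B, N] 1, 'chi_t] != 0)].
  apply: contraTT m_gt1; rewrite negb_exists => /forallP h.
  have : '['Res[N] 'chi_i, 1] = 0.
    rewrite -(cfResRes _ sNB sBT) cfdotC Frobenius_reciprocity cfdot_sum_irr.
    rewrite big1 ?conjC0 // => t _; have := h t; rewrite negb_and !negbK.
    by case/orP=> /eqP->; rewrite ?conjC0 ?mul0r ?mulr0.
  by rewrite Dm => /eqP; rewrite pnatr_eq0 => /eqP->.
have N0 : 0 \in irr_constt ('Res[N] 'chi_t).
  rewrite irr_consttE irr0 cfdotC conjC_eq0.
  by rewrite cfdotC conjC_eq0 Frobenius_reciprocity cfdotC conjC_eq0 in Rt *.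
have kerN := constt0_Res_cfker (unip_normal T) N0.
have lin_t : 'chi_t \is a linear_char.
  by rewrite lin_irr_der1 (subset_trans (borel_der T)).
have th_N : {in N, forall n, 'chi_t n = 1}.
  move=> n Nn; rewrite cfker1 ?lin_char1 //.
  exact: subsetP kerN n Nn.
have [chi Dchi] := linear_borel_char lin_t th_N.
exists chi; rewrite /principal_series -Dchi Di.
have Nind : 'Ind[T] 'chi_t \is a character by rewrite cfInd_char ?irr_char.
have Ii : i \in irr_constt ('Ind[T] 'chi_t) by rewrite constt_Ind_Res.
have /(constt_charP i Nind)[psi Npsi Epsi] := Ii.
have [psi0|psi0] := eqVneq psi 0; first by rewrite Epsi psi0 addr0.
have [j Ij] := neq0_has_constt psi0.
have /(constt_charP j Npsi)[psi' Npsi' Epsi'] := Ij.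
have Jj : j \in irr_constt ('Ind[T] 'chi_t).
  rewrite irr_consttE Epsi Epsi' cfdotDl cfdotDl cfnorm_irr.
  rewrite addrCA addrC gt_eqF // ltr_wpDl ?ltr01 //.
  by rewrite addr_ge0 // natr_ge0 // Cnat_cfdot_char_irr ?irr_char.
have := Ind_borel_fixed th_N; rewrite Epsi Epsi' !raddfD /= !cfdotDl.
have := constt_Ind_fixed th_N Jj; rewrite Dm => le1 le2.
have Ny : 0 <= '['Res[N] psi', 1].
  by rewrite natr_ge0 // Cnat_cfdot_char ?cfRes_char ?cfun1_char.
have : (3%:R : algC) <= 2%:R.
  apply: le_trans le2; rewrite (natrD _ 2 1) lerD ?ler_nat //.
  by rewrite -[1%:R]addr0 lerD.
by rewrite ler_nat.
Qed.

End UnipotentFixed.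

(** * Operators commuting with the unipotent radical *)
Section Idempotents.
Variables (F : numFieldType) (d : nat).
Implicit Types P Y : 'M[F]_d.

Lemma base_idempotent P : P *m P = P -> row_base P *m col_base P = 1%:M.
Proof.
move=> PP; have /row_freeP[B RB] := row_base_free P.
have /row_fullP[C CC] := col_base_full P.
have CP : C *m P = row_base P.
  by rewrite -[X in C *m X](mulmx_base P) mulmxA CC mul1mx.
have PB : P *m B = col_base P.
  by rewrite -[X in X *m B](mulmx_base P) -mulmxA RB mulmx1.
by rewrite -[in LHS]CP -[in LHS]PB mulmxA -(mulmxA C) PP CP RB.
Qed.

Lemma trace_idempotent P : P *m P = P -> \tr P = (\rank P)%:R.
Proof.
by move=> PP; rewrite -[X in \tr X](mulmx_base P) mxtrace_mulC base_idempotent // mxtrace1.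
Qed.

(** An operator that factors through a line on both sides is a multiple of the
    projector onto it. *)
Lemma corner_rank1 P Y : (\rank P <= 1)%N -> P *m Y *m P = Y ->
  exists a, Y = a *: P.
Proof.
have aux r (C : 'M[F]_(d, r)) (B : 'M_(r, d)) : (r <= 1)%N ->
    exists a, C *m B *m Y *m (C *m B) = a *: (C *m B).
  move=> r1; have [a Ea] : exists a, B *m (Y *m C) = a%:M.
    case: r B C r1 => [|[|r]] B C // _; first by exists 0; apply/matrixP=> -[].
    by exists ((B *m (Y *m C)) 0 0); apply: mx11_scalar.
  by exists a; rewrite -!mulmxA (mulmxA Y) (mulmxA B) Ea mul_scalar_mx -scalemxAr.
move=> /(aux _ (col_base P) (row_base P))[a]; rewrite mulmx_base => Ea <-.
by exists a.
Qed.

End Idempotents.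

Section UnipotentCommutant.
Variables (R : finFieldType) (s : {rmorphism R -> R}).
Hypothesis sK : involutive s.
Variable T : {group {'GL_2[R]}}.
Hypothesis T_mem : forall g, (g \in T) =
  (GLval g *m symp_form 1 *m (map_mx s (GLval g))^T == symp_form 1).
Local Notation N := (unip_group T).
Local Notation tau2 := (@tau 2 R).
Variables (d : nat) (pi : mx_representation algC T d).

Lemma tr_pi_tau g : g \in T -> \tr (pi (tau2 g)) = \tr (pi g).
Proof.
move=> Tg; have [x Tx E] := tau_conj sK T_mem Tg.
have Ttg := tau_T sK T_mem Tg.
rewrite -[pi (tau2 g)]mulmx1 -(repr_mx1 pi) -(mulgV x) repr_mxM ?groupV //.
by rewrite mulmxA -repr_mxM // -E mxtrace_mulC -repr_mxM ?groupM ?groupV // mulKg.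
Qed.

Lemma tau_unip n : n \in N -> tau2 n = n.
Proof.
by case/(unipP sK T_mem)=> u /U11_n Un ->; rewrite /gn (tau_gl2 sK Un).
Qed.

Lemma unip_T : {subset N <= T}.
Proof. by apply/subsetP; apply: subset_trans (sub_unip_borel T) (sub_borel T). Qed.

Lemma gt_gn a v : a != 0 -> s v = v ->
  (gt s a * gn v = gn (a * s a * v) * gt s a)%g.
Proof.
move=> a0 sv; have Ut := U11_t sK a0; have Un := U11_n sv.
have sw : s (a * s a * v) = a * s a * v by rewrite !rmorphM sK sv [s a * a]mulrC.
have Uw := U11_n sw; have sa0 : s a != 0 by rewrite fmorph_eq0.
by rewrite /gt /gn !(gl2M sK T_mem) //; congr gl2; field.
Qed.

Section Equivariant.
Variables (lam : {'GL_2[R]} -> algC) (Y : 'M[algC]_d).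
Hypothesis lam_l : {in N, forall n, pi n *m Y = lam n *: Y}.
Hypothesis lam_r : {in N, forall n, Y *m pi n = lam n *: Y}.
Let f g := \tr (Y *m pi g).

Let f_l n g : n \in N -> g \in T -> f (n * g)%g = lam n * f g.
Proof.
by move=> Nn Tg; have Tn := unip_T Nn; rewrite /f repr_mxM // mulmxA lam_r // -scalemxAl mxtraceZ.
Qed.

Let f_r n g : n \in N -> g \in T -> f (g * n)%g = lam n * f g.
Proof.
move=> Nn Tg; have Tn := unip_T Nn; rewrite /f repr_mxM // mulmxA mxtrace_mulC mulmxA lam_l //.
by rewrite -scalemxAl mxtraceZ.
Qed.

(** The function f transforms on both sides under the same character lam of N,
    and tau fixes N pointwise. On the big cell, tau fixes the antidiagonal
    middle factor and exchanges the two factors in N, which f does not notice.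
    On the torus, moving N across an element with upper left entry a scales it
    by a s(a), and since lam is non-trivial f vanishes unless a s(a) = 1, where
    tau fixes the torus element. *)
Lemma whittaker_tau : {in N &, {morph lam : x y / (x * y)%g >-> x * y}} ->
    (exists2 n, n \in N & lam n != 1) ->
  {in T, forall g, f (tau2 g) = f g}.
Proof.
move=> lamM [n0 Nn0 lam_n0] g /(TP sK T_mem)[a b c e U ->].
have [c0|c0] := eqVneq c 0; last first.
  have [u [v [b' [c' [su sv U' ->]]]]] := bruhat_decomp sK T_mem U c0.
  have [Nu Nv] := (mem_unip sK T_mem su, mem_unip sK T_mem sv).
  have Tm := mem_gl2 sK T_mem U'; have [Tu Tv] := (unip_T Nu, unip_T Nv).
  rewrite !tauM (tau_unip Nu) (tau_unip Nv) (tau_gl2 sK U') mulgA f_r ?groupM // f_l //.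
  by rewrite f_r ?groupM // f_l // mulrCA.
rewrite c0 in U *.
rewrite (upper_decomp sK T_mem U); have [a0 _ su] := U11_upper sK U.
have Nu := mem_unip sK T_mem su; have Tu := unip_T Nu.
have tau_gt x : x != 0 -> tau2 (gt s x) = gt s (s x)^-1.
  by move=> x0; rewrite (tau_gl2 sK (U11_t sK x0)) /gt fmorphV sK invrK.
have Tgt x : x != 0 -> gt s x \in T by apply: (mem_gt sK T_mem).
have sa0 : (s a)^-1 != 0 by rewrite invr_eq0 fmorph_eq0.
rewrite tauM (tau_unip Nu) tau_gt // (f_r Nu) ?Tgt // (f_l Nu) ?Tgt //; congr (_ * _).
have [na1|na1] := eqVneq (a * s a) 1; first by rewrite mulrC in na1; rewrite (mulr1_eq na1).
have f0 x : x != 0 -> x * s x != 1 -> f (gt s x) = 0.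
  move=> x0 nx1; apply: contraNeq lam_n0 => fx0.
  (* On gt s x, gn v acts from the right by lam (gn v) and, once moved to the
     left, by lam (gn (x s(x) v)); v is chosen so that the quotient of these
     two values is lam (gn w). *)
  have [w sw ->] := unipP sK T_mem Nn0.
  have sNx : s (1 - x * s x) = 1 - x * s x.
    by rewrite rmorphB rmorph1 rmorphM sK [s x * x]mulrC.
  have Nx0 : 1 - x * s x != 0 by rewrite subr_eq0 eq_sym.
  have [v sv Dv] : exists2 v, s v = v & w = (1 - x * s x) * v.
    by exists (w / (1 - x * s x)); [rewrite fmorph_div sw sNx | rewrite mulrC divfK].
  have sxv : s (x * s x * v) = x * s x * v.
    by rewrite !rmorphM sK sv [s x * x]mulrC.
  have [Nv Nxv] := (mem_unip sK T_mem sv, mem_unip sK T_mem sxv).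
  have Elam : lam (gn v) = lam (gn (x * s x * v)).
    apply: (mulIf fx0); rewrite -(f_r Nv) ?Tgt // -(f_l Nxv) ?Tgt //.
    by rewrite gt_gn.
  have lamV : lam (gn (x * s x * v)) != 0.
    apply/eqP=> l0; have := lamM _ _ (groupVr Nxv) Nxv.
    rewrite l0 mulr0 mulVg => l1; move: fx0; rewrite /f -[Y]mul1mx -(repr_mx1 pi).
    by rewrite lam_l ?group1 // l1 scale0r mul0mx mxtrace0 eqxx.
  apply/eqP; apply: (mulIf lamV); rewrite mul1r -lamM //; last exact: (mem_unip sK T_mem sw).
  rewrite -[in RHS]Elam (gnM sK T_mem) //; congr (lam (gn _)).
  by rewrite Dv; ring.
rewrite !f0 //; apply: contra na1; rewrite fmorphV sK -invfM mulrC => /eqP E.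
by rewrite -[_ * _]invrK E invr1.
Qed.

(** Let P be the projector onto the N-fixed vectors, of rank at most 1. Then
    Y = P Y P is a multiple of P, and tr (P pi(g)) is the average over n in N of
    the character of pi at n g. Since tau n = n and tau preserves this character,
    the average is the same for tau g. *)
Lemma fixed_tau : '['Res[N] (cfRepr pi), 1] <= 1 -> {in N, forall n, lam n = 1} ->
  {in T, forall g, f (tau2 g) = f g}.
Proof.
move=> le1 lam1 g Tg.
pose P := #|N|%:R^-1 *: \sum_(n in N) pi n.
have N0 : #|N|%:R != 0 :> algC by rewrite neq0CG.
have Pl : P *m Y = Y.
  rewrite -scalemxAl mulmx_suml (eq_bigr (fun=> Y)) => [|n Nn].
    by rewrite sumr_const -scaler_nat scalerA mulVf // scale1r.
  by rewrite lam_l // lam1 // scale1r.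
have Pr : Y *m P = Y.
  rewrite -scalemxAr mulmx_sumr (eq_bigr (fun=> Y)) => [|n Nn].
    by rewrite sumr_const -scaler_nat scalerA mulVf // scale1r.
  by rewrite lam_r // lam1 // scale1r.
have PP : P *m P = P.
  rewrite {1}/P -scalemxAl mulmx_suml (eq_bigr (fun=> P)) => [|n Nn].
    by rewrite sumr_const -scaler_nat scalerA mulVf // scale1r.
  rewrite /P -scalemxAr; congr (_ *: _); rewrite mulmx_sumr -[RHS](sum_groupMl _ Nn).
  by apply: eq_bigr => m Nm; rewrite repr_mxM ?unip_T.
have rP : (\rank P <= 1)%N.
  rewrite -(@ler_nat algC) -(trace_idempotent PP) /P mxtraceZ raddf_sum /=.
  apply: le_trans le1; rewrite cfdot_Res_unip le_eqVlt; apply/orP; left; apply/eqP.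
  by congr (_ * _); apply: eq_bigr => n Nn; rewrite cfunE unip_T.
have [|a Ea] := corner_rank1 rP (Y := Y); first by rewrite Pl Pr.
rewrite /f Ea.
rewrite -!scalemxAl !mxtraceZ; congr (_ * (_ * _)); rewrite !mulmx_suml !raddf_sum /=.
apply: eq_bigr => n Nn; have Tn := unip_T Nn.
rewrite mxtrace_mulC -repr_mxM ?(tau_T sK T_mem) // -{1}(tau_unip Nn) -tauM.
by rewrite tr_pi_tau ?groupM // repr_mxM.
Qed.

End Equivariant.

Hypothesis pi_fix : '['Res[N] (cfRepr pi), 1] <= 1.

Lemma unip_abelian : abelian N.
Proof.
apply/centsP=> _ /(unipP sK T_mem)[u su ->] _ /(unipP sK T_mem)[v sv ->].
by rewrite /commute !(gnM sK T_mem) // addrC.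
Qed.

(** X is the sum of its products X e_i with the idempotents e_i of the
    characters of the abelian group N. Each term is equivariant under one
    character, which is non-trivial ([whittaker_tau]) or trivial ([fixed_tau]). *)
Lemma unip_commutant_tau (X : 'M[algC]_d) :
    (forall u, s u = u -> pi (gn u) *m X = X *m pi (gn u)) ->
  {in T, forall g, \tr (X *m pi (tau2 g)) = \tr (X *m pi g)}.
Proof.
move=> cX; have {}cX n : n \in N -> pi n *m X = X *m pi n.
  by case/(unipP sK T_mem)=> u su ->; apply: cX.
have N0 : #|N|%:R != 0 :> algC by rewrite neq0CG.
have lin (i : Iirr N) : 'chi_i \is a linear_char.
  by apply/char_abelianP; apply: unip_abelian.
pose e (i : Iirr N) := #|N|%:R^-1 *: \sum_(n in N) 'chi_i n^-1%g *: pi n.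
have sum_e : \sum_i e i = 1%:M.
  rewrite -scaler_sumr exchange_big /= (bigD1 1%g) ?group1 //=.
  have sum_chi n : \sum_(i : Iirr N) 'chi_i n^-1%g *: pi n = cfReg N n^-1%g *: pi n.
    rewrite -scaler_suml cfReg_sum sum_cfunE; congr (_ *: _).
    by apply: eq_bigr => i _; rewrite cfunE lin_char1 ?mul1r.
  rewrite sum_chi invg1 cfRegE eqxx mulr1n repr_mx1 big1 ?addr0 => [|n /andP[_ n1]].
    by rewrite scalerA mulVf // scale1r.
  by rewrite sum_chi cfRegE invg_eq1 (negPf n1) mulr0n scale0r.
have e_l i n : n \in N -> pi n *m e i = 'chi_i n *: e i.
  move=> Nn; rewrite -scalemxAr scalerA mulrC -scalerA; congr (_ *: _).
  rewrite mulmx_sumr scaler_sumr -[RHS](sum_groupMl _ Nn); apply: eq_bigr => m Nm.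
  rewrite -scalemxAr scalerA -repr_mxM ?unip_T //; congr (_ *: _).
  by rewrite mulrC -lin_charM ?groupV ?groupM // invMg -mulgA mulVg mulg1.
have e_r i n : n \in N -> e i *m pi n = 'chi_i n *: e i.
  move=> Nn; rewrite -e_l // -scalemxAl -scalemxAr; congr (_ *: _).
  rewrite mulmx_suml mulmx_sumr; apply: eq_bigr => m Nm.
  rewrite -scalemxAl -scalemxAr -!repr_mxM ?unip_T //.
  by rewrite (centsP unip_abelian m Nm n Nn).
have Xe i : e i *m X = X *m e i.
  rewrite -scalemxAl -scalemxAr; congr (_ *: _).
  rewrite mulmx_suml mulmx_sumr; apply: eq_bigr => m Nm.
  by rewrite -scalemxAl -scalemxAr cX.
move=> g Tg; rewrite -[X]mulmx1 -sum_e mulmx_sumr !mulmx_suml !raddf_sum /=.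
apply: eq_bigr => i _.
have Yl : {in N, forall n, pi n *m (X *m e i) = 'chi_i n *: (X *m e i)}.
  by move=> n Nn; rewrite mulmxA cX // -mulmxA e_l // scalemxAr.
have Yr : {in N, forall n, X *m e i *m pi n = 'chi_i n *: (X *m e i)}.
  by move=> n Nn; rewrite -mulmxA e_r // scalemxAr.
have [/exists_inP[n Nn ntn]|/exists_inPn triv] :=
    boolP [exists n in N, 'chi_i n != 1].
  apply: (whittaker_tau Yl Yr) => //; last by exists n.
  exact: lin_charM.
by apply: (fixed_tau Yl Yr) => // n Nn; apply/eqP/negPn/triv.
Qed.

End UnipotentCommutant.

(** * The Jacobi subgroup *)
Notation M4 a11 a12 a13 a14 a21 a22 a23 a24 a31 a32 a33 a34 a41 a42 a43 a44 :=
  (mx_of_rows 4 [:: [:: a11; a12; a13; a14]; [:: a21; a22; a23; a24];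
                    [:: a31; a32; a33; a34]; [:: a41; a42; a43; a44]]).

Definition o0 : 'I_4 := @Ordinal 4 0 isT.
Definition o1 : 'I_4 := @Ordinal 4 1 isT.
Definition o2 : 'I_4 := @Ordinal 4 2 isT.
Definition o3 : 'I_4 := @Ordinal 4 3 isT.

Lemma forall_I4 (P : 'I_4 -> Prop) : P o0 -> P o1 -> P o2 -> P o3 -> forall i, P i.
Proof.
move=> P0 P1 P2 P3 i; case: i => [[|[|[|[|i]]]] lti] //.
- by rewrite (_ : Ordinal lti = o0) //; apply: val_inj.
- by rewrite (_ : Ordinal lti = o1) //; apply: val_inj.
- by rewrite (_ : Ordinal lti = o2) //; apply: val_inj.
by rewrite (_ : Ordinal lti = o3) //; apply: val_inj.
Qed.

Lemma sum_I4 (V : nmodType) (F : 'I_4 -> V) :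
  \sum_i F i = F o0 + F o1 + F o2 + F o3.
Proof.
rewrite !big_ord_recl big_ord0 addr0 !addrA; congr (_ + _ + _ + _); congr F; exact: val_inj.
Qed.

Lemma o0E : o0 = lshift (2 + 1) (ord0 : 'I_1) :> 'I_(1 + (2 + 1)).
Proof. exact: val_inj. Qed.
Lemma o1E : o1 = rshift 1 (lshift 1 (ord0 : 'I_2)) :> 'I_(1 + (2 + 1)).
Proof. exact: val_inj. Qed.
Lemma o2E : o2 = rshift 1 (lshift 1 (ord_max : 'I_2)) :> 'I_(1 + (2 + 1)).
Proof. exact: val_inj. Qed.
Lemma o3E : o3 = rshift 1 (rshift 2 (ord0 : 'I_1)) :> 'I_(1 + (2 + 1)).
Proof. exact: val_inj. Qed.
Definition oE := (o0E, o1E, o2E, o3E).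

Section FourByFour.
Variable R : comPzRingType.
Implicit Types A B : 'M[R]_4.

Lemma M4E A : A = M4 (A o0 o0) (A o0 o1) (A o0 o2) (A o0 o3)
                     (A o1 o0) (A o1 o1) (A o1 o2) (A o1 o3)
                     (A o2 o0) (A o2 o1) (A o2 o2) (A o2 o3)
                     (A o3 o0) (A o3 o1) (A o3 o2) (A o3 o3).
Proof. by apply/matrixP; do 2!apply: forall_I4; rewrite mxE. Qed.

Lemma eq_M4 a11 a12 a13 a14 a21 a22 a23 a24 a31 a32 a33 a34 a41 a42 a43 a44 A :
  A o0 o0 = a11 -> A o0 o1 = a12 -> A o0 o2 = a13 -> A o0 o3 = a14 ->
  A o1 o0 = a21 -> A o1 o1 = a22 -> A o1 o2 = a23 -> A o1 o3 = a24 ->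
  A o2 o0 = a31 -> A o2 o1 = a32 -> A o2 o2 = a33 -> A o2 o3 = a34 ->
  A o3 o0 = a41 -> A o3 o1 = a42 -> A o3 o2 = a43 -> A o3 o3 = a44 ->
  A = M4 a11 a12 a13 a14 a21 a22 a23 a24 a31 a32 a33 a34 a41 a42 a43 a44.
Proof. by do 16!move=> <-; apply: M4E. Qed.

Lemma mulM4 A B i j :
  (A *m B) i j = A i o0 * B o0 j + A i o1 * B o1 j + A i o2 * B o2 j + A i o3 * B o3 j.
Proof. by rewrite mxE sum_I4. Qed.

Lemma diag_1g1E a b c d :
  diag_1g1 (M2 a b c d) = M4 1 0 0 0 0 a b 0 0 c d 0 0 0 0 1 :> 'M[R]_4.
Proof.
apply: eq_M4; rewrite /diag_1g1 !oE;
rewrite ?(@block_mxEul _ 1 (2 + 1) 1 (2 + 1)) ?(@block_mxEur _ 1 (2 + 1) 1 (2 + 1))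
        ?(@block_mxEdl _ 1 (2 + 1) 1 (2 + 1)) ?(@block_mxEdr _ 1 (2 + 1) 1 (2 + 1))
        ?block_mxEul ?block_mxEur ?block_mxEdl ?block_mxEdr !mxE //.
Qed.

Lemma FJ_shapeM4 A : reflect
  [/\ A o0 o0 = 1, [/\ A o1 o0 = 0, A o2 o0 = 0 & A o3 o0 = 0]
    & [/\ A o3 o1 = 0, A o3 o2 = 0 & A o3 o3 = 1]]
  (FJ_shape (A : 'M_(1 + (2 + 1)))).
Proof.
apply: (iffP and4P).
  case=> /eqP/matrixP E1 /eqP/matrixP E2 /eqP/matrixP E3 /eqP/matrixP E4.
  move: (E1 0 0) (E2 (lshift 1 ord0) 0) (E2 (lshift 1 ord_max) 0) (E2 (rshift 2 0) 0)
    (E3 0 ord0) (E3 0 ord_max) (E4 0 0); rewrite !mxE -!oE.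
  by move=> -> -> -> -> -> -> ->.
case=> E00 [E10 E20 E30] [E31 E32 E33]; split; apply/eqP/matrixP=> i j; rewrite !mxE.
- by rewrite !ord1 -!oE.
- by rewrite [j]ord1; case: i => [[|[|[|i]]] lti] //;
    [rewrite -[RHS]E10 | rewrite -[RHS]E20 | rewrite -[RHS]E30];
    congr (A _ _); apply: val_inj.
- by rewrite [i]ord1; case: j => [[|[|j]] ltj] //;
    [rewrite -[RHS]E31 | rewrite -[RHS]E32]; congr (A _ _); apply: val_inj.
by rewrite !ord1 -!oE.
Qed.

Lemma mid_blockM4 A : mid_block (A : 'M_(1 + (2 + 1))) = M2 (A o1 o1) (A o1 o2) (A o2 o1) (A o2 o2).
Proof. by rewrite [LHS]M2E !mxE !oE. Qed.

Lemma symp_form2E : symp_form 2 = M4 0 0 0 1 0 0 1 0 0 (- 1) 0 0 (- 1) 0 0 0 :> 'M[R]_4.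
Proof. by apply: eq_M4; rewrite (@symp_formE _ 2) /= ?expr0 ?expr1. Qed.

End FourByFour.

Lemma flip_M4 (S : comNzRingType) (a11 a12 a13 a14 a21 a22 a23 a24 a31 a32 a33 a34 a41 a42 a43 a44 : S) :
  flip_mx (M4 a11 a12 a13 a14 a21 a22 a23 a24 a31 a32 a33 a34 a41 a42 a43 a44)
  = M4 a44 a34 a24 a14 a43 a33 a23 a13 a42 a32 a22 a12 a41 a31 a21 a11.
Proof. by apply: eq_M4; rewrite !mxE. Qed.

Section Unitary4.
Variables (R : comNzRingType) (s : {rmorphism R -> R}).
(** The (i, j) entry of A F s(A)^T. *)
Definition herm4 (A : 'M[R]_4) i j :=
  A i o0 * s (A j o3) + A i o1 * s (A j o2) - A i o2 * s (A j o1) - A i o3 * s (A j o0).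

Lemma herm4E (A : 'M[R]_4) i j :
  (A *m symp_form 2 *m (map_mx s A)^T) i j = herm4 A i j.
Proof.
by rewrite !mulM4 !(symp_form2E R) !mxE /= /herm4; ring.
Qed.

Lemma unitary4P (A : 'M[R]_4) :
  reflect (forall i j, herm4 A i j = symp_form 2 i j)
          (A *m symp_form 2 *m (map_mx s A)^T == symp_form 2).
Proof.
apply: (iffP eqP) => [E i j|E]; first by rewrite -herm4E E.
by apply/matrixP=> i j; rewrite herm4E.
Qed.

End Unitary4.

Section JacobiGroup.
Variables (R : finFieldType) (s : {rmorphism R -> R}).
Hypothesis sK : involutive s.
Hypothesis two_neq0 : 2%:R != 0 :> R.
Variable T : {group {'GL_2[R]}}.
Hypothesis T_mem : forall g, (g \in T) =
  (GLval g *m symp_form 1 *m (map_mx s (GLval g))^T == symp_form 1).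
Variables G J : {group {'GL_4[R]}}.
Hypothesis G_mem : forall g, (g \in G) =
  (GLval g *m symp_form 2 *m (map_mx s (GLval g))^T == symp_form 2).
Hypothesis J_mem : forall u, (u \in J) =
  [&& u \in G, FJ_shape (GLval u) & [exists g in T, mid_block (GLval u) == GLval g]].

(** The parametrisation of the Heisenberg group of a hermitian plane. When s is
    the identity, the two terms with 1/2 cancel and this is the usual matrix of
    the symplectic case. *)
Definition heis (x y z : R) : 'M[R]_4 :=
  M4 1 x y (z - 2%:R^-1 * s x * y + 2%:R^-1 * x * s y)
     0 1 0 (s y)
     0 0 1 (- s x)
     0 0 0 1.

Lemma unitary4_unit (A : 'M[R]_4) :
  A *m symp_form 2 *m (map_mx s A)^T = symp_form 2 -> A \in unitmx.
Proof.
move=> E; suff /mulmx1_unit[] :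
  A *m (- (symp_form 2 *m (map_mx s A)^T *m symp_form 2)) = 1%:M by [].
by rewrite mulmxN !mulmxA E (@symp_form_sq R 2) opprK.
Qed.

Lemma mem_G (A : 'M[R]_4) :
  A *m symp_form 2 *m (map_mx s A)^T = symp_form 2 ->
  GLval (to_GL (n := 4) A) = A /\ to_GL (n := 4) A \in G.
Proof.
move=> E; have DA := to_GLE (n := 4) (unitary4_unit E).
by rewrite G_mem !DA E.
Qed.

Definition sE := (rmorph1, rmorph0, rmorph_nat, rmorphD, rmorphB, rmorphN, rmorphM, fmorphV).

Lemma heis_unitary x y z : s z = z ->
  heis x y z *m symp_form 2 *m (map_mx s (heis x y z))^T = symp_form 2.
Proof.
move=> sz; apply/eqP/unitary4P.
do 2!apply: forall_I4; rewrite /herm4 (symp_form2E R) !mxE /= ?sE ?sK ?sz; try ring.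
by field; exact: two_neq0.
Qed.

(** The elements of G underlying the Heisenberg group, for z fixed by s, and
    the embedding of T as the middle block. Both are locked, as [gl2] is. *)
Fact heisG_key : unit. Proof. by []. Qed.
Definition heisG (x y z : R) : {'GL_4[R]} :=
  locked_with heisG_key (fun x y z => to_GL (n := 4) (heis x y z)) x y z.

Arguments heisG (x y z)%_R.
Local Notation H := heisG.

Lemma heisGE x y z : s z = z -> GLval (H x y z) = heis x y z.
Proof.
move=> sz; rewrite /heisG unlock; apply: (to_GLE (n := 4)).
exact: unitary4_unit (heis_unitary x y sz).
Qed.

Fact levi_key : unit. Proof. by []. Qed.
Definition levi (g : {'GL_2[R]}) : {'GL_4[R]} :=
  locked_with levi_key (fun g : {'GL_2[R]} => to_GL (n := 4) (diag_1g1 (GLval g))) g.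

Lemma leviE g : GLval (levi g) = diag_1g1 (GLval g).
Proof.
rewrite /levi unlock to_GLE //; apply: diag_1g1_unit.
exact: (@GL_unitmx 2 R g).
Qed.

Lemma diag_1g1M (A B : 'M[R]_2) : diag_1g1 (A *m B) = diag_1g1 A *m diag_1g1 B.
Proof.
rewrite /diag_1g1 !mulmx_block.
by rewrite !(mul0mx, mulmx0, mul1mx, mulmx1, addr0, add0r).
Qed.

Lemma leviM g h : levi (g * h)%g = (levi g * levi h)%g.
Proof.
by apply: GLval_inj; rewrite GL_MxE !leviE GL_MxE diag_1g1M.
Qed.

Lemma levi1 : levi 1%g = 1%g.
Proof. by apply: (mulgI (levi 1%g)); rewrite -leviM !mulg1. Qed.

Lemma leviV g : levi g^-1%g = (levi g)^-1%g.
Proof. by apply: (mulgI (levi g)); rewrite -leviM !mulgV levi1. Qed.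

Lemma levi_G g : g \in T -> levi g \in G.
Proof.
case/(TP sK T_mem)=> a b c d U ->; rewrite G_mem leviE (gl2E sK U) diag_1g1E.
have E4 := U11_inv sK U; case: U => E1 E2 E3.
apply/unitary4P; do 2!apply: forall_I4; rewrite /herm4 (symp_form2E R) !mxE /= ?sE; try ring.
- by transitivity (a * s b - b * s a); [ring | rewrite E1 subrr].
- by rewrite -E2; ring.
- by rewrite -E4; ring.
by transitivity (c * s d - d * s c); [ring | rewrite E3 subrr].
Qed.

Lemma mid_block_levi g : mid_block (GLval (levi g)) = GLval g.
Proof. by rewrite leviE /mid_block block_mxKdr block_mxKul. Qed.

Lemma levi_J g : g \in T -> levi g \in J.
Proof.
move=> Tg; rewrite J_mem mid_block_levi; apply/and3P; split; first exact: levi_G.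
  by rewrite leviE /FJ_shape /diag_1g1 !(block_mxKul, block_mxKdl, block_mxKdr) !eqxx.
by apply/exists_inP; exists g.
Qed.

Lemma mid_block_heisG x y z : s z = z -> mid_block (GLval (H x y z)) = 1%:M.
Proof. by move=> sz; rewrite heisGE // mid_blockM4 !mxE /= -M2_1. Qed.

Lemma heisG_J x y z : s z = z -> H x y z \in J.
Proof.
move=> sz; rewrite J_mem mid_block_heisG //; apply/and3P; split.
- by rewrite G_mem heisGE // heis_unitary.
- by rewrite heisGE //; apply/FJ_shapeM4; rewrite !mxE.
by apply/exists_inP; exists 1%g; rewrite ?GL_1E.
Qed.

Lemma sub_JG : J \subset G.
Proof. by apply/subsetP=> u; rewrite J_mem => /and3P[]. Qed.

(** J is the stabiliser in G of the last basis row vector: the form then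
    determines the first column and, up to the central parameter z, the last
    one. *)
Lemma stab_e4_J g : g \in G -> (forall j, GLval g o3 j = (j == o3)%:R) ->
  exists g0 x y z, [/\ g0 \in T, s z = z & g = (levi g0 * H x y z)%g].
Proof.
move=> Gg g3; move: (Gg); rewrite G_mem => /unitary4P herm.
have E3 i : GLval g i o0 = symp_form 2 i o3 :> R.
  by rewrite -herm /herm4 !g3 /= !sE; ring.
have [g00 g10 g20 g30] := And4 (E3 o0) (E3 o1) (E3 o2) (E3 o3).
rewrite !(symp_form2E R) !mxE /= in g00 g10 g20 g30.
have U : U11 s (GLval g o1 o1) (GLval g o1 o2) (GLval g o2 o1) (GLval g o2 o2).
  move: (herm o1 o1) (herm o1 o2) (herm o2 o2).
  rewrite /herm4 g10 g20 !sE !(symp_form2E R) !mxE /= => h11 h12 h22.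
  split; last by apply: subr0_eq; rewrite -[RHS]h22; ring.
    by apply: subr0_eq; rewrite -[RHS]h11; ring.
  by rewrite -[RHS]h12; ring.
set x := GLval g o0 o1; set y := GLval g o0 o2; set w := GLval g o0 o3.
pose z := w + 2%:R^-1 * s x * y - 2%:R^-1 * x * s y.
have sz : s z = z.
  move: (herm o0 o0); rewrite /herm4 g00 -/x -/y -/w !sE (symp_form2E R) !mxE /= => h.
  apply: subr0_eq; rewrite -[RHS]h /z ?sE !sK; field; exact: two_neq0.
have g13 : GLval g o1 o3 = GLval g o1 o1 * s y - GLval g o1 o2 * s x.
  apply: subr0_eq; move: (herm o1 o0).
  rewrite /herm4 g10 g00 -/x -/y -/w !sE (symp_form2E R) !mxE /= => h.
  by rewrite -[RHS]oppr0 -[in RHS]h; ring.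
have g23 : GLval g o2 o3 = GLval g o2 o1 * s y - GLval g o2 o2 * s x.
  apply: subr0_eq; move: (herm o2 o0).
  rewrite /herm4 g20 g00 -/x -/y -/w !sE (symp_form2E R) !mxE /= => h.
  by rewrite -[RHS]oppr0 -[in RHS]h; ring.
exists (gl2 (GLval g o1 o1) (GLval g o1 o2) (GLval g o2 o1) (GLval g o2 o2)), x, y, z.
split=> //; first exact: (mem_gl2 sK T_mem U).
apply: GLval_inj; rewrite GL_MxE leviE (gl2E sK U) heisGE // diag_1g1E.
rewrite [LHS]M4E g00 g10 g20 g30 !g3 /= -/x -/y -/w g13 g23.
by apply/esym; apply: eq_M4; rewrite mulM4 !mxE /=; rewrite /z; ring.
Qed.

Lemma JP u : u \in J ->
  exists g0 x y z, [/\ g0 \in T, s z = z & u = (levi g0 * H x y z)%g].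
Proof.
rewrite J_mem => /and3P[Gu /FJ_shapeM4[_ [_ _ u30] [u31 u32 u33]] _].
by apply: stab_e4_J => //; apply: forall_I4.
Qed.

(** The commutator form on pairs (x, y) is the trace form of the hermitian
    plane; this is the group law of the Heisenberg group. *)
Lemma heisGM x y z x' y' z' : s z = z -> s z' = z' ->
  (H x y z * H x' y' z')%g = H (x + x') (y + y')
    (z + z' + 2%:R^-1 * (x * s y' - y * s x' + s x * y' - s y * x')).
Proof.
move=> sz sz'; apply: GLval_inj; rewrite GL_MxE !heisGE //; last first.
  by rewrite !sE !sK sz sz'; ring.
apply: eq_M4; rewrite mulM4 !mxE /= ?sE; try ring.
by field; exact: two_neq0.
Qed.

Lemma heisG_conj x y z a b c d : s z = z -> U11 s a b c d ->
  (H x y z * levi (gl2 a b c d) = levi (gl2 a b c d) * H (x * a + y * c) (x * b + y * d) z)%g.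
Proof.
move=> sz U; apply: GLval_inj; rewrite !GL_MxE leviE (gl2E sK U) !heisGE // diag_1g1E.
have E4 := U11_inv sK U; case: U => E1 E2 E3.
set x' := x * a + y * c; set y' := x * b + y * d.
have e1 : a * s y' - b * s x' = s y.
  transitivity (s x * (a * s b - b * s a) + s y * (a * s d - b * s c)).
    by rewrite /x' /y' !sE; ring.
  by rewrite E1 E2 subrr mulr0 add0r mulr1.
have e2 : c * s y' - d * s x' = - s x.
  transitivity (s x * (c * s b - d * s a) + s y * (c * s d - d * s c)).
    by rewrite /x' /y' !sE; ring.
  by rewrite E3 E4 subrr mulr0 addr0 mulrN1.
have e3 : x' * s y' - y' * s x' = x * s y - y * s x.
  transitivity (x * (a * s y' - b * s x') + y * (c * s y' - d * s x')).
    by rewrite {1}/x' {2}/y'; ring.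
  by rewrite e1 e2; ring.
rewrite [LHS]M4E; apply/esym/eq_M4; rewrite !mulM4 !mxE /= ?(mulr0, mul0r, mulr1, mul1r, add0r, addr0) //.
- by rewrite -!addrA; congr (_ + _); transitivity (2%:R^-1 * (x' * s y' - y' * s x')); [ring | rewrite e3; ring].
- by rewrite mulrN e1.
by rewrite mulrN e2.
Qed.

Lemma tau_levi a b c d : U11 s a b c d -> tau (n := 4) (levi (gl2 a b c d)) = levi (tau (n := 2) (gl2 a b c d)).
Proof.
move=> U; apply: GLval_inj; rewrite tauE !leviE tauE (gl2E sK U) M2_flip.
by rewrite !diag_1g1E flip_M4.
Qed.

Lemma tau_heisG x y z : s z = z -> tau (n := 4) (H x y z) = H (- s x) (s y) z.
Proof.
move=> sz; apply: GLval_inj; rewrite tauE !heisGE // flip_M4 /heis !sE !sK.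
by rewrite opprK; congr (M4 _ _ _ _ _ _ _ _ _ _ _ _ _ _ _ _); ring.
Qed.

Lemma tau_G g : g \in G -> tau (n := 4) g \in G.
Proof.
rewrite !G_mem tauE => /eqP Gg; apply/eqP.
exact: (flip_unitary (n := 2) sK Gg).
Qed.

Lemma tau_J u : u \in J -> tau (n := 4) u \in J.
Proof.
case/JP=> g [x [y [z [Tg sz ->]]]]; rewrite tauM tau_heisG //.
case/(TP sK T_mem): Tg => a b c d U ->; rewrite tau_levi // groupM ?heisG_J // levi_J //.
by rewrite (tau_gl2 sK U); apply: (mem_gl2 sK T_mem (U11_flip sK U)).
Qed.

End JacobiGroup.

Arguments heis {R} s (x y z)%_R.
Arguments heisG {R} s (x y z)%_R.

(** * Double cosets of the Jacobi subgroup *)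
Section DoubleCosets.
Variables (R : finFieldType) (s : {rmorphism R -> R}).
Hypothesis sK : involutive s.
Hypothesis two_neq0 : 2%:R != 0 :> R.
Variable T : {group {'GL_2[R]}}.
Hypothesis T_mem : forall g, (g \in T) =
  (GLval g *m symp_form 1 *m (map_mx s (GLval g))^T == symp_form 1).
Variables G J : {group {'GL_4[R]}}.
Hypothesis G_mem : forall g, (g \in G) =
  (GLval g *m symp_form 2 *m (map_mx s (GLval g))^T == symp_form 2).
Hypothesis J_mem : forall u, (u \in J) =
  [&& u \in G, FJ_shape (GLval u) & [exists g in T, mid_block (GLval u) == GLval g]].
Local Notation H := (heisG s).

Fact GL4_key : unit. Proof. by []. Qed.
Definition gl4 (A : 'M[R]_4) : {'GL_4[R]} :=
  locked_with GL4_key (fun A : 'M[R]_4 => to_GL (n := 4) A) A.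

Lemma gl4P (A : 'M[R]_4) : (forall i j, herm4 s A i j = symp_form 2 i j) ->
  GLval (gl4 A) = A /\ gl4 A \in G.
Proof. by move=> h; rewrite /gl4 unlock; apply: (mem_G G_mem); apply/eqP/unitary4P. Qed.

(** The Weyl elements exchanging the coordinates 1 and 4, respectively 1 with 2
    and 3 with 4. *)
Definition Weyl_corner (c : R) := gl4 (M4 0 0 0 c 0 1 0 0 0 0 1 0 (- (s c)^-1) 0 0 0).
Definition Weyl_swap := gl4 (M4 0 1 0 0 1 0 0 0 0 0 0 1 0 0 1 0).
Definition torus4 (a : R) := gl4 (M4 a 0 0 0 0 1 0 0 0 0 1 0 0 0 0 (s a)^-1).
Definition central4 (a : R) := gl4 (M4 a 0 0 0 0 a 0 0 0 0 a 0 0 0 0 a).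

Lemma Weyl_cornerP c : c != 0 ->
  GLval (Weyl_corner c) = M4 0 0 0 c 0 1 0 0 0 0 1 0 (- (s c)^-1) 0 0 0
  /\ Weyl_corner c \in G.
Proof.
move=> c0; have sc0 : s c != 0 by rewrite fmorph_eq0.
apply: gl4P; do 2!apply: forall_I4; rewrite /herm4 (symp_form2E R) !mxE /= ?sE ?sK; try ring.
all: by field.
Qed.

Lemma Weyl_swapP :
  GLval Weyl_swap = M4 0 1 0 0 1 0 0 0 0 0 0 1 0 0 1 0 /\ Weyl_swap \in G.
Proof.
by apply: gl4P; do 2!apply: forall_I4; rewrite /herm4 (symp_form2E R) !mxE /= ?sE ?sK; ring.
Qed.

Lemma torus4P a : a != 0 ->
  GLval (torus4 a) = M4 a 0 0 0 0 1 0 0 0 0 1 0 0 0 0 (s a)^-1 /\ torus4 a \in G.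
Proof.
move=> a0; have sa0 : s a != 0 by rewrite fmorph_eq0.
apply: gl4P; do 2!apply: forall_I4; rewrite /herm4 (symp_form2E R) !mxE /= ?sE ?sK; try ring.
all: by field.
Qed.

Lemma central4P a : a * s a = 1 ->
  GLval (central4 a) = M4 a 0 0 0 0 a 0 0 0 0 a 0 0 0 0 a /\ central4 a \in G.
Proof.
move=> aa; apply: gl4P; do 2!apply: forall_I4; rewrite /herm4 (symp_form2E R) !mxE /= ?sE ?aa; by ring.
Qed.

Lemma tau_corner c : c != 0 -> tau (n := 4) (Weyl_corner c) = Weyl_corner c.
Proof.
by case/Weyl_cornerP=> E _; apply: GLval_inj; rewrite tauE !E flip_M4.
Qed.

Lemma tau_swap : tau (n := 4) Weyl_swap = Weyl_swap.
Proof. by case: Weyl_swapP => E _; apply: GLval_inj; rewrite tauE !E flip_M4. Qed.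

Lemma tau_central a : a * s a = 1 -> tau (n := 4) (central4 a) = central4 a.
Proof. by case/central4P=> E _; apply: GLval_inj; rewrite tauE !E flip_M4. Qed.

Lemma corner_levi c g : c != 0 -> g \in T ->
  (Weyl_corner c * levi g = levi g * Weyl_corner c)%g.
Proof.
case/Weyl_cornerP=> E _ /(TP sK T_mem)[a b a' b' U ->]; apply: GLval_inj.
rewrite !GL_MxE !leviE !E (gl2E sK U) diag_1g1E.
by apply/matrixP; do 2!apply: forall_I4; rewrite !mulM4 !mxE /=; ring.
Qed.

(** The subgroup of elements gn b, H 0 y z is the Siegel unipotent radical: the
    matrices with identity diagonal blocks and upper right block
    (y, z; b, s(y)). Conjugation by [Weyl_swap] exchanges both the rows and the
    columns of that block. *)
Lemma swap_siegel b y z : s b = b -> s z = z ->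
  (Weyl_swap * (levi (gn b) * H 0 y z) = (levi (gn z) * H 0 (s y) b) * Weyl_swap)%g.
Proof.
move=> sb sz; have [E _] := Weyl_swapP; have [Ub Uz] := (U11_n sb, U11_n sz).
have siegelE u v w : diag_1g1 (M2 1 u 0 1) *m heis s 0 v w
    = M4 1 0 v w 0 1 u (s v) 0 0 1 0 0 0 0 1.
  by rewrite diag_1g1E; apply: eq_M4; rewrite mulM4 !mxE /= ?sE; ring.
apply: GLval_inj; rewrite !GL_MxE !leviE !E (gl2E sK Ub) (gl2E sK Uz) !(heisGE sK two_neq0) //.
rewrite !siegelE sK.
by apply/matrixP; do 2!apply: forall_I4; rewrite !mulM4 !mxE /=; ring.
Qed.

Lemma torus_center a z : a != 0 -> s z = z ->
  (torus4 a * H 0 0 z = H 0 0 (a * s a * z) * torus4 a)%g.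
Proof.
move=> a0 sz; have [E _] := torus4P a0; have sa0 : s a != 0 by rewrite fmorph_eq0.
have sw : s (a * s a * z) = a * s a * z.
  by rewrite !rmorphM sK sz [s a * a]mulrC.
apply: GLval_inj; rewrite !GL_MxE !E !(heisGE sK two_neq0) //.
apply/matrixP; do 2!apply: forall_I4; rewrite !mulM4 !mxE /= ?sE ?sK; try ring.
by field; rewrite ?two_neq0 ?sa0.
Qed.

Lemma torus4_central a : a * s a = 1 ->
  torus4 a = (central4 a * levi (gl2 (s a) 0 0 (s a)))%g /\ gl2 (s a) 0 0 (s a) \in T.
Proof.
move=> aa; have [Ec _] := central4P aa.
have a0 : a != 0 by apply: contra_eq_neq aa => ->; rewrite mul0r eq_sym oner_eq0.
have [Et _] := torus4P a0; have aV : (s a)^-1 = a by apply: mulr1_eq; rewrite mulrC.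
have U : U11 s (s a) 0 0 (s a).
  by split; rewrite ?rmorph0 ?mulr0 ?mul0r // sK mulrC aa subr0.
split; last exact: (mem_gl2 sK T_mem U).
apply: GLval_inj; rewrite GL_MxE Et Ec leviE (gl2E sK U) diag_1g1E aV.
by apply/matrixP; do 2!apply: forall_I4; rewrite !mulM4 !mxE /= ?aa; ring.
Qed.

Lemma central_comm a g : a * s a = 1 -> (central4 a * g = g * central4 a)%g.
Proof.
case/central4P=> E _; apply: GLval_inj; rewrite !GL_MxE E.
have -> : M4 a 0 0 0 0 a 0 0 0 0 a 0 0 0 0 a = a%:M.
  by apply/esym/eq_M4; rewrite !mxE.
by rewrite scalar_mxC.
Qed.

Inductive coset_rep : {'GL_4[R]} -> Prop :=
 | RepTorus a of a != 0 : coset_rep (torus4 a)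
 | RepCorner c of c != 0 : coset_rep (Weyl_corner c)
 | RepSwap : coset_rep Weyl_swap.

(** J is the stabiliser of the last basis vector e, so J\G is the orbit of e,
    that is the set of last rows v of elements of G. If v0 is non-zero, the
    Heisenberg group brings v to a multiple of the first basis vector; if v0 = 0
    but the middle entries do not both vanish, T and the Heisenberg group bring
    v to the third one; otherwise v is a multiple of e. *)
Lemma double_coset g : g \in G ->
  exists j1 r j2, [/\ coset_rep r, j1 \in J, j2 \in J & g = (j1 * r * j2)%g].
Proof.
move=> Gg; suff [r [j2 [rep Gr Jj2 E]]] : exists r j2,
  [/\ coset_rep r, r \in G, j2 \in J & forall i, GLval (r * j2)%g o3 i = GLval g o3 i].
- have Gj2 := subsetP (sub_JG J_mem) _ Jj2.
  have Gh : (r * j2)%g \in G := groupM Gr Gj2.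
  have Gq := groupM Gg (groupVr Gh).
  exists (g * (r * j2)^-1)%g, r, j2; split=> //; last by rewrite -mulgA mulgKV.
  move: (r * j2)%g E Gq => h E Gq.
  have [|g0 [x [y [z [Tg0 sz ->]]]]] := stab_e4_J sK two_neq0 T_mem G_mem Gq.
    move=> j; have : GLval (h * h^-1)%g o3 j = (j == o3)%:R.
      by rewrite mulgV GL_1E mxE eq_sym.
    by rewrite !GL_MxE !mulM4 !E.
  exact: (groupM (levi_J sK T_mem G_mem J_mem Tg0) (heisG_J sK two_neq0 G_mem J_mem _ _ sz)).
have herm33 : herm4 s (GLval g) o3 o3 = 0.
  move: Gg; rewrite G_mem => /unitary4P->; by rewrite (symp_form2E R) mxE.
have herm03 : herm4 s (GLval g) o0 o3 = 1.
  move: Gg; rewrite G_mem => /unitary4P->; by rewrite (symp_form2E R) mxE.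
move: herm33 herm03; rewrite /herm4.
set v0 := GLval g o3 o0; set v1 := GLval g o3 o1; set v2 := GLval g o3 o2; set v3 := GLval g o3 o3.
move=> h33 h03.
have row_e (h : {'GL_4[R]}) : GLval h o3 o0 = v0 -> GLval h o3 o1 = v1 -> GLval h o3 o2 = v2 ->
    GLval h o3 o3 = v3 -> forall i, GLval h o3 i = GLval g o3 i.
  by move=> *; apply: (@forall_I4 (fun i => GLval h o3 i = GLval g o3 i)).
have s0 : s 0 = 0 :> R by rewrite rmorph0.
have [z0|n0] := eqVneq v0 0; last first.
  have sn0 : s v0 != 0 by rewrite fmorph_eq0.
  pose c := - (s v0)^-1.
  have c0 : c != 0 by rewrite oppr_eq0 invr_eq0.
  have scE : - (s c)^-1 = v0 by rewrite /c rmorphN fmorphV sK invrN opprK invrK.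
  pose x := v1 / v0; pose y := v2 / v0.
  pose z := v3 / v0 + 2%:R^-1 * s x * y - 2%:R^-1 * x * s y.
  have sz : s z = z.
    apply: subr0_eq; rewrite /z /x /y !sE !sK.
    have E : (v0 * s v3 + v1 * s v2 - v2 * s v1 - v3 * s v0) / (v0 * s v0) = 0.
      by rewrite h33 mul0r.
    by rewrite -[RHS]E; field; rewrite ?two_neq0 ?n0 ?sn0.
  have [E Gr] := Weyl_cornerP c0.
  exists (Weyl_corner c), (H x y z); split=> //.
  - exact: RepCorner.
  - exact: (heisG_J sK two_neq0 G_mem J_mem).
  apply: row_e; rewrite GL_MxE E (heisGE sK two_neq0) // mulM4 !mxE /= scE /z /x /y;
    by field; rewrite ?two_neq0 ?n0 ?sn0.
have [Es Gs] := Weyl_swapP.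
have [z1|n1] := eqVneq v1 0; last first.
  have sn1 : s v1 != 0 by rewrite fmorph_eq0.
  have U : U11 s 0 (- (s v1)^-1) v1 v2.
    split; rewrite ?s0; first by ring.
      by field.
    by apply: subr0_eq; rewrite -[RHS]h33 z0 s0; ring.
  pose y := s (v3 / v1).
  exists Weyl_swap, (levi (gl2 0 (- (s v1)^-1) v1 v2) * H 0 y 0)%g; split=> //.
  - exact: RepSwap.
  - by rewrite groupM ?(levi_J sK T_mem G_mem J_mem) ?(mem_gl2 sK T_mem) ?(heisG_J sK two_neq0 G_mem J_mem).
  apply: row_e; rewrite !GL_MxE leviE Es (gl2E sK U) (heisGE sK two_neq0) // diag_1g1E;
    rewrite !mulM4 !mxE /= /y ?sK ?s0 ?z0; by field; rewrite ?two_neq0 ?n1 ?sn1.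
have [z2|n2] := eqVneq v2 0; last first.
  have sn2 : s v2 != 0 by rewrite fmorph_eq0.
  have U : U11 s (s v2)^-1 0 0 v2.
    by split; rewrite ?s0 ?z1; try ring; field.
  pose x := - s (v3 / v2).
  exists Weyl_swap, (levi (gl2 (s v2)^-1 0 0 v2) * H x 0 0)%g; split=> //.
  - exact: RepSwap.
  - by rewrite groupM ?(levi_J sK T_mem G_mem J_mem) ?(mem_gl2 sK T_mem) ?(heisG_J sK two_neq0 G_mem J_mem).
  apply: row_e; rewrite !GL_MxE leviE Es (gl2E sK U) (heisGE sK two_neq0) // diag_1g1E;
    rewrite !mulM4 !mxE /= /x ?rmorphN ?sK ?s0 ?z0 ?z1; by field; rewrite ?two_neq0 ?n2 ?sn2.
have n3 : v3 != 0.
  apply: contra_eq_neq h03; rewrite -/v0 -/v1 -/v2 -/v3 z0 z1 z2 => ->.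
  by rewrite s0 !mulr0 !subr0 addr0 eq_sym oner_eq0.
have a0 : (s v3)^-1 != 0 by rewrite invr_eq0 fmorph_eq0.
have [E Gr] := torus4P a0.
exists (torus4 (s v3)^-1), 1%g; split=> //; first exact: RepTorus.
by rewrite mulg1; apply: row_e; rewrite E !mxE /= ?z0 ?z1 ?z2 // fmorphV sK invrK.
Qed.

End DoubleCosets.

(** * Orbits of the rank-one group on the Heisenberg group *)
Section HeisenbergOrbits.
Variables (R : finFieldType) (s : {rmorphism R -> R}).
Hypothesis sK : involutive s.
Hypothesis two_neq0 : 2%:R != 0 :> R.
Variable T : {group {'GL_2[R]}}.
Hypothesis T_mem : forall g, (g \in T) =
  (GLval g *m symp_form 1 *m (map_mx s (GLval g))^T == symp_form 1).
Local Notation H := (heisG s).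

Definition prT (u : {'GL_4[R]}) : {'GL_2[R]} := to_GL (n := 2) (mid_block (GLval u)).

Lemma prT_levi_heisG g x y z : s z = z -> prT (levi g * H x y z)%g = g.
Proof.
move=> sz; rewrite /prT GL_MxE leviE (heisGE sK two_neq0) //.
have -> : mid_block (diag_1g1 (GLval g) *m heis s x y z) = GLval g.
  rewrite (M2E (GLval g)) diag_1g1E mid_blockM4 !mulM4 !mxE /=.
  by congr (M2 _ _ _ _); ring.
by apply: GLval_inj; rewrite to_GLE //; apply: (@GL_unitmx 2 R g).
Qed.

Variant heis_rep : {'GL_4[R]} -> Prop :=
 | HeisCentral z of s z = z : heis_rep (H 0 0 z)
 | HeisIsotropic z of s z = z : heis_rep (H 0 1 z)
 | HeisAnisotropic y z of s z = z & s y = - y & y != 0 : heis_rep (H 1 y z).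

(** T acts on the plane of vectors (x, y), preserving the antihermitian form
    x s(y') - y s(x'). Non-zero isotropic vectors form one orbit. When x is
    non-zero, y / x splits as the sum of a part fixed by s, removed by N, and a
    part y0 / (x s(x)) with s(y0) = - y0. *)
Lemma heis_orbit x y z : s z = z ->
  exists h t, [/\ heis_rep h, t \in T & (h * levi t = levi t * H x y z)%g].
Proof.
move=> sz; have conj := heisG_conj sK two_neq0.
have conjE x0 y0 a b c d : U11 s a b c d -> x0 * a + y0 * c = x -> x0 * b + y0 * d = y ->
    gl2 a b c d \in T /\ (H x0 y0 z * levi (gl2 a b c d) = levi (gl2 a b c d) * H x y z)%g.
  by move=> U <- <-; split; [apply: (mem_gl2 sK T_mem U) | apply: (conj x0 y0 z a b c d sz U)].
have [x0|nx] := eqVneq x 0.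
  have [y0|ny] := eqVneq y 0.
    exists (H 0 0 z), 1%g; split=> //; first exact: HeisCentral.
    by rewrite levi1 mulg1 mul1g x0 y0.
  have sy : (s y)^-1 != 0 by rewrite invr_eq0 fmorph_eq0.
  have := U11_t sK sy; rewrite fmorphV sK invrK => U.
  have [||Tt E] := conjE 0 1 _ _ _ _ U; first by rewrite x0; ring.
    by ring.
  by exists (H 0 1 z), (gl2 (s y)^-1 0 0 y); split=> //; apply: HeisIsotropic.
have nsx : s x != 0 by rewrite fmorph_eq0.
have [b sb Eb] : exists2 b, s b = b & x * b * s x = 2%:R^-1 * (y * s x + s y * x).
  exists (2%:R^-1 * (y * s x + s y * x) / (x * s x)); last by field; rewrite two_neq0 nx nsx.
  by rewrite !sE !sK; field; rewrite two_neq0 nx nsx.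
have [y0 sy0 Ey0] : exists2 y0, s y0 = - y0 & y0 = 2%:R^-1 * (y * s x - s y * x).
  by exists (2%:R^-1 * (y * s x - s y * x)) => //; rewrite !sE !sK; ring.
have Ey : x * b + y0 / s x = y.
  transitivity ((x * b * s x + y0) / s x); first by field.
  by rewrite Eb Ey0; field; rewrite two_neq0 nsx.
have [z0|nz] := eqVneq y0 0.
  have U : U11 s 0 (- (s x)^-1) x (x * b).
    by split; rewrite ?sE ?sK ?sb; [ring | field | ring].
  rewrite z0 mul0r addr0 in Ey.
  have [||Tt E] := conjE 0 1 _ _ _ _ U; [by ring | by rewrite Ey; ring |].
  by exists (H 0 1 z), (gl2 0 (- (s x)^-1) x (x * b)); split=> //; apply: HeisIsotropic.
have U : U11 s x (x * b) 0 (s x)^-1.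
  by split; rewrite ?sE ?sK ?sb; [ring | field | ring].
have [||Tt E] := conjE 1 y0 _ _ _ _ U; [by ring | by rewrite mul1r |].
by exists (H 1 y0 z), (gl2 x (x * b) 0 (s x)^-1); split=> //; apply: HeisAnisotropic.
Qed.

(** The matrices p + r (0, y^2; 1, 0) have (1, y) as left eigenvector with
    eigenvalue p + y r; normalising by this eigenvalue gives elements x of T
    that centralise H 1 y z. The condition x g = tau(g) x is one linear equation
    in p and r, and its coefficients a - d and b - y^2 c have an s-fixed
    quotient, so it has a solution in the fixed field. *)
Lemma aniso_conj y z g : s z = z -> s y = - y -> y != 0 -> g \in T ->
  exists x, [/\ x \in T, (H 1 y z * levi x = levi x * H 1 y z)%g & (x * g = tau (n := 2) g * x)%g].
Proof.
move=> sz sy y0 /(TP sK T_mem)[a b c d U ->].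
have [Ea Eb Ec Ed] := U11_det sK U; have D0 := U11_det_neq0 sK U.
have [q sq Dq] : exists2 q, s q = q & q = y ^+ 2.
  by exists (y ^+ 2); rewrite // rmorphXn /= sy sqrrN.
(* When a = d, the flip fixes g and x = 1 works. *)
have [p [r [sp sr pr0 Epr]]] : exists p r,
    [/\ s p = p, s r = r, (p != 0) || (r != 0) & p * (a - d) = r * (b - q * c)].
  have [ad|nad] := eqVneq (a - d) 0; last first.
    exists ((b - q * c) / (a - d)), 1; split; rewrite ?rmorph1 ?oner_eq0 ?orbT //.
      apply: (fixed_ratio D0).
        by rewrite rmorphB rmorphM sq mulrBr mulrCA Eb Ec.
      by rewrite rmorphB mulrBr Ea Ed.
    by rewrite divfK // mul1r.
  by exists 1, 0; rewrite rmorph1 rmorph0 oner_eq0 ad mulr0 mul0r.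
have n1 : p + y * r != 0.
  apply/eqP=> E; have Es : p - y * r = 0.
    by have := congr1 s E; rewrite rmorphD rmorphM sp sr sy rmorph0 mulNr.
  have p0 : p = 0.
    apply: (mulfI two_neq0); rewrite mulr0; transitivity (p + y * r + (p - y * r)); first ring.
    by rewrite E Es addr0.
  move: E pr0; rewrite p0 add0r eqxx /= => /eqP.
  by rewrite mulf_eq0 (negPf y0) /= => /eqP->; rewrite eqxx.
have n2 : p - y * r != 0.
  have := n1; rewrite -(fmorph_eq0 s) rmorphD rmorphM sp sr sy mulNr.
  by [].
have [m sm Dm] : exists2 m, s m = (p - y * r)^-1 & m = (p + y * r)^-1.
  by exists (p + y * r)^-1; rewrite // fmorphV rmorphD rmorphM sp sr sy mulNr.
have Ux : U11 s (m * p) (m * (r * q)) (m * r) (m * p).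
  split; rewrite !rmorphM ?sp ?sr ?sq ?sm; first ring; last ring.
  rewrite Dm Dq.
  by field; rewrite n1 n2.
exists (gl2 (m * p) (m * (r * q)) (m * r) (m * p)); split.
- exact: (mem_gl2 sK T_mem Ux).
- rewrite (heisG_conj sK two_neq0 _ _ sz Ux); congr (_ * H _ _ _)%g.
    by rewrite Dm; field.
  by rewrite Dm Dq; field.
have Ut := U11_flip sK U.
rewrite (tau_gl2 sK U) !(gl2M sK T_mem) //; congr gl2.
- by apply: subr0_eq; transitivity (m * (p * (a - d) - r * (b - q * c))); [ring | rewrite Epr subrr mulr0].
- by ring.
- by ring.
by apply: subr0_eq; transitivity (- (m * (p * (a - d) - r * (b - q * c)))); [ring | rewrite Epr subrr mulr0 oppr0].
Qed.

End HeisenbergOrbits.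

(** * The kernel of the Weil representation *)
Section AdditiveCharacters.
Variables (R : finFieldType) (Psi : R -> algC).
Hypothesis Psi0 : Psi 0 = 1.
Hypothesis PsiD : forall x y, Psi (x + y) = Psi x * Psi y.
Hypothesis Psi_nontriv : exists x, Psi x != 1.

Lemma Psi_neq0 x : Psi x != 0.
Proof.
apply/eqP=> E; have := PsiD x (- x); rewrite subrr Psi0 E mul0r => /eqP.
by rewrite oner_eq0.
Qed.

Lemma PsiN x : Psi (- x) = (Psi x)^-1.
Proof. by apply/esym/mulr1_eq; rewrite -PsiD subrr. Qed.

Lemma sum_Psi : \sum_x Psi x = 0.
Proof.
have [a na] := Psi_nontriv; apply: (mulfI (x := Psi a - 1)); first by rewrite subr_eq0.
rewrite mulr0 mulrBl mul1r mulr_sumr [X in _ - X](reindex_inj (addrI a)) /=.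
by rewrite -sumrB big1 // => x _; rewrite PsiD subrr.
Qed.

Lemma Psi_detect c : (forall x, Psi (c * x) = 1) -> c = 0.
Proof.
move=> h; apply/eqP/negPn/negP=> c0; have [a /eqP[]] := Psi_nontriv.
by rewrite -(h (a / c)) mulrC divfK.
Qed.

Lemma fourier_inj (f : R -> algC) :
  (forall y, \sum_x Psi (y * x) * f x = 0) -> forall x, f x = 0.
Proof.
move=> h x0; have R0 : #|R|%:R != 0 :> algC.
  by rewrite pnatr_eq0 -lt0n; apply/card_gt0P; exists 0.
apply: (mulfI R0); rewrite mulr0.
transitivity (\sum_y Psi (- (y * x0)) * \sum_x Psi (y * x) * f x); last first.
  by rewrite big1 // => y _; rewrite h mulr0.
under eq_bigr => y _ do rewrite mulr_sumr.
rewrite exchange_big (bigD1 x0) //= [X in _ + X]big1 ?addr0 => [|x nx].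
  rewrite mulr_natl -sumr_const; apply: eq_bigr => y _.
  by rewrite mulrA -PsiD addNr Psi0 mul1r.
transitivity ((\sum_y Psi (y * (x - x0))) * f x).
  rewrite mulr_suml; apply: eq_bigr => y _; rewrite mulrA -PsiD.
  by congr (Psi _ * _); ring.
have dx : x - x0 != 0 by rewrite subr_eq0.
have := sum_Psi.
by rewrite (reindex_inj (mulIf dx)) /= => ->; rewrite mul0r.
Qed.

End AdditiveCharacters.

Section Weil.
Variables (R : finFieldType) (s : {rmorphism R -> R}).
Hypothesis sK : involutive s.
Hypothesis two_neq0 : 2%:R != 0 :> R.
Variable T : {group {'GL_2[R]}}.
Hypothesis T_mem : forall g, (g \in T) =
  (GLval g *m symp_form 1 *m (map_mx s (GLval g))^T == symp_form 1).
Variables G J : {group {'GL_4[R]}}.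
Hypothesis G_mem : forall g, (g \in G) =
  (GLval g *m symp_form 2 *m (map_mx s (GLval g))^T == symp_form 2).
Hypothesis J_mem : forall u, (u \in J) =
  [&& u \in G, FJ_shape (GLval u) & [exists g in T, mid_block (GLval u) == GLval g]].
Local Notation H := (heisG s).
Variables (Psi eta : R -> algC) (C : algC).
Hypothesis Psi0 : Psi 0 = 1.
Hypothesis PsiD : forall x y, Psi (x + y) = Psi x * Psi y.
Hypothesis Psi_s : forall x, Psi (s x) = Psi x.
Hypothesis Psi_nontriv : exists x, Psi x != 1.
Hypothesis eta_s : forall a, a != 0 -> eta (s a)^-1 = eta a.
Variable omega : mx_representation algC J #|R|.

Definition kernel (u : {'GL_4[R]}) (xi zeta : R) : algC :=
  omega u (enum_rank xi) (enum_rank zeta).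

(** The Weil representation through its kernel on generators of J; eta is the
    quadratic character or 1, and C the constant of the Fourier transform. *)
Record weil_kernel : Prop := WeilKernel {
  weil_x : forall x z xi zeta, s z = z ->
    kernel (H x 0 z) xi zeta = Psi z * (zeta == xi + x)%:R;
  weil_y : forall y xi zeta,
    kernel (H 0 y 0) xi zeta = Psi (2%:R * s y * xi) * (zeta == xi)%:R;
  weil_t : forall a xi zeta, a != 0 ->
    kernel (levi (gt s a)) xi zeta = eta a * (zeta == a * xi)%:R;
  weil_n : forall b xi zeta, s b = b ->
    kernel (levi (gn b)) xi zeta = Psi (b * xi * s xi) * (zeta == xi)%:R;
  weil_w : forall xi zeta,
    kernel (levi gw) xi zeta = C * Psi (2%:R * s zeta * xi) }.

Hypothesis weil : weil_kernel.

Lemma kernelM u v xi zeta : u \in J -> v \in J ->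
  kernel (u * v)%g xi zeta = \sum_mu kernel u xi mu * kernel v mu zeta.
Proof.
move=> Ju Jv; rewrite /kernel repr_mxM // mxE (reindex (@enum_rank R)) //=.
by exists enum_val => x _; rewrite ?enum_rankK ?enum_valK.
Qed.

Lemma kernel1 xi zeta : kernel 1%g xi zeta = (xi == zeta)%:R.
Proof. by rewrite /kernel repr_mx1 mxE (inj_eq enum_rank_inj). Qed.

Let leviJ g : g \in T -> levi g \in J. Proof. exact: (levi_J sK T_mem G_mem J_mem). Qed.
Let heisJ x y z : s z = z -> H x y z \in J. Proof. exact: (heisG_J sK two_neq0 G_mem J_mem). Qed.

Lemma heis_split x y z : s z = z -> exists2 z', s z' = z' &
  H x y z = (H 0 y 0 * H x 0 z')%g.
Proof.
move=> sz.
have sz' : s (z + 2%:R^-1 * (y * s x + s y * x)) = z + 2%:R^-1 * (y * s x + s y * x).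
  by rewrite !sE !sK sz; ring.
exists (z + 2%:R^-1 * (y * s x + s y * x)) => //.
by rewrite (heisGM sK two_neq0) ?rmorph0 //; congr (H _ _ _); ring.
Qed.

Let JM (u v : {'GL_4[R]}) : u \in J -> v \in J -> (u * v)%g \in J.
Proof. by move=> Ju Jv; rewrite groupM. Qed.

Definition kernel_flips u := forall xi zeta, kernel (tau (n := 4) u) xi zeta = kernel u (s zeta) (s xi).

Lemma kernel_flipsM u v : u \in J -> v \in J ->
  kernel_flips u -> kernel_flips v -> kernel_flips (u * v)%g.
Proof.
move=> Ju Jv fu fv xi zeta.
have tJ := tau_J sK two_neq0 T_mem G_mem J_mem.
rewrite tauM !kernelM ?tJ // [RHS](reindex_inj (inv_inj sK)).
by apply: eq_bigr => mu _; rewrite fu fv mulrC.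
Qed.

(** The symmetry is multiplicative in j, so it suffices to check it on
    generators, where it is read off the formulas. *)
Lemma tau_kernel j : j \in J -> kernel_flips j.
Proof.
have s0 : s 0 = 0 by rewrite rmorph0.
have fn b : s b = b -> kernel_flips (levi (gn b)).
  move=> sb xi zeta; have U := U11_n sb.
  rewrite (tau_levi sK U) (tau_gl2 sK U) -/(gn b) !(weil_n weil) // sK (inj_eq (inv_inj sK)) [zeta == _]eq_sym.
  case: eqP => [->|_]; last by rewrite !mulr0.
  by congr (Psi _ * _); ring.
have ft a : a != 0 -> kernel_flips (levi (gt s a)).
  move=> a0 xi zeta; have U := U11_t sK a0; have sa0 : s a != 0 by rewrite fmorph_eq0.
  have Et : gl2 (s a)^-1 0 0 a = gt s (s a)^-1 by rewrite /gt fmorphV sK invrK.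
  rewrite (tau_levi sK U) (tau_gl2 sK U) Et !(weil_t weil) ?invr_eq0 // eta_s //; congr (_ * _%:R).
  congr nat_of_bool; apply/eqP/eqP=> [->|E].
    by rewrite rmorphM fmorphV sK mulVKf.
  by rewrite -[xi]sK E rmorphM sK mulKf.
have fw : kernel_flips (levi gw).
  move=> xi zeta; have U := U11_w s.
  by rewrite (tau_levi sK U) (tau_gl2 sK U) -/gw !(weil_w weil) sK; congr (_ * Psi _); ring.
have fx x z : s z = z -> kernel_flips (H x 0 z).
  move=> sz xi zeta; rewrite (tau_heisG sK two_neq0) // s0 !(weil_x weil) //; congr (_ * _%:R).
  congr nat_of_bool; apply/eqP/eqP=> [->|E]; first by rewrite rmorphB sK subrK.
  by rewrite -[xi]sK E rmorphD sK addrK.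
have fy y : kernel_flips (H 0 y 0).
  move=> xi zeta; rewrite (tau_heisG sK two_neq0) // s0 oppr0 !(weil_y weil) sK (inj_eq (inv_inj sK)) [zeta == _]eq_sym.
  case: eqP => [->|_]; last by rewrite !mulr0.
  by rewrite -[Psi (_ * s y * _)]Psi_s !rmorphM !sK rmorph_nat.
have fm b c : U11 s 0 b c 0 -> kernel_flips (levi (gl2 0 b c 0)).
  move=> U; have [_ E _] := U.
  have b0 : b != 0 by apply: contra_eq_neq E => ->; rewrite !mul0r subrr eq_sym oner_eq0.
  have Ec : c = - (s b)^-1.
    apply: oppr_inj; rewrite opprK; apply/esym/mulr1_eq.
    have := congr1 s E; rewrite rmorphB !rmorphM !sK rmorph1 s0 => <-; ring.
  have [Uw Ut] := (U11_w s, U11_t sK b0).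
  have -> : gl2 0 b c 0 = (gt s b * gw)%g.
    by rewrite /gt /gw (gl2M sK T_mem) // Ec; congr gl2; ring.
  rewrite leviM; have Jt := leviJ (mem_gl2 sK T_mem Ut); have Jw := leviJ (mem_gl2 sK T_mem Uw).
  exact: (kernel_flipsM Jt Jw (ft b b0) fw).
case/(JP sK two_neq0 T_mem G_mem J_mem)=> g [x [y [z [Tg sz ->]]]].
have [z' sz' ->] := heis_split x y sz.
have [Jy Jx] := (heisJ 0 y s0, heisJ x 0 sz').
apply: (kernel_flipsM (leviJ Tg) (JM Jy Jx)); last first.
  exact: (kernel_flipsM Jy Jx (fy y) (fx x z' sz')).
case/(TP sK T_mem): Tg => a b c d U ->.
have [c0|c0] := eqVneq c 0; last first.
  have [u [v [b' [c' [su sv U' ->]]]]] := bruhat_decomp sK T_mem U c0.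
  have Ju := leviJ (mem_gl2 sK T_mem (U11_n su)).
  have Jv := leviJ (mem_gl2 sK T_mem (U11_n sv)).
  have Jm := leviJ (mem_gl2 sK T_mem U').
  rewrite !leviM; apply: (kernel_flipsM (JM Ju Jm) Jv _ (fn v sv)).
  exact: (kernel_flipsM Ju Jm (fn u su) (fm b' c' U')).
rewrite c0 in U *; have [a0 _ su] := U11_upper sK U.
have Ju := leviJ (mem_gl2 sK T_mem (U11_n su)).
have Jt := leviJ (mem_gl2 sK T_mem (U11_t sK a0)).
rewrite (upper_decomp sK T_mem U) leviM.
exact: (kernel_flipsM Ju Jt (fn _ su) (ft a a0)).
Qed.

Lemma kernel_siegel b y z xi zeta : s b = b -> s z = z ->
  kernel (levi (gn b) * H 0 y z)%g xi zeta
    = Psi (b * xi * s xi + 2%:R * s y * xi + z) * (zeta == xi)%:R.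
Proof.
move=> sb sz; have [s0 Ub] := (rmorph0 s, U11_n sb).
have -> : H 0 y z = (H 0 y 0 * H 0 0 z)%g.
  by rewrite (heisGM sK two_neq0) //; congr (H _ _ _); rewrite ?s0; ring.
have Jb := leviJ (mem_gl2 sK T_mem Ub).
rewrite (kernelM _ _ Jb (JM (heisJ 0 y s0) (heisJ 0 0 sz))).
rewrite (bigD1 xi) //= big1 => [|mu /negPf nmu]; last by rewrite (weil_n weil) // nmu mulr0 mul0r.
rewrite kernelM ?heisJ // (bigD1 xi) //= big1 => [|mu /negPf nmu]; last by rewrite (weil_y weil) nmu mulr0 mul0r.
rewrite (weil_n weil) // (weil_y weil) (weil_x weil) // !eqxx !mulr1 !addr0 !PsiD; ring.
Qed.

(** The Heisenberg operators span all operators on functions: H x y z shifts by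
    x and multiplies by an additive character depending on y, so that Fourier
    inversion in zeta isolates D0 on each shifted diagonal. *)
Lemma heis_span (D0 : R -> R -> algC) :
    (forall x y z, s z = z ->
       \sum_xi \sum_zeta kernel (H x y z) zeta xi * D0 xi zeta = 0) ->
  forall xi zeta, D0 xi zeta = 0.
Proof.
move=> h xi zeta; have s0 := rmorph0 s.
suff {xi zeta} E x zeta : D0 (zeta + x) zeta = 0.
  by rewrite -[xi](subrK zeta) addrC.
apply: (fourier_inj Psi0 PsiD Psi_nontriv (f := fun zeta => D0 (zeta + x) zeta)) => y {zeta}.
(* The choice of y' turns the character of H 0 y' 0 into
   zeta |-> Psi (y zeta); the choice of z cancels the cocycle in
   H x y' z = H 0 y' 0 * H x 0 0. *)
pose y' := s (y / 2%:R).
pose z := - (2%:R^-1 * (y' * s x + s y' * x)).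
have sz : s z = z by rewrite /z !sE !sK; congr (- (_ * _)); rewrite addrC.
have := h x y' z sz.
have -> : H x y' z = (H 0 y' 0 * H x 0 0)%g.
  by rewrite (heisGM sK two_neq0) //; congr (H _ _ _); rewrite /z ?s0; ring.
have Ey zeta xi : kernel (H 0 y' 0 * H x 0 0)%g zeta xi = Psi (y * zeta) * (xi == zeta + x)%:R.
  rewrite kernelM ?heisJ // (bigD1 zeta) //= big1 => [|mu /negPf nmu].
    rewrite (weil_y weil) (weil_x weil) // eqxx mulr1 addr0 Psi0 mul1r; congr (Psi _ * _).
    by rewrite /y' sK; field.
  by rewrite (weil_y weil) nmu mulr0 mul0r.
under eq_bigr => xi _ do under eq_bigr => zeta _ do rewrite Ey.
rewrite exchange_big /= => E; rewrite -[RHS]E; apply: eq_bigr => zeta _.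
rewrite (bigD1 (zeta + x)) //= eqxx mulr1 big1 ?addr0 // => xi /negPf nxi.
by rewrite nxi mulr0 mul0r.
Qed.

End Weil.

(** * Block matrices *)
(** P and Q are the projections to and the inclusions of the summands of a
    decomposition of an n-dimensional space into copies of a d-dimensional one.
    This describes pi (x) omega without fixing an identification of its basis
    with pairs. *)
Section Blocks.
Variables (X : finType) (F : fieldType) (d n : nat).
Variables (P : X -> 'M[F]_(d, n)) (Q : X -> 'M[F]_(n, d)).
Hypothesis PQ : forall xi zeta, P xi *m Q zeta = (xi == zeta)%:R%:M.
Hypothesis QP : \sum_xi Q xi *m P xi = 1%:M.

Definition blk (A : 'M[F]_n) xi zeta := P xi *m A *m Q zeta.

Lemma blk_inj A B : (forall xi zeta, blk A xi zeta = blk B xi zeta) -> A = B.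
Proof.
move=> E; rewrite -[A]mul1mx -[A]mulmx1 -[B]mul1mx -[B]mulmx1 -QP.
rewrite !mulmx_suml; apply: eq_bigr => xi _.
rewrite !mulmx_sumr; apply: eq_bigr => zeta _.
have mid M : Q xi *m P xi *m (M *m (Q zeta *m P zeta)) = Q xi *m blk M xi zeta *m P zeta.
  by rewrite /blk !mulmxA.
by rewrite !mid E.
Qed.

Lemma blkM A B xi zeta : blk (A *m B) xi zeta = \sum_mu blk A xi mu *m blk B mu zeta.
Proof.
rewrite /blk -[A in LHS]mulmx1 -QP !(mulmx_sumr, mulmx_suml).
by apply: eq_bigr => mu _; rewrite !mulmxA.
Qed.

Lemma blk_scalar a xi zeta : blk a%:M xi zeta = (a *+ (xi == zeta))%:M.
Proof. by rewrite /blk mul_mx_scalar -scalemxAl PQ scale_scalar_mx mulr_natr. Qed.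

Lemma tr_blk A : \tr A = \sum_xi \tr (blk A xi xi).
Proof.
rewrite -[A in LHS]mulmx1 -QP mulmx_sumr raddf_sum; apply: eq_bigr => xi _ /=.
by rewrite mulmxA mxtrace_mulC mulmxA.
Qed.

Lemma tr_blkM A B : \tr (A *m B) = \sum_xi \sum_zeta \tr (blk A xi zeta *m blk B zeta xi).
Proof.
by rewrite tr_blk; apply: eq_bigr => xi _; rewrite blkM raddf_sum.
Qed.

Definition of_blk (f : X -> X -> 'M[F]_d) : 'M[F]_n :=
  \sum_xi \sum_zeta Q xi *m f xi zeta *m P zeta.

Lemma blk_of_blk f xi zeta : blk (of_blk f) xi zeta = f xi zeta.
Proof.
rewrite /blk /of_blk mulmx_sumr mulmx_suml (bigD1 xi) //= [X in _ + X]big1 => [|mu nmu].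
  rewrite addr0 mulmx_sumr mulmx_suml (bigD1 zeta) //= [X in _ + X]big1 => [|mu nmu].
    by rewrite !mulmxA PQ eqxx mul1mx -mulmxA PQ eqxx mulmx1 addr0.
  by rewrite -!mulmxA PQ (negPf nmu) -scalemx1 scale0r !mulmx0.
rewrite mulmx_sumr mulmx_suml big1 // => nu _.
by rewrite !mulmxA PQ eq_sym (negPf nmu) -scalemx1 scale0r !mul0mx.
Qed.

End Blocks.

(** * The trace identity on the double cosets *)
Section FourierJacobi.
Variables (R : finFieldType) (s : {rmorphism R -> R}).
Hypothesis sK : involutive s.
Hypothesis two_neq0 : 2%:R != 0 :> R.
Variable T : {group {'GL_2[R]}}.
Hypothesis T_mem : forall g, (g \in T) =
  (GLval g *m symp_form 1 *m (map_mx s (GLval g))^T == symp_form 1).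
Variables G J : {group {'GL_4[R]}}.
Hypothesis G_mem : forall g, (g \in G) =
  (GLval g *m symp_form 2 *m (map_mx s (GLval g))^T == symp_form 2).
Hypothesis J_mem : forall u, (u \in J) =
  [&& u \in G, FJ_shape (GLval u) & [exists g in T, mid_block (GLval u) == GLval g]].
Local Notation H := (heisG s).
Local Notation tau2 := (@tau 2 R).
Local Notation tau4 := (@tau 4 R).
Variables (Psi eta : R -> algC) (C : algC).
Hypothesis Psi0 : Psi 0 = 1.
Hypothesis PsiD : forall x y, Psi (x + y) = Psi x * Psi y.
Hypothesis Psi_s : forall x, Psi (s x) = Psi x.
Hypothesis Psi_nontriv : exists x, Psi x != 1.
Hypothesis eta_s : forall a, a != 0 -> eta (s a)^-1 = eta a.
Variable omega : mx_representation algC J #|R|.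
Hypothesis weil : weil_kernel s Psi eta C omega.
Variables (d : nat) (pi : mx_representation algC T d).
Hypothesis d_gt0 : (0 < d)%N.
Hypothesis pi_sc : scalar_commutant pi.
Hypothesis pi_fix : '['Res[unip_group T] (cfRepr pi), 1] <= 1.
Variables (n : nat) (rho : mx_representation algC J n).
Variables (P : R -> 'M[algC]_(d, n)) (Q : R -> 'M[algC]_(n, d)).
Hypothesis PQ : forall xi zeta, P xi *m Q zeta = (xi == zeta)%:R%:M.
Hypothesis QP : \sum_xi Q xi *m P xi = 1%:M.
Local Notation ker := (kernel omega).
Local Notation blk := (blk P Q).
Hypothesis rhoE : forall j xi zeta, j \in J ->
  blk (rho j) xi zeta = ker j xi zeta *: pi (prT j).

Let TM (g h : {'GL_2[R]}) : g \in T -> h \in T -> (g * h)%g \in T.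
Proof. by move=> Tg Th; have := groupM Tg Th. Qed.
Let TV (g : {'GL_2[R]}) : g \in T -> (g^-1)%g \in T.
Proof. by move=> Tg; have := groupVr Tg. Qed.
Let JM (u v : {'GL_4[R]}) : u \in J -> v \in J -> (u * v)%g \in J.
Proof. by move=> Ju Jv; have := groupM Ju Jv. Qed.
Let leviJ g : g \in T -> levi g \in J. Proof. exact: (levi_J sK T_mem G_mem J_mem). Qed.
Let heisJ x y z : s z = z -> H x y z \in J. Proof. exact: (heisG_J sK two_neq0 G_mem J_mem). Qed.
Let tau_omega := tau_kernel sK two_neq0 T_mem G_mem J_mem Psi_s eta_s weil.
Let tau2T := tau_T sK T_mem.
Let tau4J := tau_J sK two_neq0 T_mem G_mem J_mem.
Let tau_levi_T g : g \in T -> tau4 (levi g) = levi (tau2 g).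
Proof. by case/(TP sK T_mem)=> a b c e U ->; apply: (tau_levi sK U). Qed.
Let tau1 : tau2 1%g = 1%g.
Proof. by apply: (mulgI (tau2 1%g)); rewrite -tauM !mulg1. Qed.
Let s0 : s 0 = 0. Proof. exact: rmorph0. Qed.
Let heisG1 : H 0 0 0 = 1%g.
Proof.
apply: (mulgI (H 0 0 0)); rewrite mulg1 (heisGM sK two_neq0) //.
by congr (H _ _ _); rewrite ?s0; ring.
Qed.

Let prT_levi (g : {'GL_2[R]}) : prT (levi g) = g.
Proof. by rewrite -{1}[levi g]mulg1 -heisG1 (prT_levi_heisG sK two_neq0). Qed.

Let pi1 : pi (1%g : {'GL_2[R]}) = 1%:M. Proof. exact: repr_mx1. Qed.

Let rho_levi g xi zeta : g \in T -> blk (rho (levi g)) xi zeta = ker (levi g) xi zeta *: pi g.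
Proof. by move=> Tg; rewrite rhoE ?leviJ // prT_levi. Qed.

Let rho_heisG x y z xi zeta : s z = z -> blk (rho (H x y z)) xi zeta = (ker (H x y z) xi zeta)%:M.
Proof.
move=> sz; rewrite rhoE ?heisJ // -[H x y z]mul1g -levi1 (prT_levi_heisG sK two_neq0) //.
by rewrite pi1 scalemx1.
Qed.

Lemma prT_tau j : j \in J -> prT j \in T /\ prT (tau4 j) = tau2 (prT j).
Proof.
case/(JP sK two_neq0 T_mem G_mem J_mem)=> g [x [y [z [Tg sz ->]]]].
rewrite (prT_levi_heisG sK two_neq0) //; split=> //.
rewrite tauM tau_levi_T // (tau_heisG sK two_neq0) //.
have /(TP sK T_mem)[a b c e U ->] := tau2T Tg.
by rewrite (heisG_conj sK two_neq0 _ _ sz U) (prT_levi_heisG sK two_neq0).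
Qed.

(** An operator A commuting with rho commutes with the Heisenberg group, which
    acts through omega alone. The multiplications by additive characters make A
    block diagonal, the translations make its diagonal blocks equal, and the
    common block commutes with pi. *)
Lemma rho_scalar_commutant : scalar_commutant rho.
Proof.
move=> A cA.
have cAb j xi zeta : j \in J ->
    \sum_mu ker j xi mu *: (pi (prT j) *m blk A mu zeta)
    = \sum_mu ker j mu zeta *: (blk A xi mu *m pi (prT j)).
  move=> Jj; have := congr1 (fun M => blk M xi zeta) (cA j Jj).
  rewrite !(blkM QP) => E; transitivity (\sum_mu blk (rho j) xi mu *m blk A mu zeta).
    by apply: eq_bigr => mu _; rewrite rhoE // scalemxAl.
  by rewrite E; apply: eq_bigr => mu _; rewrite rhoE // scalemxAr.
have pH x y z : s z = z -> pi (prT (H x y z)) = 1%:M.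
  move=> sz; rewrite -[H x y z]mul1g -levi1 (prT_levi_heisG sK two_neq0) //.
have offdiag xi zeta : xi != zeta -> blk A xi zeta = 0.
  move=> nxz; apply/eqP; apply: contraNT nxz => nA.
  suff : xi - zeta = 0 by move/subr0_eq->.
  apply: (Psi_detect Psi_nontriv) => x; pose y := s (x / 2%:R).
  have := cAb (H 0 y 0) xi zeta (heisJ 0 y s0).
  rewrite (bigD1 xi) //= big1 => [|mu /negPf nmu]; last by rewrite (weil_y weil) nmu mulr0 scale0r.
  rewrite [X in _ = X](bigD1 zeta) //= [X in _ = _ + X]big1 => [|mu nmu]; last first.
    by rewrite (weil_y weil) eq_sym (negPf nmu) mulr0 scale0r.
  rewrite pH // mul1mx mulmx1 !addr0 !(weil_y weil) !eqxx !mulr1 => /eqP.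
  rewrite -subr_eq0 -scalerBl scaler_eq0 (negPf nA) orbF subr_eq0 => /eqP E.
  have Ey w : 2%:R * s y * w = x * w by rewrite /y sK; field.
  move: E; rewrite !Ey => E; rewrite mulrC mulrBr PsiD (PsiN Psi0 PsiD) E.
  by rewrite mulfV // (Psi_neq0 Psi0 PsiD).
have const xi : blk A xi xi = blk A 0 0.
  have := cAb (H (- xi) 0 0) xi 0 (heisJ (- xi) 0 s0).
  rewrite (bigD1 0) //= big1 => [|mu nmu]; last first.
    by rewrite (weil_x weil) // subrr (negPf nmu) mulr0 scale0r.
  rewrite [X in _ = X](bigD1 xi) //= [X in _ = _ + X]big1 => [|mu nmu]; last first.
    by rewrite offdiag 1?eq_sym // mul0mx scaler0.
  rewrite pH // mul1mx mulmx1 !addr0 !(weil_x weil) // subrr eqxx Psi0 mulr1 !scale1r.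
  by move->.
have /is_scalar_mxP[a Ea] : is_scalar_mx (blk A 0 0).
  apply: pi_sc => g Tg; have Jg := leviJ Tg.
  have [xi nxi] : exists xi, ker (levi g) xi 0 != 0.
    apply/existsP; apply: contraT; rewrite negb_exists => /forallP k0.
    have := kernelM omega 0 0 (leviJ (TV Tg)) Jg.
    rewrite -leviM mulVg levi1 kernel1 eqxx big1 => [|mu _].
      by move/eqP; rewrite oner_eq0.
    by have := k0 mu; rewrite negbK => /eqP->; rewrite mulr0.
  have := cAb (levi g) xi 0 Jg.
  rewrite (bigD1 0) //= big1 => [|mu nmu]; last by rewrite offdiag // mulmx0 scaler0.
  rewrite [X in _ = X](bigD1 xi) //= [X in _ = _ + X]big1 => [|mu nmu]; last first.
    by rewrite offdiag 1?eq_sym // mul0mx scaler0.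
  by rewrite !addr0 const prT_levi; apply: scalerI.
apply/is_scalar_mxP; exists a; apply: (blk_inj QP) => xi zeta; rewrite (blk_scalar PQ).
have [<-|nxz] := eqVneq xi zeta; first by rewrite const.
by rewrite offdiag // mulr0n; apply/matrixP=> i j; rewrite !mxE mul0rn.
Qed.

Section OneCoset.
Variable A : 'M[algC]_n.
Definition coef xi zeta g := \tr (blk A xi zeta *m pi g).

Lemma tr_rho j : j \in J ->
  \tr (A *m rho j) = \sum_xi \sum_zeta ker j zeta xi * coef xi zeta (prT j).
Proof.
move=> Jj; rewrite (tr_blkM QP); apply: eq_bigr => xi _; apply: eq_bigr => zeta _.
by rewrite rhoE // -scalemxAr mxtraceZ.
Qed.

(** Reduction of the identity on J to one on T, by the symmetry of the Weil
    kernel. *)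
Lemma tr_rho_tau :
    (forall xi zeta g, g \in T -> coef (s zeta) (s xi) (tau2 g) = coef xi zeta g) ->
  {in J, forall j, \tr (A *m rho (tau4 j)) = \tr (A *m rho j)}.
Proof.
move=> coef_tau j Jj; have [Tp Ep] := prT_tau Jj.
rewrite !tr_rho ?tau4J // Ep.
transitivity (\sum_xi \sum_zeta
    ker (tau4 j) (s zeta) (s xi) * coef (s xi) (s zeta) (tau2 (prT j))).
  rewrite (reindex_inj (inv_inj sK)); apply: eq_bigr => xi _ /=.
  by rewrite (reindex_inj (inv_inj sK)).
rewrite exchange_big; apply: eq_bigr => zeta _; apply: eq_bigr => xi _ /=.
by rewrite (tau_omega Jj) !sK coef_tau.
Qed.

(** The trace of A against the tensor product of pi(g) and omega(h). Unlike in
    rho, the elements h and g are independent. *)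
Definition twist h g := \sum_xi \sum_zeta ker h zeta xi * coef xi zeta g.

Hypothesis A_T : {in T, forall t, rho (levi t) *m A = A *m rho (levi t)}.

(** A commutes with rho(t) = pi(t) (x) omega(t), so t acts on both factors at
    once. *)
Lemma twist_conj h g t : h \in J -> g \in T -> t \in T ->
  twist (levi t^-1 * h * levi t)%g (t^-1 * g * t)%g = twist h g.
Proof.
move=> Jh Tg Tt; have TV' := TV Tt.
pose M h g := of_blk P Q (fun xi zeta => ker h xi zeta *: pi g).
have tw h' g' : twist h' g' = \tr (A *m M h' g').
  rewrite (tr_blkM QP); apply: eq_bigr => xi _; apply: eq_bigr => zeta _.
  by rewrite (blk_of_blk PQ) -scalemxAr mxtraceZ.
have JV : levi t^-1%g \in J by apply: leviJ.
have ME : M (levi t^-1 * h * levi t)%g (t^-1 * g * t)%g = rho (levi t^-1)%g *m M h g *m rho (levi t).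
  apply: (blk_inj QP) => xi zeta; rewrite (blk_of_blk PQ) !(blkM QP).
  rewrite kernelM ?JM ?leviJ // scaler_suml; apply: eq_bigr => nu _.
  rewrite kernelM // (blkM QP) mulr_suml scaler_suml mulmx_suml; apply: eq_bigr => mu _.
  rewrite (blk_of_blk PQ) !rho_levi // -!scalemxAl -!scalemxAr -!scalemxAl !scalerA.
  by rewrite !repr_mxM ?TM // mulrAC mulrA.
rewrite !tw ME !mulmxA mxtrace_mulC !mulmxA A_T // -(mulmxA A) -repr_mxM ?leviJ //.
by rewrite -leviM mulgV levi1 repr_mx1 mulmx1.
Qed.

Definition tau_good h := {in T, forall g, twist (tau4 h) (tau2 g) = twist h g}.

Lemma tau_good_conj h h' t : h \in J -> h' \in J -> t \in T ->
  (h * levi t = levi t * h')%g -> tau_good h -> tau_good h'.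
Proof.
move=> Jh Jh' Tt E good g Tg.
have TtV := TV Tt; have Tg' : (t * g * t^-1)%g \in T by rewrite !TM.
have Dh' : h' = (levi t^-1 * h * levi t)%g by rewrite -mulgA E leviV mulKg.
have Dg : g = (t^-1 * (t * g * t^-1) * t)%g by rewrite !mulgA mulVg mul1g mulgKV.
rewrite [in RHS]Dh' [in RHS]Dg twist_conj // -(good _ Tg').
have Tu : tau2 t^-1 \in T by apply: tau2T.
have tV : (tau2 t^-1)^-1%g = tau2 t.
  by apply: (mulgI (tau2 t^-1)%g); rewrite mulgV -tauM mulgV tau1.
have := twist_conj (tau4J Jh) (tau2T Tg') Tu.
rewrite tV -!tau_levi_T // => <-; congr twist.
  by rewrite Dh' !tauM mulgA.
by rewrite {1}Dg !tauM !mulgA.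
Qed.

Let twist_cent h x g : h \in J -> x \in T -> g \in T -> (h * levi x = levi x * h)%g ->
  twist h (x^-1 * g * x)%g = twist h g.
Proof.
move=> Jh Tx Tg E; have := twist_conj Jh Tg Tx.
by rewrite -mulgA E leviV mulKg.
Qed.

Let twist_tau h x g : h \in J -> x \in T -> g \in T -> (h * levi x = levi x * h)%g ->
  (x * g = tau2 g * x)%g -> twist h (tau2 g) = twist h g.
Proof.
move=> Jh Tx Tg E Eg; have Ttg := tau2T Tg.
have := twist_cent Jh Tx Ttg E; rewrite -(mulgA x^-1%g) -Eg mulKg => ->.
by [].
Qed.

(** In the central and in the anisotropic case some x in T commutes with h and
    conjugates g to tau g; tau h is h, respectively the conjugate of h by -1. In
    the isotropic case tau h = h is centralised by N, and contracting A with
    the kernel of h gives an operator that commutes with pi(N). *)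
Lemma tau_good_rep h : heis_rep s h -> tau_good h.
Proof.
have conj := heisG_conj sK two_neq0.
case=> {h} [z sz|z sz|y z sz sy y0] g Tg.
- have Jh := heisJ 0 0 sz; have [x Tx Ex] := tau_conj sK T_mem Tg.
  rewrite (tau_heisG sK two_neq0) // s0 oppr0; apply: (twist_tau Jh Tx Tg _ Ex).
  case/(TP sK T_mem): Tx => a b c e U ->; rewrite (conj _ _ _ _ _ _ _ sz U).
  by rewrite !mul0r addr0.
- have Jh := heisJ 0 1 sz; rewrite (tau_heisG sK two_neq0) // s0 oppr0 rmorph1.
  pose M := \sum_xi \sum_zeta ker (H 0 1 z) zeta xi *: blk A xi zeta.
  have twM g' : twist (H 0 1 z) g' = \tr (M *m pi g').
    rewrite mulmx_suml raddf_sum; apply: eq_bigr => xi _ /=.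
    rewrite mulmx_suml raddf_sum; apply: eq_bigr => zeta _ /=.
    by rewrite -scalemxAl mxtraceZ.
  rewrite !twM; apply: (unip_commutant_tau sK T_mem pi_fix) => // u su.
  have Tu := mem_gn sK T_mem su; have Un := U11_n su.
  have Ec : (H 0 1 z * levi (gn u) = levi (gn u) * H 0 1 z)%g.
    by rewrite (conj _ _ _ _ _ _ _ sz Un) !mul0r !mul1r !add0r.
  have VT := TV Tu.
  suff E : pi (gn u) *m M *m pi (gn u)^-1%g = M.
    by rewrite -[in RHS]E -!mulmxA -repr_mxM // mulVg pi1 mulmx1.
  apply: (eq_trace_repr pi_sc d_gt0) => g' Tg'.
  rewrite [LHS]mxtrace_mulC -!mulmxA -repr_mxM // mxtrace_mulC -!mulmxA -repr_mxM ?TM //.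
  by rewrite -twM twist_cent // twM mxtrace_mulC.
have sN1 : s (- 1) = - 1 by rewrite rmorphN rmorph1.
have UN : U11 s (- 1) 0 0 (- 1) by split; rewrite ?sN1 ?s0; ring.
have TN := mem_gl2 sK T_mem UN; have Jh := heisJ 1 y sz.
have Jth := heisJ (- 1) (- y) sz.
have [x [Tx Ehx Ex]] := aniso_conj sK two_neq0 T_mem sz sy y0 Tg.
have Ttg := tau2T Tg.
rewrite (tau_heisG sK two_neq0) // rmorph1 sy.
rewrite -[RHS](twist_tau Jh Tx Tg Ehx Ex) -[RHS](twist_conj Jh Ttg TN).
have EN : (H 1 y z * levi (gl2 (- 1) 0 0 (- 1)) = levi (gl2 (- 1) 0 0 (- 1)) * H (- 1) (- y) z)%g.
  by rewrite (conj _ _ _ _ _ _ _ sz UN); congr (_ * H _ _ _)%g; ring.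
have -> : (levi (gl2 (- 1) 0 0 (- 1))^-1 * H 1 y z * levi (gl2 (- 1) 0 0 (- 1)))%g = H (- 1) (- y) z.
  by rewrite -mulgA EN leviV mulKg.
congr twist; have [a b c e U ->] := TP sK T_mem Ttg.
rewrite -mulgA; apply: (mulgI (gl2 (- 1) 0 0 (- 1))); rewrite mulKVg !(gl2M sK T_mem) //.
by congr gl2; ring.
Qed.

(** The difference of the two sides of the identity on blocks is annihilated by
    all Heisenberg kernels, hence zero. *)
Lemma corner_tau : {in J, forall j, \tr (A *m rho (tau4 j)) = \tr (A *m rho j)}.
Proof.
apply: tr_rho_tau => xi zeta g Tg; apply/eqP; rewrite -subr_eq0; apply/eqP.
move: xi zeta.
suff E xi zeta : coef xi zeta g - coef (s zeta) (s xi) (tau2 g) = 0.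
  by move=> xi zeta; rewrite -opprB E oppr0.
move: xi zeta; apply: (heis_span sK two_neq0 G_mem J_mem Psi0 PsiD Psi_nontriv weil
  (D0 := fun xi zeta => coef xi zeta g - coef (s zeta) (s xi) (tau2 g))) => x y z sz.
have [h [t [rep Tt E]]] := heis_orbit sK two_neq0 T_mem x y sz.
have Jh : h \in J by case: rep => [z' ?|z' ?|y' z' ? ? ?]; apply: heisJ.
have Jh' := heisJ x y sz.
have := tau_good_conj Jh Jh' Tt E (tau_good_rep rep) Tg; rewrite /twist => Et.
transitivity (twist (H x y z) g - twist (tau4 (H x y z)) (tau2 g)); last by rewrite /twist Et subrr.
rewrite /twist.
have -> : \sum_xi \sum_zeta ker (tau4 (H x y z)) zeta xi * coef xi zeta (tau2 g)
   = \sum_xi \sum_zeta ker (H x y z) zeta xi * coef (s zeta) (s xi) (tau2 g).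
  rewrite exchange_big [LHS](reindex_inj (inv_inj sK)); apply: eq_bigr => xi _ /=.
  rewrite (reindex_inj (inv_inj sK)); apply: eq_bigr => zeta _ /=.
  by rewrite (tau_omega Jh') !sK.
rewrite -sumrB; apply: eq_bigr => xi _; rewrite -sumrB; apply: eq_bigr => zeta _.
by rewrite mulrBr.
Qed.

End OneCoset.

(** The hypothesis on A comes from [swap_siegel]. Taking b = z = 0 shows that
    the block at (xi, zeta) vanishes unless zeta = s xi; taking y = 0 and b = z
    shows that the remaining blocks commute with pi(N), the two scalars being
    equal. *)
Lemma swap_tau A :
    (forall b y z, s b = b -> s z = z ->
       rho (levi (gn z) * H 0 (s y) b)%g *m A = A *m rho (levi (gn b) * H 0 y z)%g) ->
  {in J, forall j, \tr (A *m rho (tau4 j)) = \tr (A *m rho j)}.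
Proof.
move=> hA.
have blkE b y z xi zeta : s b = b -> s z = z ->
    Psi (z * xi * s xi + 2%:R * y * xi + b) *: (pi (gn z) *m blk A xi zeta)
    = Psi (b * zeta * s zeta + 2%:R * s y * zeta + z) *: (blk A xi zeta *m pi (gn b)).
  move=> sb sz; have sy' := s0.
  have Jb : (levi (gn b) * H 0 y z)%g \in J := JM (leviJ (mem_gn sK T_mem sb)) (heisJ 0 y sz).
  have Jz : (levi (gn z) * H 0 (s y) b)%g \in J := JM (leviJ (mem_gn sK T_mem sz)) (heisJ 0 (s y) sb).
  have kS := kernel_siegel sK two_neq0 T_mem G_mem J_mem PsiD weil.
  have := congr1 (fun M => blk M xi zeta) (hA b y z sb sz).
  rewrite !(blkM QP) (bigD1 xi) //= big1 => [|mu nmu]; last first.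
    by rewrite rhoE // kS // (negPf nmu) mulr0 scale0r mul0mx.
  rewrite [X in _ = X](bigD1 zeta) //= [X in _ = _ + X]big1 => [|mu nmu]; last first.
    by rewrite rhoE // kS // eq_sym (negPf nmu) mulr0 scale0r mulmx0.
  rewrite !rhoE // !kS // !eqxx !mulr1 !addr0 sK !(prT_levi_heisG sK two_neq0) //.
  by rewrite -scalemxAl -scalemxAr.
have gn0 : gn 0 = 1%g :> {'GL_2[R]} by apply: gl2_1 sK.
have supp xi zeta : zeta != s xi -> blk A xi zeta = 0.
  move=> nz; apply/eqP; apply: contraNT nz => nA.
  suff E : xi - s zeta = 0 by rewrite (subr0_eq E) sK.
  apply: (Psi_detect Psi_nontriv) => x.
  have := blkE 0 (x / 2%:R) 0 xi zeta s0 s0.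
  rewrite gn0 pi1 mulmx1 mul1mx !mul0r !add0r !addr0 => /eqP.
  rewrite -subr_eq0 -scalerBl scaler_eq0 (negPf nA) orbF subr_eq0 => /eqP.
  have -> : 2%:R * (x / 2%:R) * xi = x * xi by field.
  have EW w : Psi (2%:R * s w * zeta) = Psi (2%:R * w * s zeta).
    by rewrite -Psi_s !rmorphM sK rmorph_nat.
  rewrite EW.
  have -> : 2%:R * (x / 2%:R) * s zeta = x * s zeta by field.
  move=> E; rewrite mulrC mulrBr PsiD (PsiN Psi0 PsiD) E.
  by rewrite mulfV // (Psi_neq0 Psi0 PsiD).
move=> j Jj; have [Tp Ep] := prT_tau Jj.
rewrite !tr_rho ?tau4J // Ep; apply: eq_bigr => xi _.
have coef0 zeta g : zeta != s xi -> coef A xi zeta g = 0.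
  by move=> nz; rewrite /coef supp // mul0mx mxtrace0.
rewrite (bigD1 (s xi)) //= [X in _ + X]big1 => [|zeta nz]; last by rewrite coef0 // mulr0.
rewrite [RHS](bigD1 (s xi)) //= [X in _ = _ + X]big1 => [|zeta nz]; last by rewrite coef0 // mulr0.
rewrite !addr0 (tau_omega Jj) sK; congr (_ * _).
apply: (unip_commutant_tau sK T_mem pi_fix) => // u su.
have := blkE u 0 u xi (s xi) su su; rewrite s0 sK !mulr0 !mul0r !addr0.
have -> : u * s xi * xi = u * xi * s xi by ring.
exact: (scalerI (Psi_neq0 Psi0 PsiD _)).
Qed.

Section EquivariantFunction.
Variable Phi : {'GL_4[R]} -> 'M[algC]_n.
Hypothesis PhiL : {in J & G, forall j g, Phi (j * g)%g = rho j *m Phi g}.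
Hypothesis PhiR : {in G & J, forall g j, Phi (g * j)%g = Phi g *m rho j}.

Let GJ u : u \in J -> u \in G. Proof. exact: subsetP (sub_JG J_mem) u. Qed.
Let GM (u v : {'GL_4[R]}) : u \in G -> v \in G -> (u * v)%g \in G.
Proof. by move=> Gu Gv; have := groupM Gu Gv. Qed.

Let PhiLR j1 r j2 : j1 \in J -> r \in G -> j2 \in J ->
  Phi (j1 * r * j2)%g = rho j1 *m Phi r *m rho j2.
Proof.
by move=> J1 Gr J2; rewrite (PhiR (GM (GJ J1) Gr) J2) (PhiL J1 Gr).
Qed.

Let Phi_coset r : r \in G -> tau4 r = r ->
    {in J, forall j, \tr (Phi r *m rho (tau4 j)) = \tr (Phi r *m rho j)} ->
  {in J &, forall j1 j2, \tr (Phi (tau4 (j1 * r * j2)%g)) = \tr (Phi (j1 * r * j2)%g)}.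
Proof.
move=> Gr Er hr j1 j2 J1 J2; have [T1 T2] := (tau4J J1, tau4J J2).
rewrite !tauM Er mulgA (PhiLR T2 Gr T1) (PhiLR J1 Gr J2).
rewrite [LHS]mxtrace_mulC mulmxA -repr_mxM // mxtrace_mulC -tauM (hr _ (JM J2 J1)).
by rewrite [RHS]mxtrace_mulC mulmxA -repr_mxM // [RHS]mxtrace_mulC.
Qed.

(* The centre acts on rho by Psi, and moving H 0 0 z across the torus element
   turns Psi z into Psi (a s(a) z). *)
Let Phi_torus0 a : a != 0 -> a * s a != 1 -> Phi (torus4 s a) = 0.
Proof.
move=> a0 na; have [_ Gt] := torus4P sK G_mem a0.
have sNa : s (1 - a * s a) = 1 - a * s a.
  by rewrite rmorphB rmorph1 rmorphM sK [s a * a]mulrC.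
have Na0 : 1 - a * s a != 0 by rewrite subr_eq0 eq_sym.
have [w [sw nw]] : exists w, s w = w /\ Psi w != 1.
  have [x nx] := Psi_nontriv; exists (2%:R^-1 * (x + s x)).
  have E : Psi (2%:R^-1 * (x + s x)) = Psi x.
    rewrite mulrDr PsiD -[Psi (_ * s x)]Psi_s rmorphM sK fmorphV rmorph_nat -PsiD.
    by congr Psi; field.
  by rewrite E; split=> //; rewrite !sE sK addrC.
have [z sz Dz] : exists2 z, s z = z & w = (1 - a * s a) * z.
  by exists (w / (1 - a * s a)); [rewrite fmorph_div sw sNa | rewrite mulrC divfK].
have rho_z v : s v = v -> rho (H 0 0 v) = (Psi v)%:M.
  move=> sv; apply: (blk_inj QP) => xi zeta; rewrite (blk_scalar PQ) rho_heisG // (weil_x weil) //.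
  by rewrite addr0 mulr_natr eq_sym.
have sw' : s (a * s a * z) = a * s a * z by rewrite !rmorphM sK sz [s a * a]mulrC.
have E : Psi z *: Phi (torus4 s a) = Psi (a * s a * z) *: Phi (torus4 s a).
  rewrite -mul_mx_scalar -mul_scalar_mx -!rho_z // -PhiR ?heisJ // -PhiL ?heisJ //.
  by rewrite (torus_center sK two_neq0 G_mem).
apply/eqP; apply: contraNT nw => nPhi; move/eqP: E.
rewrite -subr_eq0 -scalerBl scaler_eq0 (negPf nPhi) orbF subr_eq0 => /eqP E.
rewrite Dz mulrBl mul1r PsiD E (PsiN Psi0 PsiD) mulfV //.
exact: (Psi_neq0 Psi0 PsiD).
Qed.

(** For a representative r fixed by tau, both traces are moved to tr (Phi(r)
    rho(j2 j1)) and its flip by cyclicity. The torus representatives are not all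
    fixed by tau; those that are not lie on cosets where Phi vanishes. *)
Lemma equivariant_tau : {in G, forall g, \tr (Phi (tau4 g)) = \tr (Phi g)}.
Proof.
move=> g /(double_coset sK two_neq0 T_mem G_mem J_mem)[j1 [r [j2 [rep J1 J2 ->]]]].
have [T1 T2] := (tau4J J1, tau4J J2).
case: rep => {r} [a a0|c c0|].
- have [na|na] := eqVneq (a * s a) 1; last first.
    have sa0 : (s a)^-1 != 0 by rewrite invr_eq0 fmorph_eq0.
    have [E1 Gt] := torus4P sK G_mem a0; have [E2 Gt'] := torus4P sK G_mem sa0.
    have Et : tau4 (torus4 s a) = torus4 s (s a)^-1.
      by apply: GLval_inj; rewrite tauE E1 E2 flip_M4 fmorphV sK invrK.
    rewrite !tauM Et mulgA (PhiLR T2 Gt' T1) (PhiLR J1 Gt J2).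
    rewrite !Phi_torus0 ?mulmx0 ?mul0mx //.
    apply: contra na => /eqP E; rewrite fmorphV sK -invfM in E.
    by rewrite mulrC -[_ * _]invrK E invr1.
  have [Et Tt] := torus4_central sK T_mem G_mem na.
  have [_ Gc] := central4P G_mem na.
  rewrite Et -(mulgA j1) -(mulgA (central4 a)) (mulgA j1).
  apply: Phi_coset => //; [exact: (tau_central G_mem) | | exact: JM (leviJ Tt) J2].
  have /is_scalar_mxP[e ->] : is_scalar_mx (Phi (central4 a)).
    apply: rho_scalar_commutant => j Jj.
    by rewrite -PhiL // -PhiR // (central_comm G_mem _ na).
  move=> j Jj; rewrite !mul_scalar_mx !mxtraceZ; congr (_ * _).
  (* A scalar commutes with rho(T), so the first Weyl element covers it. *)
  have /corner_tau : {in T, forall t, rho (levi t) *m 1%:M = 1%:M *m rho (levi t)}.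
    by move=> t _; rewrite mulmx1 mul1mx.
  by move/(_ j Jj); rewrite !mul1mx.
- have [_ Gw] := Weyl_cornerP sK G_mem c0.
  apply: Phi_coset => //; first exact: (tau_corner sK G_mem c0).
  apply: corner_tau => t Tt.
  by rewrite -PhiL ?leviJ // -PhiR ?leviJ // (corner_levi sK T_mem G_mem c0 Tt).
have [_ Gw] := Weyl_swapP G_mem.
apply: Phi_coset => //; first exact: (tau_swap G_mem).
apply: swap_tau => b y z sb sz.
have [Ju Jv] := (JM (leviJ (mem_gn sK T_mem sb)) (heisJ 0 y sz), JM (leviJ (mem_gn sK T_mem sz)) (heisJ 0 (s y) sb)).
by rewrite -PhiL // -PhiR // (swap_siegel sK two_neq0 G_mem _ sb sz).
Qed.

End EquivariantFunction.

Theorem jacobi_multiplicity_free : multiplicity_free ('Ind[G] (cfRepr rho)).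
Proof.
have n_gt0 : (0 < n)%N.
  rewrite lt0n; apply/eqP=> n0.
  have /(congr1 mxtrace) : P 0 *m Q 0 = 1%:M by rewrite PQ eqxx.
  rewrite mxtrace1 mxtrace_mulC.
  have -> : \tr (Q 0 *m P 0) = 0 by apply: big1 => i; have := ltn_ord i; rewrite {2}n0.
  by move/esym/eqP; rewrite pnatr_eq0 eqn0Ngt d_gt0.
have sJG := sub_JG J_mem.
apply: (gelfand_multiplicity_free (tau := tau4) sJG) => //.
- exact: (tau_G sK G_mem).
- by move=> x y _ _; apply: tauM.
- by move=> x _; apply: tauK.
- exact: rho_scalar_commutant.
move=> N sigma S S' hS hS' g Gg.
apply: (equivariant_tau (Phi := fun g => S *m sigma g *m S')) => //.
- move=> j h Jj Gh; have Gj := subsetP sJG j Jj.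
  by rewrite repr_mxM // !mulmxA hS.
move=> h j Gh Jj; have Gj := subsetP sJG j Jj.
by rewrite repr_mxM // -!mulmxA hS'.
Qed.

End FourierJacobi.

Lemma tprod_linear_r (F : fieldType) m1 n1 m2 n2 (A : 'M[F]_(m1, n1)) a (B B' : 'M_(m2, n2)) :
  tprod A (a *: B + B') = a *: tprod A B + tprod A B'.
Proof.
elim: m1 n1 A => [|m1 IH] n1 A /=; first by rewrite scaler0 addr0.
by rewrite linearP /= IH scale_col_mx add_col_mx.
Qed.

(** * The tensor product with the Weil representation *)
Section TensorModel.
Variables (R : finFieldType) (s : {rmorphism R -> R}).
Hypothesis sK : involutive s.
Hypothesis two_neq0 : 2%:R != 0 :> R.
Variable T : {group {'GL_2[R]}}.
Hypothesis T_mem : forall g, (g \in T) =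
  (GLval g *m symp_form 1 *m (map_mx s (GLval g))^T == symp_form 1).
Variables G J : {group {'GL_4[R]}}.
Hypothesis G_mem : forall g, (g \in G) =
  (GLval g *m symp_form 2 *m (map_mx s (GLval g))^T == symp_form 2).
Hypothesis J_mem : forall u, (u \in J) =
  [&& u \in G, FJ_shape (GLval u) & [exists g in T, mid_block (GLval u) == GLval g]].
Variables (Psi eta : R -> algC) (C : algC).
Hypothesis Psi0 : Psi 0 = 1.
Hypothesis PsiD : forall x y, Psi (x + y) = Psi x * Psi y.
Hypothesis Psi_s : forall x, Psi (s x) = Psi x.
Hypothesis Psi_nontriv : exists x, Psi x != 1.
Hypothesis eta_s : forall a, a != 0 -> eta (s a)^-1 = eta a.
Variable omega : mx_representation algC J #|R|.
Hypothesis weil : weil_kernel s Psi eta C omega.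
Variables (d : nat) (pi : mx_representation algC T d).
Hypothesis pi_irr : mx_irreducible pi.
Hypothesis pi_nfi : ~ fully_induced pi.
Variable lam : mx_representation algC J d.
Hypothesis lamE : {in J, forall j, lam j = pi (prT j)}.

(** The tensor product with a 1 x 1 matrix has size d * 1, which is not
    convertible to d; pi' is pi on a space of that size. *)
Lemma triv_mx_repr : mx_repr T (fun=> 1%:M : 'M[algC]_1).
Proof. by split=> // x y _ _; rewrite mulmx1. Qed.
Let pi' := prod_repr pi (MxRepresentation triv_mx_repr).

Let pi'E : cfRepr pi' = cfRepr pi.
Proof.
apply/cfun_inP=> g Tg; rewrite !cfunE Tg /= mxtrace_prod mxtrace1 mulr1.
by [].
Qed.

Let tprod_sum (I : Type) (r : seq I) m1 n1 m2 n2 (A : 'M[algC]_(m1, n1)) (B : I -> 'M_(m2, n2)) :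
  tprod A (\sum_(i <- r) B i) = \sum_(i <- r) tprod A (B i).
Proof.
have tprod0 : tprod A (0 : 'M_(m2, n2)) = 0.
  have := tprod_linear_r A (- 1) 0 (0 : 'M_(m2, n2)); rewrite scaler0 addr0 scaleN1r addNr.
  by [].
elim: r => [|i r IH]; first by rewrite !big_nil.
rewrite !big_cons -IH; have := tprod_linear_r A 1 (B i) (\sum_(j <- r) B j).
by rewrite !scale1r.
Qed.

Let tprodZ m1 n1 m2 n2 (A : 'M[algC]_(m1, n1)) a (B : 'M_(m2, n2)) :
  tprod A (a *: B) = a *: tprod A B.
Proof.
have := tprod_linear_r A a B 0; rewrite addr0 => ->.
by have := tprod_sum [::] A (fun _ : nat => B); rewrite !big_nil => ->; rewrite addr0.
Qed.

(** The blocks of a Kronecker product are cut out by tensoring with the rows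
    and columns of the identity matrix. *)
Theorem fourier_jacobi_multiplicity_free :
  multiplicity_free ('Ind[G] (cfRepr (prod_repr lam omega))).
Proof.
pose P xi : 'M_(d * 1, d * #|R|) :=
  tprod (1%:M : 'M_d) (delta_mx 0 (enum_rank xi) : 'M[algC]_(1, #|R|)).
pose Q xi : 'M_(d * #|R|, d * 1) :=
  tprod (1%:M : 'M_d) (delta_mx (enum_rank xi) 0 : 'M[algC]_(#|R|, 1)).
have d_gt0 : (0 < d)%N by case/mx_irrP: pi_irr.
have pi'_irr : mx_irreducible pi'.
  have /cfRepr_rsimP/mx_rsim_irr : cfRepr pi == cfRepr pi' by rewrite pi'E.
  exact.
apply: (@jacobi_multiplicity_free R s sK two_neq0 T T_mem G J G_mem J_mem Psi eta C
  Psi0 PsiD Psi_s Psi_nontriv eta_s omega weil (d * 1) pi' _ _ _ _ _ P Q).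
- by rewrite muln1.
- exact: irr_scalar_commutant.
- by rewrite pi'E; apply: (unip_fixed_le1 sK T_mem).
- move=> xi zeta; rewrite /P /Q -tprodE mulmx1 mul_delta_mx_cond.
  have -> : (delta_mx 0 0 : 'M[algC]_1) = 1%:M.
    by apply/matrixP=> i j; rewrite !mxE !ord1.
  by rewrite (inj_eq enum_rank_inj) -scaler_nat tprodZ tprod1 scalemx1.
- rewrite (eq_bigr (fun xi => tprod (1%:M : 'M_d) (delta_mx (enum_rank xi) (enum_rank xi)))).
    rewrite -tprod_sum -[RHS]tprod1; congr tprod.
    apply/matrixP=> i j; rewrite summxE mxE (bigD1 (enum_val i)) //= enum_valK mxE eqxx.
    rewrite big1 ?addr0 1?eq_sym // => k nk; rewrite mxE.
    have /negPf-> : i != enum_rank k by apply: contra nk => /eqP->; rewrite enum_rankK.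
    by [].
  by move=> xi _; rewrite /P /Q -tprodE mulmx1 mul_delta_mx.
move=> j xi zeta Jj; rewrite /blk /P /Q /= -!tprodE !mulmx1 mul1mx lamE // -tprodZ.
congr tprod; rewrite -rowE -colE.
by apply/matrixP=> i i'; rewrite !mxE !ord1 eqxx mulr1.
Qed.

End TensorModel.

(** * The symplectic and the unitary group *)
(** The kernel is read off the action on delta functions. *)
Lemma fun_act_kernel (X : finType) (A : 'M[algC]_#|X|) (xi zeta : X) :
  A (enum_rank xi) (enum_rank zeta) = fun_act A (fun y => (y == zeta)%:R) xi.
Proof.
rewrite /fun_act (bigD1 zeta) //= eqxx mulr1 big1 ?addr0 // => y /negPf->.
by rewrite mulr0.
Qed.

Lemma det_M2 (R : comNzRingType) (a b c d : R) : \det (M2 a b c d) = a * d - b * c.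
Proof.
rewrite (expand_det_row _ ord0) !big_ord_recl big_ord0 !mxE /= /cofactor !det_mx11 !mxE /=.
by rewrite expr0 expr1; ring.
Qed.

Section JacobiElements.
Variables (R : finFieldType) (s : {rmorphism R -> R}).
Hypothesis sK : involutive s.
Hypothesis two_neq0 : 2%:R != 0 :> R.

Lemma diag_1g1_1 : diag_1g1 (1%:M : 'M[R]_2) = 1%:M.
Proof. by rewrite /diag_1g1 -!scalar_mx_block. Qed.

Lemma heis0 : heis s 0 0 0 = 1%:M.
Proof. by apply/esym/eq_M4; rewrite !mxE //= ?rmorph0 ?oppr0; ring. Qed.

Lemma to_GL_heisG x y z : s z = z ->
  to_GL (n := 4) (diag_1g1 1%:M *m heis s x y z) = heisG s x y z.
Proof.
move=> sz; apply: GLval_inj; rewrite (heisGE sK two_neq0) // diag_1g1_1 mul1mx.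
by apply: (to_GLE (n := 4)); apply: (unitary4_unit (heis_unitary sK two_neq0 x y sz)).
Qed.

Lemma to_GL_levi a b c d : U11 s a b c d ->
  to_GL (n := 4) (diag_1g1 (M2 a b c d) *m heis s 0 0 0) = levi (gl2 a b c d).
Proof.
move=> U; apply: GLval_inj; rewrite leviE (gl2E sK U) heis0 mulmx1.
apply: (to_GLE (n := 4)); apply: diag_1g1_unit; exact: (U11_unit sK U).
Qed.

End JacobiElements.

Section SymplecticCase.
Variables (k : finFieldType) (psi : k -> algC) (eps : mult_char k).
Hypothesis k_odd : 2%N \notin [pchar k].
Hypothesis psi_nontriv : nontrivial_additive_char psi.
Hypothesis eps_quad : nontrivial_quadratic_char eps.
Variable omega : mx_representation algC (J_Sp k) #|k|.
Hypothesis omega_Weil : is_Weil_Sp eps psi omega.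
Variables (d : nat) (pi : mx_representation algC (SL2 k) d).
Hypothesis pi_irr : mx_irreducible pi.
Hypothesis pi_nfi : ~ fully_induced pi.

Let s : {rmorphism k -> k} := idfun.
Let sK : involutive s. Proof. by []. Qed.
Let two_neq0 : 2%:R != 0 :> k.
Proof. by move: k_odd; rewrite inE. Qed.

Let T_mem (g : {'GL_2[k]}) : (g \in SL2_group k) =
  (GLval g *m symp_form 1 *m (map_mx s (GLval g))^T == symp_form 1).
Proof.
rewrite inE (M2E (GLval g)) det_M2.
move: (GLval g _ _) (GLval g _ _) (GLval g _ _) (GLval g _ _) => a b c e.
apply/eqP/eqP=> [E|/(U11P sK)[] //].
by apply/(U11P sK); split=> //=; rewrite mulrC.
Qed.

Let G_mem (g : {'GL_4[k]}) : (g \in Sp4_group k) =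
  (GLval g *m symp_form 2 *m (map_mx s (GLval g))^T == symp_form 2).
Proof. by rewrite inE /symp_mx map_mx_id. Qed.

Let J_mem (u : {'GL_4[k]}) : (u \in J_Sp_group k) =
  [&& u \in Sp4_group k, FJ_shape (GLval u)
    & [exists g in SL2_group k, mid_block (GLval u) == GLval g]].
Proof. by rewrite inE. Qed.

Let heisE x y z : heis_Sp x y z = heis s x y z.
Proof. by apply: eq_M4; rewrite !mxE //=; ring. Qed.

Let psi0 : psi 0 = 1. Proof. by case: psi_nontriv => -[]. Qed.
Let psiD x y : psi (x + y) = psi x * psi y. Proof. by case: psi_nontriv => -[_ ->]. Qed.

Let weil : weil_kernel s psi eps (gauss_sum psi 1)^-1 omega.
Proof.
have [Wx Wy Wt Wn Ww] := omega_Weil.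
have s0 : s 0 = 0 by [].
split.
- move=> x z xi zeta _; rewrite /kernel -(to_GL_heisG sK two_neq0) // -heisE fun_act_kernel Wx.
  by rewrite eq_sym.
- move=> y xi zeta; rewrite /kernel -(to_GL_heisG sK two_neq0) // -heisE fun_act_kernel Wy.
  by rewrite eq_sym mulrAC.
- move=> a xi zeta a0; have U := U11_t sK a0.
  by rewrite /kernel -(to_GL_levi sK U) -heisE fun_act_kernel Wt // eq_sym.
- move=> b xi zeta sb; have U := U11_n sb.
  by rewrite /kernel -(to_GL_levi sK U) -heisE fun_act_kernel Wn eq_sym expr2 mulrA.
move=> xi zeta; have U := U11_w s.
have := Ww 1 (fun y => (y == zeta)%:R) xi (oner_neq0 _); rewrite invr1.
rewrite /kernel -(to_GL_levi sK U) -heisE fun_act_kernel => ->; congr (_ * _).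
rewrite (bigD1 zeta) //= eqxx !mulr1 big1 ?addr0 // => y /negPf->.
by rewrite mulr0.
Qed.

Theorem symplectic_case :
  multiplicity_free ('Ind[Sp4 k] (cfRepr (prod_repr (lift_Sp pi) omega))).
Proof.
apply: (fourier_jacobi_multiplicity_free sK two_neq0 T_mem G_mem J_mem psi0 psiD
  (fun _ => erefl) _ _ weil pi_irr pi_nfi) => //.
- by case: psi_nontriv.
move=> a a0; have [sq _] := eps_quad.
have e0 : eps a != 0 by apply: contra_eq_neq (sq a a0) => ->; rewrite expr0n eq_sym oner_eq0.
apply: (mulfI e0); rewrite -mult_charM ?invr_eq0 // mulfV // mult_char1 -expr2.
by rewrite sq.
Qed.

End SymplecticCase.

Section UnitaryCase.
Variables (k : finFieldType) (E0 : fieldExtType k) (psi : k -> algC).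
Local Notation E := (finvect_type E0).
Hypothesis k_odd : 2%N \notin [pchar k].
Hypothesis E_quad : \dim {: E} = 2%N.
Hypothesis psi_nontriv : nontrivial_additive_char psi.
Variable sg : gal_of {: E}.
Hypothesis sg_nontriv : sg != 1%g.
Variable omega : mx_representation algC (J_U sg) #|E|.
Hypothesis omega_Weil : is_Weil_U psi omega.
Variables (d : nat) (pi : mx_representation algC (U2 sg) d).
Hypothesis pi_irr : mx_irreducible pi.
Hypothesis pi_nfi : ~ fully_induced pi.

Let s : {rmorphism E -> E} := sg.

Let base_inj : injective (fun t : k => t%:A : E).
Proof. exact: fmorph_inj (in_alg E). Qed.

Let two_k : 2%:R != 0 :> k.
Proof. by move: k_odd; rewrite inE. Qed.

Let two_neq0 : 2%:R != 0 :> E.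
Proof.
have -> : 2%:R = 2%:R%:A :> E by rewrite scaler_nat.
by rewrite scaler_eq0 negb_or two_k oner_eq0.
Qed.

Let sA (t : k) : s t%:A = t%:A :> E.
Proof. by rewrite -[LHS]/(sg t%:A) linearZ /= rmorph1. Qed.

(* The square of the conjugation is in the Galois group of order 2 and is not
   the conjugation itself. *)
Let sK : involutive s.
Proof.
have galE := gal_quad E_quad sg_nontriv.
have sg2 : (sg * sg)%g = 1%g.
  have Gsg : sg \in 'Gal({: E} / 1)%g by rewrite galE !inE eqxx orbT.
  have : (sg * sg)%g \in 'Gal({: E} / 1)%g by exact: (groupM Gsg Gsg).
  rewrite galE !inE => /orP[/eqP//|].
  by rewrite -[X in _ == X]mulg1 (inj_eq (mulgI sg)) (negPf sg_nontriv).
by move=> x; rewrite -[RHS](gal_id {: E}%AS) -sg2 galM ?memvf.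
Qed.

Let T_mem (g : {'GL_2[E]}) : (g \in U2_group sg) =
  (GLval g *m symp_form 1 *m (map_mx s (GLval g))^T == symp_form 1).
Proof. by rewrite inE. Qed.

Let G_mem (g : {'GL_4[E]}) : (g \in U4_group sg) =
  (GLval g *m symp_form 2 *m (map_mx s (GLval g))^T == symp_form 2).
Proof. by rewrite inE. Qed.

Let J_mem (u : {'GL_4[E]}) : (u \in J_U_group sg) =
  [&& u \in U4_group sg, FJ_shape (GLval u)
    & [exists g in U2_group sg, mid_block (GLval u) == GLval g]].
Proof. by rewrite inE. Qed.

Let tr (x : E) : k := trE sg x.
Let trA x : (tr x)%:A = x + s x. Proof. exact: trEE. Qed.

Let trD x y : tr (x + y) = tr x + tr y.
Proof. by apply: base_inj; rewrite scalerDl !trA rmorphD addrACA. Qed.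
Let tr_s x : tr (s x) = tr x.
Proof. by apply: base_inj; rewrite !trA sK addrC. Qed.
Let tr_base t : tr t%:A = 2%:R * t.
Proof. by apply: base_inj; rewrite trA sA mulr_natl mulr2n scalerDl. Qed.

Let fixedE z : s z = z -> z = (2%:R^-1 * tr z)%:A.
Proof.
move=> sz; rewrite -scalerA trA sz -mulr2n -scaler_nat scalerA mulVf //.
by rewrite scale1r.
Qed.

(* The factor 1/2 makes Psi restrict to psi on k; it also
   accounts for the factor 2 in the symplectic formula for H 0 y 0, which the
   unitary formula lacks. *)
Let Psi (x : E) : algC := psi (2%:R^-1 * tr x).
Let psi0 : psi 0 = 1. Proof. by case: psi_nontriv => -[]. Qed.
Let psiD x y : psi (x + y) = psi x * psi y. Proof. by case: psi_nontriv => -[_ ->]. Qed.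
Let Psi_base t : Psi t%:A = psi t.
Proof. by rewrite /Psi tr_base mulKf. Qed.
Let PsiD x y : Psi (x + y) = Psi x * Psi y.
Proof. by rewrite /Psi trD mulrDr psiD. Qed.
Let Psi0 : Psi 0 = 1.
Proof. by rewrite -(scale0r 1) Psi_base. Qed.
Let Psi_s x : Psi (s x) = Psi x.
Proof. by rewrite /Psi tr_s. Qed.
Let Psi_two x : Psi (2%:R * x) = psi (tr x).
Proof.
have -> : 2%:R * x = x + x by ring.
by rewrite /Psi trD; congr psi; field.
Qed.
Let Psi_nontriv : exists x, Psi x != 1.
Proof. by have [_ [t nt]] := psi_nontriv; exists t%:A; rewrite Psi_base. Qed.

Let heisE x y z : heis_U sg x y z = heis s x y z%:A.
Proof. by apply: eq_M4; rewrite !mxE //=; ring. Qed.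

Let weil : weil_kernel s Psi (fun=> 1) (- #|k|%:R^-1) omega.
Proof.
have [Wx Wy Wt Wn Ww] := omega_Weil.
have s0 : s 0 = 0 by rewrite rmorph0.
have heis0y y : heis s 0 y 0 = heis_U sg 0 y 0 by rewrite heisE scale0r.
split.
- move=> x z xi zeta sz; rewrite {1}(fixedE sz) /kernel -(to_GL_heisG sK two_neq0) // -heisE fun_act_kernel Wx.
  by rewrite eq_sym.
- move=> y xi zeta; rewrite /kernel -(to_GL_heisG sK two_neq0) // heis0y fun_act_kernel Wy.
  by rewrite eq_sym -mulrA Psi_two.
- move=> a xi zeta a0; have U := U11_t sK a0.
  by rewrite /kernel -(to_GL_levi sK U) heis0y fun_act_kernel Wt // mul1r eq_sym.
- move=> b xi zeta sb; have U := U11_n sb.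
  rewrite /kernel -(to_GL_levi sK U) heis0y fun_act_kernel {1}(fixedE sb) Wn eq_sym.
  rewrite -Psi_base; congr (Psi _ * _).
  rewrite mulrC -scalerA nmEE //.
  by rewrite [in RHS](fixedE sb) -mulrA mulr_algl.
move=> xi zeta; have U := U11_w s.
have := Ww (fun y => (y == zeta)%:R) xi.
rewrite /kernel -(to_GL_levi sK U) heis0y fun_act_kernel => ->; congr (_ * _).
rewrite (bigD1 zeta) //= eqxx !mulr1 big1 ?addr0 => [|y /negPf->]; last by rewrite mulr0.
by rewrite -mulrA Psi_two.
Qed.

Theorem unitary_case :
  multiplicity_free ('Ind[U4 sg] (cfRepr (prod_repr (lift_U pi) omega))).
Proof.
by apply: (fourier_jacobi_multiplicity_free sK two_neq0 T_mem G_mem J_mem Psi0 PsiD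
  Psi_s _ _ weil pi_irr pi_nfi).
Qed.

End UnitaryCase.

Theorem theoremB (k : finFieldType) (k_odd : 2%N \notin [pchar k])
    (E : fieldExtType k) (E_quad : \dim {: E} = 2%N)
    (psi : k -> algC) (psi_nontriv : nontrivial_additive_char psi) :
  (forall (eps : mult_char k) (eps_quad : nontrivial_quadratic_char eps)
      (omega : mx_representation algC (J_Sp k) #|k|)
      (omega_Weil : is_Weil_Sp eps psi omega)
      (d : nat) (pi : mx_representation algC (SL2 k) d)
      (pi_irr : mx_irreducible pi) (pi_nfi : ~ fully_induced pi),
    multiplicity_free
      ('Ind[Sp4 k] (cfRepr (prod_repr (lift_Sp pi) omega))))
  /\
  (forall (s : gal_of {: finvect_type E})
      (s_gal : s \in 'Gal({: finvect_type E} / 1)%g) (s_nontriv : s != 1%g)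
      (omega : mx_representation algC (J_U s) #|finvect_type E|)
      (omega_Weil : is_Weil_U psi omega)
      (d : nat) (pi : mx_representation algC (U2 s) d)
      (pi_irr : mx_irreducible pi) (pi_nfi : ~ fully_induced pi),
    multiplicity_free
      ('Ind[U4 s] (cfRepr (prod_repr (lift_U pi) omega)))).
Proof.
split=> [eps eps_quad omega omega_Weil d pi pi_irr pi_nfi
        | s _ s_nontriv omega omega_Weil d pi pi_irr pi_nfi].
  exact: (symplectic_case k_odd psi_nontriv eps_quad omega_Weil pi_irr pi_nfi).
exact: (unitary_case k_odd E_quad psi_nontriv s_nontriv omega_Weil pi_irr pi_nfi).
Qed.
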